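(* Let $(\mathcal{C},\tau)$ be a non-commutative $C^\ast$-probability space with $\tau$ faithful, let $m\in\mathbb{N}$, and put $\mathcal{A}:=\operatorname{M}_m(\mathbb{C})\otimes\mathcal{C}$ and $E:=\operatorname{id}\otimes\tau:\mathcal{A}\to\operatorname{M}_m(\mathbb{C})$. Let $(X_i)_{i\in\mathbb{N}}$ be a sequence of non-zero elements of $\mathcal{A}$. Assume: (1) all $X_i$ have the same $\ast$-distribution with respect to $E$, and $E[X_i]=0$; (2) the $X_i$ are $\ast$-free with amalgamation over $\operatorname{M}_m(\mathbb{C})$, i.e. the $\ast$-algebras $\mathcal{X}_i$ generated by $\operatorname{M}_m(\mathbb{C})$ and $X_i$ are free with respect to $E$; (3) $\sup_{i\in\mathbb{N}}\|X_i\|<\infty$. Then the sequence $(S_n)_{n\in\mathbb{N}}$ defined by $$S_n:=\frac{1}{\sqrt{n}}\sum_{i=1}^n X_i,\qquad n\in\mathbb{N},$$ converges (in distribution with respect to $E$) to an operator-valued semicircular element $s$. Moreover, there are $\kappa>0$, $c>1$, $C>0$ and $N\in\mathbb{N}$ such that, with $$\Omega:=\Big\{b\in\operatorname{GL}_m(\mathbb{C})\ \Big|\ \|b^{-1}\|<\kappa,\ \|b\|\cdot\|b^{-1}\|<c\Big\},$$ the operator-valued Cauchy transforms $G_s$ of $s$ and $G_{S_n}$ of $S_n$ satisfy (in particular they are defined on $\Omega$ for $n\ge N$) $$\|G_s(b)-G_{S_n}(b)\|\le C\,\frac{1}{\sqrt{n}}\,\|b\|\qquad\text{for all } b\in\Omega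 \text{ and } n\ge N.$$
   Context: A non-commutative $C^\ast$-probability space $(\mathcal{C},\tau)$ is a unital $C^\ast$-algebra $\mathcal{C}$ with a state $\tau$. $\operatorname{M}_m(\mathbb{C})$ is the $C^\ast$-algebra of complex $m\times m$ matrices (operator norm), and $\operatorname{GL}_m(\mathbb{C})$ its group of invertible elements. $\mathcal{A}=\operatorname{M}_m(\mathbb{C})\otimes\mathcal{C}\cong \operatorname{M}_m(\mathcal{C})$, $E(b\otimes c)=\tau(c)b$ (i.e. $\tau$ applied entrywise), and $b\in\operatorname{M}_m(\mathbb{C})$ is identified with $b\otimes 1\in\mathcal{A}$. Having the same $\ast$-distribution with respect to $E$ means that all $\operatorname{M}_m(\mathbb{C})$-valued $\ast$-moments $E[X_i^{\epsilon_1}b_1X_i^{\epsilon_2}b_2\cdots b_{k-1}X_i^{\epsilon_k}]$ ($\epsilon_j\in\{1,\ast\}$, $b_j\in\operatorname{M}_m(\mathbb{C})$) do not depend on $i$. Algebras $\mathcal{X}_i\supseteq \operatorname{M}_m(\mathbb{C})$ are free with respect to $E$ if $E[a_1\cdots a_k]=0$ whenever $a_j\in\mathcal{X}_{i_j}$, $E[a_j]=0$ for all $j$ and $i_1\ne i_2\ne\cdots\ne i_k$ (neighbouring indices distinct). An operator-valued $C^\ast$-probability space over $\operatorname{M}_m(\mathbb{C})$ is a unital $C^\ast$-algebra $\mathcal{A}'$ with a unital embedding of $\operatorname{M}_m(\mathbb{C})$ and a conditional expectation $E':\mathcal{A}'\to\operatorname{M}_m(\mathbb{C})$. An element $s$ of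 such a space (not necessarily self-adjoint) is an operator-valued semicircular element with covariance $\eta:\operatorname{M}_m(\mathbb{C})\to\operatorname{M}_m(\mathbb{C})$, $\eta(b)=E'[sbs]$, if $E'[s]=0$ and all its $\operatorname{M}_m(\mathbb{C})$-valued free cumulants of order different from $2$ vanish; equivalently, for all $k\ge2$ and $b_1,\dots,b_{k-1}\in \operatorname{M}_m(\mathbb{C})$, $$E'[sb_1s\cdots b_{k-1}s]=\sum_{j=2}^{k}\eta\big(E'[b_1sb_2\cdots sb_{j-1}]\big)\,E'[b_jsb_{j+1}\cdots b_{k-1}s],$$ where for $j=2$ the argument of $\eta$ is $b_1$ and for $j=k$ the last factor is $1$. The limit $s$ lives in some such space $(\mathcal{A}',E')$, and its covariance is $\eta(b)=E[X_ibX_i]$. Convergence of $S_n$ to $s$ in distribution means $E[S_nb_1S_n\cdots b_{k-1}S_n]\to E'[sb_1s\cdots b_{k-1}s]$ for all $k$ and all $b_j\in\operatorname{M}_m(\mathbb{C})$. For an element $a$ of an operator-valued $C^\ast$-probability space $(\mathcal{A}',E')$, the matrix-valued resolvent set is $\rho_m(a)=\{b\in\operatorname{M}_m(\mathbb{C})\mid b-a\text{ is invertible in }\mathcal{A}'\}$ and the operator-valued Cauchy transform is $G_a:\rho_m(a)\to\operatorname{M}_m(\mathbb{C})$, $G_a(b)=E'[(b-a)^{-1}]$. *)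

(* Defs.v *)
From HB Require Import structures.
Set Warnings "-notation-overridden,-notation-incompatible-prefix,-ambiguous-paths".
From mathcomp Require Import all_boot all_order all_algebra.
From mathcomp Require Import all_classical all_reals all_analysis.
From mathcomp Require Import complex.

Set Implicit Arguments.
Unset Strict Implicit.
Unset Printing Implicit Defensive.

Import Order.TTheory GRing.Theory Num.Theory.
Import numFieldNormedType.Exports.

Local Open Scope classical_set_scope.
Local Open Scope ring_scope.

Notation normc := ComplexField.Normc.normc.

(* The norm is real-valued and completeness is sequential.  The structure is
   not built on completeNormedModType: Hierarchy Builder cannot join it with
   the ring structures, as numDomainType already inherits from both a ring and
   a normed Z-module structure. *)
HB.mixin Record isCStarAlg (R : realType) A of GRing.Algebra R[i] A := {
  adj : A -> A;
  cnorm : A -> R;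
  adjD : forall a b, adj (a + b) = adj a + adj b;
  adjZ : forall (k : R[i]) a, adj (k *: a) = conjc k *: adj a;
  adjM : forall a b, adj (a * b) = adj b * adj a;
  adjK : forall a, adj (adj a) = a;
  ler_cnormD : forall a b, cnorm (a + b) <= cnorm a + cnorm b;
  cnormZ : forall (k : R[i]) a, cnorm (k *: a) = normc k * cnorm a;
  cnorm_eq0 : forall a, cnorm a = 0 -> a = 0;
  ler_cnormM : forall a b, cnorm (a * b) <= cnorm a * cnorm b;
  cnorm_adjM : forall a, cnorm (adj a * a) = cnorm a ^+ 2;
  cnorm_complete : forall u : nat -> A,
    (forall e : R, 0 < e -> exists N : nat, forall p q : nat,
       (N <= p)%N -> (N <= q)%N -> cnorm (u p - u q) < e) ->
    exists l : A, (fun n => cnorm (u n - l)) @ \oo --> (0 : R)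
}.

#[short(type="cstarAlgType")]
HB.structure Definition CStarAlg (R : realType) :=
  {A of isCStarAlg R A & GRing.Algebra R[i] A}.

Arguments adj {R A} : rename.
Arguments cnorm {R A} : rename.

Definition is_state (R : realType) (C : cstarAlgType R) (tau : {scalar C}) :=
  tau 1 = 1 /\ forall a : C, 0 <= tau (adj a * a).

Definition faithful_state (R : realType) (C : cstarAlgType R) (tau : {scalar C}) :=
  forall a : C, tau (adj a * a) = 0 -> a = 0.

(* Notions that involve only the algebraic data of a *-probability space over
   M_m(C): a unital ring A with an involution star, the inclusion iota of
   M_m(C) into A, and the expectation E. *)
Section OperatorValued.
Variables (R : realType) (m : nat) (A : nzRingType).
Local Notation M := 'M[R[i]]_m.+1.
Variables (star : A -> A) (iota : M -> A) (E : A -> M).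

Definition starpow (e : bool) (a : A) : A := if e then star a else a.

(* [:: (b_1, e_2); ...; (b_{k-1}, e_k)] encodes the *-moment
   E[a^{e_1} b_1 a^{e_2} ... b_{k-1} a^{e_k}]. *)
Definition star_moment (a : A) (e1 : bool) (w : seq (M * bool)) : M :=
  E (starpow e1 a * \prod_(p <- w) (iota p.1 * starpow p.2 a)).

Definition same_star_distribution (X : nat -> A) :=
  forall i j e1 w, star_moment (X i) e1 w = star_moment (X j) e1 w.

(* E[a b_1 a b_2 ... b_{k-1} a] for bs = [:: b_1; ...; b_{k-1}]. *)
Definition op_moment (a : A) (bs : seq M) : M :=
  E (a * \prod_(b <- bs) (iota b * a)).

(* Closure under scalar multiplication is not listed: below, S contains
   iota k%:M for every complex number k. *)
Definition star_closed (S : set A) :=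
  [/\ forall a b, S a -> S b -> S (a - b),
      forall a b, S a -> S b -> S (a * b) &
      forall a, S a -> S (star a)].

Definition gen_star_algebra (a : A) : set A :=
  smallest star_closed (range iota `|` [set a]).

Definition free_over (X : nat -> set A) :=
  forall (k : nat) (i : nat -> nat) (a : nat -> A),
    (0 < k)%N ->
    (forall j, (j < k)%N -> X (i j) (a j) /\ E (a j) = 0) ->
    (forall j, (j.+1 < k)%N -> i j <> i j.+1) ->
    E (\prod_(0 <= j < k) a j) = 0.

Definition star_free (X : nat -> A) := free_over (fun i => gen_star_algebra (X i)).

Definition op_covariance (a : A) (b : M) : M := E (a * iota b * a).

(* The moment recursion for b_1 = b and bs = [:: b_2; ...; b_{k-1}]; the index
   j of the usual formulation is p + 2.  For p = 0 the argument of eta is b,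
   and for p = size bs the last factor is E 1. *)
Definition semicircular (s : A) :=
  E s = 0 /\
  forall (b : M) (bs : seq M),
    op_moment s (b :: bs) =
    \sum_(p < (size bs).+1)
       op_covariance s (E (iota b * \prod_(c <- take p bs) (s * iota c))) *
       E (\prod_(c <- drop p bs) (iota c * s)).

Definition is_inverse (a x : A) := a * x = 1 /\ x * a = 1.

Definition resolvent_set (a : A) : set M :=
  [set b | exists x, is_inverse (iota b - a) x].

(* Meaningful for b in resolvent_set a, where the inverse is unique. *)
Definition cauchy_transform (a : A) (b : M) : M :=
  E (xget 0 [set x | is_inverse (iota b - a) x]).

End OperatorValued.

HB.mixin Record isOpCStarProbSpace (R : realType) (m : nat) A
    of CStarAlg R A := {
  op_embed : {lrmorphism 'M[R[i]]_m.+1 -> A};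
  op_embed_inj : injective op_embed;
  op_embed_adj : forall b, op_embed (map_mx conjc b)^T = adj (op_embed b);
  op_expect : {linear A -> 'M[R[i]]_m.+1};
  op_expect_embed : forall b, op_expect (op_embed b) = b;
  op_expect_bimod : forall b a b',
    op_expect (op_embed b * a * op_embed b') = b * op_expect a * b';
  op_expect_pos : forall a, exists y : 'M[R[i]]_m.+1,
    op_expect (adj a * a) = (map_mx conjc y)^T * y
}.

#[short(type="opCStarProbSpace")]
HB.structure Definition OpCStarProbSpace (R : realType) (m : nat) :=
  {A of isOpCStarProbSpace R m A & CStarAlg R A}.

Section MatrixAlgebra.
Variables (R : realType) (C : cstarAlgType R) (m : nat).

Definition mx_star (X : 'M[C]_m.+1) : 'M[C]_m.+1 := (map_mx adj X)^T.

Definition mx_embed (b : 'M[R[i]]_m.+1) : 'M[C]_m.+1 :=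
  map_mx (fun k => k%:A) b.

Definition mx_expect (tau : {scalar C}) (X : 'M[C]_m.+1) : 'M[R[i]]_m.+1 :=
  map_mx tau X.

Definition module_norm (v : 'cV[C]_m.+1) : R :=
  Num.sqrt (cnorm (\sum_i adj (v i 0) * v i 0)).

(* The C*-norm of M_m(C) is its operator norm on the Hilbert C-module C^m.
   It is taken in the extended reals so that the supremum needs no a priori
   bound. *)
Definition mx_cnorm (X : 'M[C]_m.+1) : \bar R :=
  ereal_sup [set (module_norm (X *m v))%:E | v in [set v | module_norm v <= 1]].

Definition normalized_sum (X : nat -> 'M[C]_m.+1) (n : nat) : 'M[C]_m.+1 :=
  map_mx (fun c => ((Num.sqrt n%:R)^-1)%:C%C *: c) (\sum_(i < n) X i).

End MatrixAlgebra.

Section OperatorNorm.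
Variables (R : realType) (m : nat).

Definition euclidean_norm (v : 'cV[R[i]]_m.+1) : R :=
  Num.sqrt (\sum_i normc (v i 0) ^+ 2).

Definition opnorm (b : 'M[R[i]]_m.+1) : R :=
  sup [set euclidean_norm (b *m v) | v in [set v | euclidean_norm v <= 1]].

Definition Omega (kappa c : R) : set 'M[R[i]]_m.+1 :=
  [set b | [/\ b \is a GRing.unit, opnorm b^-1 < kappa &
               opnorm b * opnorm b^-1 < c]].

End OperatorNorm.

(* s lives in an operator-valued C*-probability space and S n in (A, E). *)
Definition converges_in_distribution (R : realType) (m : nat) (A : nzRingType)
    (iota : 'M[R[i]]_m.+1 -> A) (E : A -> 'M[R[i]]_m.+1) (S : nat -> A)
    (A' : opCStarProbSpace R m) (s : A') :=
  forall bs : seq 'M[R[i]]_m.+1,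
    (fun n => opnorm (op_moment iota E (S n) bs
                      - op_moment op_embed op_expect s bs)) @ \oo --> (0 : R).

(* Main.v *)
(* The limit lives in the C*-algebra A' of bounded sequences in M_m(C), with E'
   the limit of E along a free ultrafilter; s is the sequence (S_n) itself, so
   E'[s b s ... s] is the limit of the moments of S_n.

   Boundedness of (S_n) is a Voiculescu-type inequality.  Every x in the algebra
   generated by the X_i is b + sum_i w_i, with w_i a sum of alternating centered
   words starting with index i and these summands orthogonal in L2(tr o tau).
   Then <y, sum_i X_i x> splits into
   sum_i <y, X_i (x - w_i)> + <X_i^* (y - v_i), w_i> + <v_i, X_i w_i>,
   each sum being O(sqrt n) |x| |y| because X_i (x - w_i) starts with index i.
   Faithfulness of tau turns this L2 bound into a bound of the C*-norms.

   Replacing, in E[X_i b_1 S_n ... S_n], all but one occurrence of X_i by the sum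
   without X_i, freeness gives the semicircular moment recursion up to an error
   O(L^k / sqrt n).  The moments of S_n and S_l thus differ by
   O(G^k (n^-1/2 + l^-1/2)), and so do the Cauchy transforms, by the Neumann
   series, once |b^-1| is small. *)
Require Import Defs.
From HB Require Import structures.
Set Warnings "-notation-overridden,-notation-incompatible-prefix,-ambiguous-paths".
Set Warnings "-redundant-canonical-projection".
From mathcomp Require Import all_boot all_order all_algebra.
From mathcomp Require Import all_classical all_reals all_analysis.
From mathcomp Require Import complex ring lra.

Set Implicit Arguments.
Unset Strict Implicit.
Unset Printing Implicit Defensive.

Import Order.TTheory GRing.Theory Num.Theory.
Import numFieldNormedType.Exports.

Local Open Scope classical_set_scope.
Local Open Scope ring_scope.

(** * Square roots in a C*-algebra *)

(** A C*-algebra is given here by the C*-identity and completeness alone, so every spectral tool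
    comes from one source: an iteration for a square root of [1 - t] with [cnorm t <= 1]. It yields
    square roots, absolute values and positive parts. Norm bounds then follow by writing [h] as the
    mean of two multiples of unitaries.

    The obstacle in the norm estimate is that the L2 bound for [S n] is available only on
    decomposable elements, not on all of [A]. It is tested on the vectors [h ^+ n *: delta_mx 0 0],
    where [h = adj c * c] for an entry [c] of [S n]. These stay decomposable, and their squared L2
    norms are moments of [h], whose growth rate bounds [cnorm h] since [tau] is faithful.

    Estimates use the sum of the norms of the entries, which is submultiplicative; comparison with
    operator norms costs factors [m.+1 ^ 2].

    The moments of [S n] are Cauchy by themselves; the ultrafilter serves to define [E'] on all of
    [A']. A resolvent of the sequence [s] in [A'] has the resolvents of the [S n] as components, so
    one inverse serves both Cauchy transforms. *)

Section ComplexNorm.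
Variable R : realType.

Lemma normc_ge0 (z : R[i]) : 0 <= normc z.
Proof. by case: z => a b; rewrite /= sqrtr_ge0. Qed.

Lemma normc_real (r : R) : normc r%:C%C = `|r|.
Proof. by rewrite /= expr0n addr0 sqrtr_sqr. Qed.

Lemma normcN (z : R[i]) : normc (- z) = normc z.
Proof. by case: z => a b; rewrite /= !sqrrN. Qed.

Lemma ler_normcD (z w : R[i]) : normc (z + w) <= normc z + normc w.
Proof. exact: (@le_normcD R z w). Qed.

Lemma normc_conj (z : R[i]) : normc (conjc z) = normc z.
Proof. by case: z => a b; rewrite /= sqrrN. Qed.

Lemma Re_conjc (z : R[i]) : complex.Re (conjc z) = complex.Re z.
Proof. by case: z. Qed.

Lemma ReD (z w : R[i]) : complex.Re (z + w) = complex.Re z + complex.Re w.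
Proof. by case: z w => [a b] [c d]. Qed.

Lemma ReN (z : R[i]) : complex.Re (- z) = - complex.Re z.
Proof. by case: z. Qed.

Lemma ImN (z : R[i]) : complex.Im (- z) = - complex.Im z.
Proof. by case: z. Qed.

Lemma ImD (z w : R[i]) : complex.Im (z + w) = complex.Im z + complex.Im w.
Proof. by case: z w => [a b] [c d]. Qed.

Lemma normc_i : normc ('i%C : R[i]) = 1.
Proof. by rewrite /= expr0n add0r expr1n sqrtr1. Qed.

Lemma normc_Re (z : R[i]) : `|complex.Re z| <= normc z.
Proof.
case: z => a b /=; rewrite -sqrtr_sqr ler_sqrt ?addr_ge0 ?sqr_ge0 //.
by rewrite lerDl sqr_ge0.
Qed.

Lemma normc_Im (z : R[i]) : `|complex.Im z| <= normc z.
Proof.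
case: z => a b /=; rewrite -sqrtr_sqr ler_sqrt ?addr_ge0 ?sqr_ge0 //.
by rewrite lerDr sqr_ge0.
Qed.

Lemma normc_le_ReIm (z : R[i]) : normc z <= `|complex.Re z| + `|complex.Im z|.
Proof.
rewrite [z in normc z]complexE; apply: le_trans (ler_normcD _ _) _.
by rewrite ComplexField.Normc.normcM normc_i !normc_real mul1r.
Qed.

(** The phase is the conjugate of [z] divided by its modulus. It reduces bounds on a modulus to
    bounds on real parts. *)
Lemma normc_phase (z : R[i]) :
  exists u : R[i], normc u = 1 /\ complex.Re (u * z) = normc z.
Proof.
have [->|z0] := eqVneq z 0.
  by exists 1; rewrite ComplexField.Normc.normc1 mulr0 ComplexField.Normc.normc0.
have nz0 : normc z != 0.
  by apply: contraNneq z0 => /ComplexField.Normc.eq0_normc ->.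
exists ((normc z)^-1%:C%C * conjc z); split.
  rewrite ComplexField.Normc.normcM normc_real normc_conj normfV.
  by rewrite (ger0_norm (normc_ge0 z)) mulVf.
have E : complex.Re (conjc z * z) = normc z ^+ 2.
  case: z {z0 nz0} => a b /=.
  rewrite sqr_sqrtr; first by rewrite !expr2 mulNr opprK.
  by rewrite addr_ge0 ?sqr_ge0.
rewrite -mulrA.
have ReZ (r : R) w : complex.Re (r%:C%C * w) = r * complex.Re w.
  by case: w => a b /=; rewrite mul0r subr0.
by rewrite ReZ E expr2 mulrA mulVf // mul1r.
Qed.

End ComplexNorm.

Section CStarBasics.
Variables (R : realType) (A : cstarAlgType R).
Implicit Types (a b c h k t x : A) (r : R).

Lemma cadj0 : adj (0 : A) = 0.
Proof. by apply: (@addrI _ (adj 0)); rewrite -adjD !addr0. Qed.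

Lemma cadjN a : adj (- a) = - adj a.
Proof. by apply: (@addrI _ (adj a)); rewrite -adjD !subrr cadj0. Qed.

Lemma cadjB a b : adj (a - b) = adj a - adj b.
Proof. by rewrite adjD cadjN. Qed.

Lemma cadj1 : adj (1 : A) = 1.
Proof. by have := adjM (adj 1) (1 : A); rewrite mulr1 adjK mulr1. Qed.

Lemma cadj_sum (I : Type) (s : seq I) (P : pred I) (F : I -> A) :
  adj (\sum_(i <- s | P i) F i) = \sum_(i <- s | P i) adj (F i).
Proof. exact: (big_morph _ adjD cadj0). Qed.

Lemma cadjZr r a : adj (r%:C%C *: a) = r%:C%C *: adj a.
Proof. by rewrite Defs.adjZ conjc_real. Qed.

Lemma cnorm0 : cnorm (0 : A) = 0.
Proof. by rewrite -(scale0r (0 : A)) cnormZ ComplexField.Normc.normc0 mul0r. Qed.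

Lemma cnormN a : cnorm (- a) = cnorm a.
Proof.
by rewrite -scaleN1r cnormZ normcN ComplexField.Normc.normc1 mul1r.
Qed.

Lemma cnorm_ge0 a : 0 <= cnorm a.
Proof.
have := ler_cnormD a (- a); rewrite subrr cnorm0 cnormN; lra.
Qed.

Lemma cnormZr r a : cnorm (r%:C%C *: a) = `|r| * cnorm a.
Proof. by rewrite cnormZ normc_real. Qed.

Lemma ler_cnormB a b : cnorm (a - b) <= cnorm a + cnorm b.
Proof. by rewrite -(cnormN b) ler_cnormD. Qed.

Lemma cnormBC a b : cnorm (a - b) = cnorm (b - a).
Proof. by rewrite -cnormN opprB. Qed.

Lemma cnorm1 : cnorm (1 : A) = 1.
Proof.
have := cnorm_adjM (1 : A); rewrite cadj1 mulr1.
have [/cnorm_eq0 /eqP|n0] := eqVneq (cnorm (1 : A)) 0; first by rewrite oner_eq0.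
by rewrite expr2 -{1}[cnorm 1]mulr1 => /(mulfI n0).
Qed.

Lemma cnorm_adj a : cnorm (adj a) = cnorm a.
Proof.
have H b : cnorm b <= cnorm (adj b).
  have [->|n0] := eqVneq (cnorm b) 0; first exact: cnorm_ge0.
  have b0 : 0 < cnorm b by rewrite lt_neqAle eq_sym n0 cnorm_ge0.
  by rewrite -(ler_pM2r b0) -expr2 -cnorm_adjM ler_cnormM.
by apply/eqP; rewrite eq_le H -{2}[a]adjK H.
Qed.

Lemma cnorm_sqr_sa a : adj a = a -> cnorm (a * a) = cnorm a ^+ 2.
Proof. by move=> h; rewrite -cnorm_adjM h. Qed.

(** Convergence is spelled out because [cnorm] is a bare function here, not the norm of a normed
    module. *)
Definition ccvg (u : nat -> A) (l : A) :=
  forall e : R, 0 < e -> exists N, forall n, (N <= n)%N -> cnorm (u n - l) < e.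

Lemma ccvg_complete (u : nat -> A) :
  (forall e : R, 0 < e -> exists N : nat, forall p q : nat,
       (N <= p)%N -> (N <= q)%N -> cnorm (u p - u q) < e) ->
  exists l, ccvg u l.
Proof.
move=> /cnorm_complete [l hl]; exists l => e e0.
move/cvgrPdist_lt : hl => /(_ e e0) [N _ hN]; exists N => n Nn.
have := hN n Nn; rewrite /= sub0r normrN => /(le_lt_trans _); apply.
exact: ler_norm.
Qed.

Lemma ccvg_uniq u l l' : ccvg u l -> ccvg u l' -> l = l'.
Proof.
move=> h h'; apply/eqP; rewrite -subr_eq0; apply/eqP/cnorm_eq0.
apply/eqP; rewrite eq_le cnorm_ge0 andbT; apply/ler_addgt0Pl => e e0.
rewrite addr0.
have e2 : 0 < e / 2 by lra.
have [N hN] := h _ e2; have [N' hN'] := h' _ e2.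
have := hN (maxn N N') (leq_maxl _ _); have := hN' (maxn N N') (leq_maxr _ _).
set w := u _ => a b.
have -> : l - l' = (w - l') - (w - l) by rewrite opprB [RHS]addrC addrA subrK.
by have := ler_cnormB (w - l') (w - l); lra.
Qed.

Lemma ccvg_lip (f : A -> A) (k : R) u l : 0 <= k ->
  (forall x y, cnorm (f x - f y) <= k * cnorm (x - y)) ->
  ccvg u l -> ccvg (f \o u) (f l).
Proof.
move=> k0 hf h e e0; have k1 : 0 < k + 1 by lra.
have [N hN] := h (e / (k + 1)) (divr_gt0 e0 k1); exists N => n Nn /=.
apply: le_lt_trans (hf _ _) _; have := hN n Nn.
rewrite ltr_pdivlMr // => H.
by have := cnorm_ge0 (u n - l); nra.
Qed.

Lemma ccvg_norm_le u l r : (forall n, cnorm (u n) <= r) -> ccvg u l -> cnorm l <= r.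
Proof.
move=> h hl; apply/ler_addgt0Pl => e e0; have [N /(_ N (leqnn N)) hN] := hl e e0.
have -> : l = u N - (u N - l) by rewrite opprB [RHS]addrC subrK.
by have := ler_cnormB (u N) (u N - l); have := h N; lra.
Qed.

Lemma ccvgS u l : ccvg u l -> ccvg (fun n => u n.+1) l.
Proof.
by move=> h e e0; have [N hN] := h e e0; exists N => n Nn; apply: hN; rewrite leqW.
Qed.

Lemma ccvg_sqr u l : (forall n, cnorm (u n) <= 1) -> ccvg u l ->
  ccvg (fun n => u n * u n) (l * l).
Proof.
move=> h hl; have l1 := ccvg_norm_le h hl.
move=> e e0; have e2 : 0 < e / 2 by lra.
have [N hN] := hl _ e2; exists N => n /hN H.
have -> : u n * u n - l * l = u n * (u n - l) + (u n - l) * l.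
  by rewrite mulrBr mulrBl addrA subrK.
have := ler_cnormD (u n * (u n - l)) ((u n - l) * l).
have := ler_cnormM (u n) (u n - l); have := ler_cnormM (u n - l) l.
have := h n; have := cnorm_ge0 (u n - l).
nra.
Qed.

(* The scalar iteration y' = (1 + y^2) / 2, whose increments dominate those of
   the operator iteration below. *)
Fixpoint sqrt_maj (n : nat) : R :=
  if n is n'.+1 then (1 + sqrt_maj n' ^+ 2) / 2 else 0.

Lemma sqrt_maj01 n : 0 <= sqrt_maj n <= 1.
Proof. elim: n => [|n /= IH]; [rewrite /=; lra | nra]. Qed.

Lemma sqrt_maj_mono n : sqrt_maj n <= sqrt_maj n.+1.
Proof. by rewrite /=; have := sqr_ge0 (sqrt_maj n - 1); lra. Qed.

Lemma sqrt_maj_cauchy (e : R) : 0 < e ->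
  exists N, forall p q : nat, (N <= p)%N -> (p <= q)%N -> sqrt_maj q - sqrt_maj p < e.
Proof.
move=> e0.
have H : nondecreasing_seq sqrt_maj.
  by apply/nondecreasing_seqP => n; exact: sqrt_maj_mono.
have c : cvgn sqrt_maj.
  apply: nondecreasing_is_cvgn => //; exists 1 => _ [n _ <-].
  by case/andP : (sqrt_maj01 n).
have [N _ hN] := (proj1 (@cvgrPdist_lt _ _ _ _ _ _ _) c) e e0.
exists N => p q Np pq.
have := hN p Np => /=; have := nondecreasing_cvgn_le H c q.
rewrite ltr_norml; lra.
Qed.

Fixpoint sqrt_iter (t : A) (n : nat) : A :=
  if n is n'.+1 then (2^-1 : R)%:C%C *: (t + sqrt_iter t n' * sqrt_iter t n') else 0.

Lemma sqrt_iter_maj t n : cnorm t <= 1 -> cnorm (sqrt_iter t n) <= sqrt_maj n.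
Proof.
move=> t1; elim: n => [|n IH] /=; first by rewrite cnorm0.
rewrite cnormZr ger0_norm ?invr_ge0 ?ler0n //.
have := ler_cnormD t (sqrt_iter t n * sqrt_iter t n).
have := ler_cnormM (sqrt_iter t n) (sqrt_iter t n).
have := cnorm_ge0 (sqrt_iter t n).
nra.
Qed.

(** The new increment is half of [x * (x - y) + (x - y) * y], an identity that requires no
    commutation. Its norm is at most [(p + q) * (p - q) / 2], which is exactly the increment of the
    majorant. *)
Lemma sqrt_iter_incr t n : cnorm t <= 1 ->
  cnorm (sqrt_iter t n.+1 - sqrt_iter t n) <= sqrt_maj n.+1 - sqrt_maj n.
Proof.
move=> t1; elim: n => [|n IH].
  rewrite /= subr0 mulr0 addr0 cnormZr ger0_norm ?invr_ge0 ?ler0n //.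
  by rewrite expr0n /= addr0 subr0; lra.
set x := sqrt_iter t n.+1 in IH *; set y := sqrt_iter t n in IH *.
have -> : sqrt_iter t n.+2 - x = (2^-1 : R)%:C%C *: (x * (x - y) + (x - y) * y).
  rewrite {2}/x /= -/x -/y -scalerBr; congr (_ *: _).
  by rewrite mulrBr mulrBl addrA subrK opprD addrACA subrr add0r.
rewrite cnormZr ger0_norm ?invr_ge0 ?ler0n //.
have := ler_cnormD (x * (x - y)) ((x - y) * y).
have := ler_cnormM x (x - y); have := ler_cnormM (x - y) y.
have := sqrt_iter_maj n t1; have := sqrt_iter_maj n.+1 t1.
rewrite -/x -/y => hx hy h1 h2 h3.
have -> : sqrt_maj n.+2 = (1 + sqrt_maj n.+1 ^+ 2) / 2 by [].
have E : sqrt_maj n.+1 = (1 + sqrt_maj n ^+ 2) / 2 by [].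
have := cnorm_ge0 (x - y); have := cnorm_ge0 x; have := cnorm_ge0 y.
set p := sqrt_maj n.+1 in hx IH E *; set q := sqrt_maj n in hy IH E *.
rewrite {2}E; nra.
Qed.

Lemma sqrt_iter_dist t p q : cnorm t <= 1 -> (p <= q)%N ->
  cnorm (sqrt_iter t q - sqrt_iter t p) <= sqrt_maj q - sqrt_maj p.
Proof.
move=> t1 /subnK <-; elim: (q - p)%N => [|k IH]; first by rewrite add0n !subrr cnorm0.
rewrite addSn -(subrK (sqrt_iter t (k + p)) (sqrt_iter t (k + p).+1)) -addrA.
apply: le_trans (ler_cnormD _ _) _.
have := sqrt_iter_incr (k + p) t1; lra.
Qed.

(** The limit [x] of the iteration satisfies [x + x = t + x * x], that is, [1 - x] is a square root
    of [1 - t]. Self-adjointness, the norm bound and commutation hold along the iteration and pass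
    to the limit. The boundary case [cnorm t = 1] must be covered; the majorant then converges
    without a geometric rate, which is why a monotone real sequence controls the increments. *)
Lemma sqrt1B t : adj t = t -> cnorm t <= 1 ->
  exists x : A, [/\ adj x = x, cnorm x <= 1, (1 - x) * (1 - x) = 1 - t &
                forall z, z * t = t * z -> z * x = x * z].
Proof.
move=> tsa t1; set u := sqrt_iter t.
have u1 n : cnorm (u n) <= 1.
  by apply: le_trans (sqrt_iter_maj n t1) _; case/andP : (sqrt_maj01 n).
have [l hl] : exists l, ccvg u l.
  apply: ccvg_complete => e e0; have [N hN] := sqrt_maj_cauchy e0.
  exists N => p q Np Nq; case/orP: (leq_total p q) => pq.
    by rewrite cnormBC; apply: le_lt_trans (sqrt_iter_dist t1 pq) (hN _ _ Np pq).
  exact: le_lt_trans (sqrt_iter_dist t1 pq) (hN _ _ Nq pq).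
have usa n : adj (u n) = u n.
  elim: n => [|n IH]; first exact: cadj0.
  by rewrite /u /= -/u cadjZr adjD adjM IH tsa.
have ucomm z : z * t = t * z -> forall n, z * u n = u n * z.
  move=> zt; elim => [|n IH]; first by rewrite /u /= mulr0 mul0r.
  rewrite /u /= -/u -scalerAr -scalerAl mulrDr mulrDl zt; congr (_ *: (_ + _)).
  by rewrite mulrA IH -mulrA IH mulrA.
exists l; split.
- apply: (@ccvg_uniq u) => //.
  have := @ccvg_lip adj 1 u l ler01 _ hl.
  rewrite (_ : adj \o u = u); last by apply/funext => n /=; rewrite usa.
  by apply=> x y; rewrite mul1r -cadjB cnorm_adj.
- exact: ccvg_norm_le u1 hl.
- have E : l = (2^-1 : R)%:C%C *: (t + l * l).
    apply: (@ccvg_uniq (fun n => u n.+1)); first exact: ccvgS.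
    apply: (@ccvg_lip (fun x => (2^-1 : R)%:C%C *: (t + x)) 1 (fun n => u n * u n)) => //.
      move=> x y; rewrite -scalerBr opprD addrACA subrr add0r cnormZr.
      rewrite ger0_norm ?invr_ge0 ?ler0n //.
      by have := cnorm_ge0 (x - y); lra.
    exact: ccvg_sqr.
  have {}E : l + l = t + l * l.
    rewrite {1 2}E -scalerDl -rmorphD /=.
    by rewrite (_ : 2^-1 + 2^-1 = 1 :> R) ?scale1r //; lra.
  rewrite mulrBr mulr1 mulrBl mul1r opprB.
  have -> : 1 - l + (l * l - l) = 1 + l * l - (l + l).
    by rewrite opprD !addrA; congr (_ - _); rewrite -!addrA; congr (_ + _); rewrite addrC.
  by rewrite E opprD addrACA subrr addr0.
- move=> z zt; apply: (@ccvg_uniq (fun n => z * u n)).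
    apply: (@ccvg_lip (fun x => z * x) (cnorm z)) => // [|x y]; first exact: cnorm_ge0.
    by rewrite -mulrBr ler_cnormM.
  rewrite (_ : (fun n => z * u n) = (fun x => x * z) \o u); last first.
    by apply/funext => n /=; exact: ucomm.
  apply: (@ccvg_lip (fun x => x * z) (cnorm z)) => // [|x y]; first exact: cnorm_ge0.
  by rewrite -mulrBl mulrC ler_cnormM.
Qed.

(* A self-adjoint [h] with [h^2 + p^2 = r^2], [p] self-adjoint commuting with
   [h], is the real part of the r-fold [h + i p] of a unitary. *)
Lemma cnorm_unitary_part h (p : A) r : 0 <= r -> adj h = h -> adj p = p ->
  h * p = p * h -> h * h + p * p = (r ^+ 2)%:C%C%:A ->
  cnorm (h + 'i%C *: p) = r.
Proof.
move=> r0 hh hp hc E.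
have Ei : 'i%C * 'i%C = -1 :> R[i] by rewrite -expr2 sqr_i.
have : cnorm (adj (h + 'i%C *: p) * (h + 'i%C *: p)) = r ^+ 2.
  rewrite adjD Defs.adjZ hh hp.
  have -> : conjc 'i%C = - 'i%C :> R[i] by apply/eqP; rewrite eq_complex /= oppr0 !eqxx.
  rewrite mulrDl !mulrDr scaleNr !mulNr -!scalerAl -!scalerAr scalerA Ei scaleN1r opprK.
  rewrite hc -addrA (addrA _ (- _)) subrr add0r E cnormZr cnorm1 mulr1.
  by rewrite ger0_norm // sqr_ge0.
rewrite cnorm_adjM => /eqP; rewrite eqrXn2 // ?cnorm_ge0 //; exact/eqP.
Qed.

(** [h + h] is the sum of [h + 'i *: p] and [h - 'i *: p], both of norm [r]. This replaces the
    spectral radius: a norm bound on [h] follows from a square root of [r^2 - h^2]. *)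
Lemma cnorm_le_of_sqr_add h (p : A) r : 0 <= r -> adj h = h -> adj p = p ->
  h * p = p * h -> h * h + p * p = (r ^+ 2)%:C%C%:A -> cnorm h <= r.
Proof.
move=> r0 hh hp hc E.
have n1 := cnorm_unitary_part r0 hh hp hc E.
have n2 : cnorm (h + 'i%C *: (- p)) = r.
  by apply: cnorm_unitary_part => //; rewrite ?cadjN ?hp ?mulrN ?mulNr ?hc ?opprK.
have : cnorm (h + h) <= r + r.
  rewrite -{1}n1 -n2; apply: le_trans (ler_cnormD _ _).
  by rewrite scalerN addrACA subrr addr0.
rewrite (_ : h + h = (2 : R)%:C%C *: h).
  by rewrite cnormZr ger0_norm ?ler0n //; lra.
by rewrite (_ : 2%:C%C = 1 + 1 :> R[i]) ?scalerDl ?scale1r // -(rmorph1 (real_complex R)) -rmorphD.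
Qed.

(** Makes [sqrt1B] applicable to [1 - k * k], which produces the square root of [k * k], the
    absolute value of [k]. *)
Lemma cnorm_1Bsqr k : adj k = k -> cnorm k <= 1 -> cnorm (1 - k * k) <= 1.
Proof.
move=> ksa k1.
have kk : adj (k * k) = k * k by rewrite adjM ksa.
have kk1 : cnorm (k * k) <= 1.
  by rewrite cnorm_sqr_sa //; have := cnorm_ge0 k; nra.
have [x [xsa _ hx hc]] := sqrt1B kk kk1.
have [y [ysa _ hy hcy]] := sqrt1B kk kk1.
set p := 1 - x in hx.
have psa : adj p = p by rewrite cadjB cadj1 xsa.
have kp : k * p = p * k by rewrite mulrBr mulrBl mulr1 mul1r hc // mulrA.
clearbody p.
have E : k * k + p * p = (1 ^+ 2)%:C%C%:A by rewrite hx addrC subrK expr1n scale1r.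
have n1 := cnorm_unitary_part ler01 ksa psa kp E.
(* 1 - k^2 = (2 - u^2 - (u^* )^2) / 4 for the unitary u = k + i p *)
have n2 : cnorm (k + 'i%C *: (- p)) = 1.
  by apply: cnorm_unitary_part => //; rewrite ?cadjN ?psa ?mulrN ?mulNr ?kp ?opprK.
set u := k + _ in n1; set v := k + _ in n2.
have Ei : 'i%C * 'i%C = -1 :> R[i] by rewrite -expr2 sqr_i.
have Euv : u * u + v * v = (2 : R)%:C%C *: (k * k - p * p).
  rewrite /u /v !(mulrDl, mulrDr) -!scalerAl -!scalerAr !scalerA !Ei.
  rewrite !mulrN !mulNr opprK kp !scalerN !scaleN1r.
  set a := k * k; set b := p * p; set c := _ *: (p * k).
  rewrite (_ : 2%:C%C = 1 + 1 :> R[i]) ?scalerDl ?scale1r; last first.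
    by rewrite -(rmorph1 (real_complex R)) -rmorphD.
  rewrite [LHS]addrACA (addrACA a c a) subrr addr0 (addrACA c) subrr add0r.
  by rewrite addrACA.
have E4 : (4 : R)%:C%C *: (1 - k * k) = (2 : R)%:C%C *: 1 - (u * u + v * v).
  rewrite Euv hx -scalerBr (_ : 4%:C%C = 2%:C%C * 2%:C%C :> R[i]); last first.
    by rewrite -rmorphM /=; congr (_%:C%C); lra.
  rewrite -scalerA; congr (_ *: _).
  rewrite (_ : 2%:C%C = 1 + 1 :> R[i]) ?scalerDl ?scale1r; last first.
    by rewrite -(rmorph1 (real_complex R)) -rmorphD.
  by rewrite opprB addrCA.
have : cnorm ((4 : R)%:C%C *: (1 - k * k)) <= 4.
  rewrite E4; apply: le_trans (ler_cnormB _ _) _.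
  rewrite cnormZr cnorm1 ger0_norm ?ler0n //.
  have := ler_cnormD (u * u) (v * v).
  have := ler_cnormM u u; have := ler_cnormM v v; rewrite n1 n2; lra.
rewrite cnormZr ger0_norm ?ler0n //; lra.
Qed.

(** [q * q] is the absolute value of [k]; giving its square root [q] exhibits its positivity
    algebraically. After rescaling [k] to [k'] in the unit ball, [sqrt1B] is used twice: on
    [1 - k' * k'], which makes [1 - x] the absolute value of [k'], and then on [x] to take the root
    of [1 - x]. *)
Lemma abs_exists k : adj k = k -> exists q : A, [/\ adj q = q,
    (q * q) * (q * q) = k * k & forall z, z * k = k * z -> z * q = q * z].
Proof.
move=> ksa; pose r := cnorm k + 1.
have r0 : 0 < r by rewrite ltr_wpDl ?cnorm_ge0.
pose k' := (r^-1)%:C%C *: k.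
have k'sa : adj k' = k' by rewrite cadjZr ksa.
have k'1 : cnorm k' <= 1.
  rewrite cnormZr gtr0_norm ?invr_gt0 // mulrC ler_pdivrMr // mul1r.
  by rewrite /r; lra.
have sa1 : adj (1 - k' * k') = 1 - k' * k' by rewrite cadjB cadj1 adjM k'sa.
have [x [xsa x1 hx hcx]] := sqrt1B sa1 (cnorm_1Bsqr k'sa k'1).
have [y [ysa y1 hy hcy]] := sqrt1B xsa x1.
exists ((Num.sqrt r)%:C%C *: (1 - y)); split.
- by rewrite cadjZr cadjB cadj1 ysa.
- have -> : (Num.sqrt r)%:C%C *: (1 - y) * ((Num.sqrt r)%:C%C *: (1 - y))
      = r%:C%C *: (1 - x).
    by rewrite -scalerAl -scalerAr scalerA hy -rmorphM /= -expr2 sqr_sqrtr ?ltW.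
  rewrite -scalerAl -scalerAr scalerA hx opprB [1 + _]addrC subrK -rmorphM /=.
  rewrite /k' -scalerAl -scalerAr !scalerA -!rmorphM /=.
  by rewrite (_ : _ * _ = 1) ?scale1r //; field; rewrite gt_eqF.
- move=> z zk; rewrite -scalerAl -scalerAr; congr (_ *: _).
  rewrite mulrBr mulrBl mulr1 mul1r hcy // hcx //.
  rewrite mulrBr mulrBl mulr1 mul1r; congr (_ - _).
  rewrite /k' -!scalerAl -!scalerAr -!scalerAl; congr (_ *: (_ *: _)).
  by rewrite mulrA zk -mulrA zk mulrA.
Qed.

End CStarBasics.

(** * Faithful states and norms *)

(** The common source of the Cauchy-Schwarz inequalities below. For [c = 0] the affine function
    would take the value [-1] at [s = - (a + 1) / (2 * b)] if [b] were non-zero. *)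
Lemma sqr_le_of_discr (R : realType) (a b c : R) : 0 <= a -> 0 <= c ->
  (forall s : R, 0 <= a + 2 * s * b + s ^+ 2 * c) -> b ^+ 2 <= a * c.
Proof.
move=> a0 c0 H; have [cz|cn] := eqVneq c 0.
  have [->|bn] := eqVneq b 0; first by rewrite expr0n /= mulr_ge0.
  have := H (- (a + 1) / (2 * b)).
  have -> : 2 * (- (a + 1) / (2 * b)) * b = - (a + 1) by field.
  by rewrite cz mulr0; lra.
have cp : 0 < c by rewrite lt_neqAle eq_sym cn.
have := H (- b / c).
have -> : a + 2 * (- b / c) * b + (- b / c) ^+ 2 * c = (a * c - b ^+ 2) / c by field.
by rewrite pmulr_lge0 ?invr_gt0 // subr_ge0.
Qed.

Section State.
Variables (R : realType) (C : cstarAlgType R) (tau : {scalar C}).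
Hypothesis tau_state : is_state tau.
Implicit Types (a b c h x y : C) (r : R).

Definition rtau a : R := complex.Re (tau a).

Lemma rtauD a b : rtau (a + b) = rtau a + rtau b.
Proof. by rewrite /rtau linearD ReD. Qed.

Lemma rtau0 : rtau 0 = 0.
Proof. by rewrite /rtau linear0. Qed.

Lemma rtauN a : rtau (- a) = - rtau a.
Proof. by rewrite /rtau linearN ReN. Qed.

Lemma rtauB a b : rtau (a - b) = rtau a - rtau b.
Proof. by rewrite rtauD rtauN. Qed.

Lemma rtauZ r a : rtau (r%:C%C *: a) = r * rtau a.
Proof. by rewrite /rtau linearZ /=; case: (tau a) => u v /=; rewrite mul0r subr0. Qed.

Lemma rtau_sum (I : Type) (s : seq I) (P : pred I) (F : I -> C) :
  rtau (\sum_(i <- s | P i) F i) = \sum_(i <- s | P i) rtau (F i).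
Proof. exact: (big_morph _ rtauD rtau0). Qed.

Lemma rtau1 : rtau 1 = 1.
Proof. by rewrite /rtau (proj1 tau_state). Qed.

Lemma rtau_ge0 a : 0 <= rtau (adj a * a).
Proof. by have := (proj2 tau_state) a; rewrite lecE => /andP[_]. Qed.

Lemma Im_tau_ge0 a : complex.Im (tau (adj a * a)) = 0.
Proof. exact: ger0_Im ((proj2 tau_state) a). Qed.

(** Positivity at [1 + b] forces the imaginary parts of [tau b] and [tau (adj b)] to cancel. Taking
    [b = a] and [b = 'i *: a] gives the imaginary and the real part of the claim. *)
Lemma tau_adj a : tau (adj a) = conjc (tau a).
Proof.
have H b : complex.Im (tau b) + complex.Im (tau (adj b)) = 0.
  have := Im_tau_ge0 (1 + b).
  have -> : adj (1 + b) * (1 + b) = 1 + (b + adj b) + adj b * b.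
    by rewrite adjD cadj1 mulrDl mul1r mulrDr mulr1 !addrA.
  rewrite (linearD tau (1 + (b + adj b))) (linearD tau 1) (linearD tau b).
  rewrite !ImD /= Im_tau_ge0 (proj1 tau_state) /=.
  by rewrite add0r addr0.
have := H ('i%C *: a); have := H a.
rewrite Defs.adjZ !linearZ /=.
case: (tau a) => u v; case: (tau (adj a)) => u' v' /= h1 h2.
by apply/eqP; rewrite eq_complex /=; apply/andP; split; apply/eqP; lra.
Qed.

Lemma rtau_adj a : rtau (adj a) = rtau a.
Proof. by rewrite /rtau tau_adj Re_conjc. Qed.

Lemma rtau_sqr_le a : rtau a ^+ 2 <= rtau (adj a * a).
Proof.
rewrite -[leRHS]mulr1; apply: sqr_le_of_discr => // [|s]; first exact: rtau_ge0.
have := rtau_ge0 (a + s%:C%C *: 1).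
have -> : adj (a + s%:C%C *: 1) * (a + s%:C%C *: 1)
    = adj a * a + s%:C%C *: (adj a + a) + s%:C%C *: (s%:C%C *: 1).
  rewrite adjD cadjZr cadj1 mulrDl !mulrDr -!scalerAl -!scalerAr !mul1r !mulr1.
  by rewrite -!addrA; congr (_ + _); rewrite !addrA -scalerDr.
by rewrite !rtauD !rtauZ rtauD rtau_adj rtau1; lra.
Qed.

(** For [r > 0] the element [1 - r^-1 s] is the square of a self-adjoint [1 - u] by [sqrt1B]. Hence
    [adj x * (1 - r^-1 s) * x] has the form [adj z * z], on which [tau] is non-negative. *)
Lemma rtau_form_le (s x : C) r : adj s = s -> cnorm s <= r ->
  rtau (adj x * s * x) <= r * rtau (adj x * x).
Proof.
move=> ssa sr; have r0 : 0 <= r by apply: le_trans sr; exact: cnorm_ge0.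
have [rz|rn] := eqVneq r 0.
  have /cnorm_eq0 -> : cnorm s = 0 by apply/eqP; rewrite eq_le cnorm_ge0 andbT -rz.
  by rewrite mulr0 mul0r rtau0 rz mul0r.
have rp : 0 < r by rewrite lt_neqAle eq_sym rn.
pose t := r^-1%:C%C *: s.
have tsa : adj t = t by rewrite cadjZr ssa.
have t1 : cnorm t <= 1.
  by rewrite cnormZr gtr0_norm ?invr_gt0 // mulrC ler_pdivrMr // mul1r.
have [u [usa _ hu _]] := sqrt1B tsa t1.
have := rtau_ge0 ((1 - u) * x).
have -> : adj ((1 - u) * x) * ((1 - u) * x) = adj x * (1 - t) * x.
  by rewrite adjM cadjB cadj1 usa -hu !mulrA.
rewrite mulrBr mulr1 mulrBl rtauB /t -scalerAr -scalerAl rtauZ subr_ge0 mulrC.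
by rewrite ler_pdivrMr // [X in _ <= X]mulrC.
Qed.

Lemma rtau_le_cnorm_sqr a x :
  rtau (adj x * (adj a * a) * x) <= cnorm a ^+ 2 * rtau (adj x * x).
Proof. by apply: rtau_form_le; rewrite ?cnorm_adjM // adjM adjK. Qed.

Lemma rtau_sqr_le_cnorm a : rtau (adj a * a) <= cnorm a ^+ 2.
Proof.
by have := rtau_le_cnorm_sqr a 1; rewrite cadj1 !mul1r !mulr1 rtau1 mulr1.
Qed.

Lemma normc_tau a : normc (tau a) <= cnorm a.
Proof.
have [u [u1 <-]] := normc_phase (tau a).
have -> : complex.Re (u * tau a) = rtau (u *: a) by rewrite /rtau linearZ.
have -> : cnorm a = cnorm (u *: a) by rewrite cnormZ u1 mul1r.
have := le_trans (rtau_sqr_le (u *: a)) (rtau_sqr_le_cnorm (u *: a)).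
set v := rtau _ => H; have := cnorm_ge0 (u *: a); nra.
Qed.

Hypothesis tau_faithful : faithful_state tau.

Lemma rtau_eq0 a : rtau (adj a * a) = 0 -> a = 0.
Proof.
move=> h; apply: tau_faithful; move: h (Im_tau_ge0 a); rewrite /rtau.
by case: (tau _) => u v /= -> ->.
Qed.

Lemma le0_of_le_geometric (e K rho : R) : 0 <= rho < 1 ->
  (forall n, e <= K * rho ^+ n) -> e <= 0.
Proof.
move=> /andP[rho0 rho1] H; rewrite leNgt; apply/negP => e0.
have : geometric K rho @ \oo --> 0 by apply: cvg_geometric; rewrite ger0_norm.
move/cvgrPdist_lt => /(_ e e0) [N _ /(_ N (leqnn N))] /=.
rewrite sub0r normrN => /(le_lt_trans (ler_norm _)).
by rewrite ltNge H.
Qed.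

(* If the bound failed, the positive part [y] of [h^2 - M'^2] would be nonzero
   for some [M' > M], and on its support the moments grow at least like M'. *)
Lemma cnorm_le_of_moments h (K M : R) : adj h = h -> 0 <= M ->
  (forall n, rtau (h ^+ n * h ^+ n) <= K * (M ^+ 2) ^+ n) -> cnorm h <= M.
Proof.
move=> hsa M0 H; apply/ler_addgt0Pl => e e0.
set M' := e + M; have M'0 : 0 < M' by rewrite ltr_wpDr.
have [k Ek] : exists k, k = h * h - (M' ^+ 2)%:C%C%:A by eexists.
have comm_scal (z : C) : GRing.comm z (M' ^+ 2)%:C%C%:A.
  by rewrite /GRing.comm -scalerAl -scalerAr mulr1 mul1r.
have ksa : adj k = k by rewrite Ek cadjB adjM hsa cadjZr cadj1.
have hk : GRing.comm h k by rewrite Ek; apply: commrB => //; apply: commrM.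
have [q [qsa qq qc]] := abs_exists ksa.
have hq : GRing.comm h q by apply: qc.
have kq : GRing.comm k q by apply: qc.
have qk := commr_sym kq.
(* Since [q * q] is the absolute value of [k], [y] is twice the positive part of [k], and on it
   multiplication by [k] agrees with multiplication by [q * q]. *)
have [y Ey] : exists y, y = q * q + k by exists (q * q + k).
have ysa : adj y = y by rewrite Ey adjD adjM qsa ksa.
have hy : GRing.comm h y by rewrite Ey; apply: commrD => //; apply: commrM.
have qy : GRing.comm q y by rewrite Ey; apply: commrD => //; apply: commrM.
have yk : y * k = y * (q * q).
  rewrite Ey !mulrDl qq addrC; congr (_ + _).
  by apply/esym; apply: commrM.
(* In the order of the algebra, [y * h^2 * y] dominates [M'^2 * y^2]. The difference is kept as an
   explicit [adj z * z], so that [tau] can be applied to it. *)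
have yhhy : y * (h * h) * y = adj (q * y) * (q * y) + (M' ^+ 2)%:C%C *: (adj y * y).
  have -> : h * h = k + (M' ^+ 2)%:C%C%:A by rewrite Ek subrK.
  rewrite mulrDr mulrDl yk adjM qsa ysa -scalerAr mulr1 -scalerAl.
  by rewrite !mulrA.
pose w n := rtau (adj (y * h ^+ n) * (y * h ^+ n)).
have adjX n : adj (h ^+ n) = h ^+ n.
  elim: n => [|n IH]; first by rewrite expr0 cadj1.
  by rewrite exprS adjM IH hsa -exprSr exprS.
have wS n : M' ^+ 2 * w n <= w n.+1.
  rewrite /w.
  have -> : adj (y * h ^+ n.+1) * (y * h ^+ n.+1) =
      adj (q * y * h ^+ n) * (q * y * h ^+ n)
      + (M' ^+ 2)%:C%C *: (adj (y * h ^+ n) * (y * h ^+ n)).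
    transitivity (h ^+ n * (y * (h * h) * y) * h ^+ n).
      rewrite adjM ysa adjX {1}exprSr exprS !mulrA; congr (_ * _).
      rewrite -!mulrA; congr (_ * _).
      by rewrite -hy mulrA {1}hy -mulrA.
    rewrite yhhy mulrDr mulrDl !adjM ysa qsa adjX -scalerAr -scalerAl.
    by rewrite !mulrA.
  by rewrite rtauD rtauZ lerDr rtau_ge0.
have wn n : M' ^+ 2 ^+ n * w 0%N <= w n.
  elim: n => [|n IH]; first by rewrite expr0 mul1r.
  apply: le_trans (wS n); rewrite exprS -mulrA ler_wpM2l //.
  exact: sqr_ge0.
have wle n : w n <= (cnorm y ^+ 2 * K) * (M ^+ 2) ^+ n.
  rewrite /w adjM adjX mulrA -[X in X * _]mulrA.
  have := rtau_le_cnorm_sqr y (h ^+ n); rewrite adjX => /le_trans; apply.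
  by rewrite -mulrA ler_wpM2l // sqr_ge0.
(* The weighted moments satisfy [M'^(2n) * w 0 <= w n <= const * M^(2n)] with [M < M'], which is
   possible for all [n] only if [w 0] vanishes. *)
have w0 : w 0%N = 0.
  apply/eqP; rewrite eq_le rtau_ge0 andbT.
  apply: (@le0_of_le_geometric _ (cnorm y ^+ 2 * K) (M ^+ 2 / M' ^+ 2)).
    rewrite divr_ge0 ?sqr_ge0 //= ltr_pdivrMr ?exprn_gt0 // mul1r.
    by rewrite ltrXn2r // ltrDr.
  move=> n; rewrite expr_div_n mulrA ler_pdivlMr; last first.
    by rewrite !exprn_gt0.
  by rewrite mulrC (le_trans (wn n)).
move: w0; rewrite /w expr0 mulr1 => /rtau_eq0; rewrite Ey => y0.
(* With a vanishing positive part, [q * q = - k], so [h^2 + q^2 = M'^2] and the unitary trick bounds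
   [h] by [M']. *)
apply: (@cnorm_le_of_sqr_add _ _ h q) => //; first exact: ltW.
have -> : q * q = - k by apply/eqP; rewrite -addr_eq0; apply/eqP.
by rewrite Ek opprB addrC subrK.
Qed.

End State.

(** * Matrices over a C*-algebra *)

Section EntrySum.
Variables (R : realType) (V : pzRingType) (N : V -> R) (m : nat).
Hypotheses (N_ge0 : forall a, 0 <= N a) (N0 : N 0 = 0).
Hypothesis ND : forall a b, N (a + b) <= N a + N b.
Hypothesis NM : forall a b, N (a * b) <= N a * N b.
Implicit Types x y : 'M[V]_m.+1.

(** The working norm for matrices: submultiplicative for elementary reasons. It is generic in [N]
    because it is used both over the complex numbers and over [C]. *)
Definition entry_sum x : R := \sum_i \sum_j N (x i j).

Lemma entry_sum_ge0 x : 0 <= entry_sum x.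
Proof. by do 2! apply: sumr_ge0 => ? _; exact: N_ge0. Qed.

Lemma entry_sum_ge x i j : N (x i j) <= entry_sum x.
Proof.
rewrite /entry_sum (bigD1 i) //= (bigD1 j) //= -addrA lerDl addr_ge0 //.
  by apply: sumr_ge0 => ? _; exact: N_ge0.
by do 2! apply: sumr_ge0 => ? _; exact: N_ge0.
Qed.

Lemma entry_sum0 : entry_sum 0 = 0.
Proof. by do 2! apply: big1 => ? _; rewrite mxE N0. Qed.

Lemma ler_entry_sumD x y : entry_sum (x + y) <= entry_sum x + entry_sum y.
Proof.
rewrite -big_split /=; apply: ler_sum => i _; rewrite -big_split /=.
by apply: ler_sum => j _; rewrite mxE ND.
Qed.

Lemma ler_entry_sum_sum (I : Type) (s : seq I) (P : pred I) (F : I -> 'M[V]_m.+1) :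
  entry_sum (\sum_(i <- s | P i) F i) <= \sum_(i <- s | P i) entry_sum (F i).
Proof.
elim/big_ind2 : _ => [|a ra b rb ha hb|//]; first by rewrite entry_sum0.
by rewrite (le_trans (ler_entry_sumD _ _)) // lerD.
Qed.

Lemma ler_entry_sumM x y : entry_sum (x * y) <= entry_sum x * entry_sum y.
Proof.
rewrite /entry_sum mulr_suml; apply: ler_sum => i _.
apply: (@le_trans _ _ (\sum_j \sum_k N (x i k) * N (y k j))).
  apply: ler_sum => j _; rewrite mxE.
  elim/big_ind2 : _ => [|a ra b rb ha hb|//]; first by rewrite N0.
  by rewrite (le_trans (ND _ _)) // lerD.
rewrite exchange_big /= mulr_suml; apply: ler_sum => k _.
rewrite -mulr_sumr ler_wpM2l // [leRHS](bigD1 k) //= lerDl.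
by do 2! apply: sumr_ge0 => ? _; exact: N_ge0.
Qed.

End EntrySum.

Section ScalarMatrixNorm.
Variables (R : realType) (m : nat).
Implicit Types b c : 'M[R[i]]_m.+1.

Definition cent_norm b : R := entry_sum (fun z => normc z) b.

Let normc0 : normc (0 : R[i]) = 0 := ComplexField.Normc.normc0 R.

Lemma cent_norm_ge0 b : 0 <= cent_norm b.
Proof. exact: entry_sum_ge0 (@normc_ge0 R) _. Qed.

Lemma cent_norm_ge b i j : normc (b i j) <= cent_norm b.
Proof. exact: (entry_sum_ge (@normc_ge0 R)). Qed.

Lemma cent_norm0 : cent_norm 0 = 0.
Proof. exact: entry_sum0. Qed.

Lemma ler_cent_normD b c : cent_norm (b + c) <= cent_norm b + cent_norm c.
Proof. exact: (ler_entry_sumD (@ler_normcD R)). Qed.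

Lemma ler_cent_norm_sum (I : Type) (s : seq I) (P : pred I) (F : I -> 'M[R[i]]_m.+1) :
  cent_norm (\sum_(i <- s | P i) F i) <= \sum_(i <- s | P i) cent_norm (F i).
Proof. exact: (ler_entry_sum_sum normc0 (@ler_normcD R)). Qed.

Lemma ler_cent_normM b c : cent_norm (b * c) <= cent_norm b * cent_norm c.
Proof.
apply: (ler_entry_sumM (@normc_ge0 R) normc0 (@ler_normcD R)) => z w.
by rewrite ComplexField.Normc.normcM.
Qed.

Lemma cent_normN b : cent_norm (- b) = cent_norm b.
Proof. by do 2! apply: eq_bigr => ? _; rewrite mxE normcN. Qed.

Lemma cent_norm_distC b c : cent_norm (b - c) = cent_norm (c - b).
Proof. by rewrite -cent_normN opprB. Qed.

Lemma cent_norm_eq0 b : cent_norm b = 0 -> b = 0.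
Proof.
move=> h; apply/matrixP => i j; rewrite mxE; apply: ComplexField.Normc.eq0_normc.
by apply/eqP; rewrite eq_le normc_ge0 andbT -h cent_norm_ge.
Qed.

Definition rscalar (r : R) : 'M[R[i]]_m.+1 := (r%:C%C)%:M.

Lemma cent_norm_rscalar r b : cent_norm (rscalar r * b) = `|r| * cent_norm b.
Proof.
have -> : rscalar r * b = r%:C%C *: b by rewrite -mul_scalar_mx.
rewrite /cent_norm /entry_sum mulr_sumr; apply: eq_bigr => i _.
rewrite mulr_sumr; apply: eq_bigr => j _.
by rewrite mxE ComplexField.Normc.normcM normc_real.
Qed.

End ScalarMatrixNorm.

Section MatrixNorms.
Variables (R : realType) (C : cstarAlgType R) (m : nat).
Local Notation M := 'M[R[i]]_m.+1.
Local Notation A := 'M[C]_m.+1.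
Implicit Types (x y z : A) (b c : M).

Local Notation iota := (@mx_embed R C m).
Local Notation star := (@mx_star R C m).

Definition ent_norm x : R := entry_sum cnorm x.

Lemma ent_norm_ge0 x : 0 <= ent_norm x.
Proof. exact: entry_sum_ge0 (@cnorm_ge0 R C) _. Qed.

Lemma ent_norm_ge x i j : cnorm (x i j) <= ent_norm x.
Proof. exact: (entry_sum_ge (@cnorm_ge0 R C)). Qed.

Lemma ent_normN x : ent_norm (- x) = ent_norm x.
Proof. by do 2! apply: eq_bigr => ? _; rewrite mxE cnormN. Qed.

Lemma ler_ent_normD x y : ent_norm (x + y) <= ent_norm x + ent_norm y.
Proof. exact: (ler_entry_sumD (@ler_cnormD R C)). Qed.

Lemma ler_ent_normB x y : ent_norm (x - y) <= ent_norm x + ent_norm y.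
Proof. by rewrite -(ent_normN y) ler_ent_normD. Qed.

Lemma ler_ent_normM x y : ent_norm (x * y) <= ent_norm x * ent_norm y.
Proof.
exact: (ler_entry_sumM (@cnorm_ge0 R C) (@cnorm0 R C) (@ler_cnormD R C) (@ler_cnormM R C)).
Qed.

Lemma cnorm_scal (k : R[i]) : cnorm (k%:A : C) = normc k.
Proof. by rewrite cnormZ cnorm1 mulr1. Qed.

Lemma mx_embed_is_zmod : zmod_morphism iota.
Proof. by move=> b c; apply/matrixP => i j; rewrite !mxE scalerBl. Qed.

Lemma mx_embed_is_monoid : monoid_morphism iota.
Proof.
split=> [|b c]; apply/matrixP => i j; rewrite !mxE.
  by case: (i == j); rewrite ?scale1r ?scale0r.
rewrite scaler_suml; apply: eq_bigr => k _; rewrite !mxE.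
by rewrite -scalerAl mul1r scalerA.
Qed.

HB.instance Definition _ := GRing.isZmodMorphism.Build M A iota mx_embed_is_zmod.
HB.instance Definition _ := GRing.isMonoidMorphism.Build M A iota mx_embed_is_monoid.

Lemma ent_norm_embed b : ent_norm (iota b) = cent_norm b.
Proof. by do 2! apply: eq_bigr => ? _; rewrite mxE cnorm_scal. Qed.

Lemma mx_embed_inj : injective iota.
Proof.
move=> b c /matrixP h; apply/matrixP => i j; have := h i j; rewrite !mxE.
move=> /eqP; rewrite -subr_eq0 -scalerBl => /eqP /(congr1 cnorm).
rewrite cnorm_scal cnorm0 => /ComplexField.Normc.eq0_normc /eqP.
by rewrite subr_eq0 => /eqP.
Qed.

Lemma mx_starD x y : star (x + y) = star x + star y.
Proof. by apply/matrixP => i j; rewrite !mxE adjD. Qed.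

Lemma mx_starK x : star (star x) = x.
Proof. by apply/matrixP => i j; rewrite !mxE adjK. Qed.

Lemma mx_starM x y : star (x * y) = star y * star x.
Proof.
apply/matrixP => i j; rewrite !mxE cadj_sum; apply: eq_bigr => k _.
by rewrite !mxE adjM.
Qed.

Lemma mx_star_embed b : star (iota b) = iota (map_mx conjc b)^T.
Proof. by apply/matrixP => i j; rewrite !mxE Defs.adjZ cadj1. Qed.

Lemma mx_star0 : star 0 = 0.
Proof. by apply/matrixP => i j; rewrite !mxE cadj0. Qed.

Lemma mx_star_sum (I : Type) (s : seq I) (P : pred I) (F : I -> A) :
  star (\sum_(i <- s | P i) F i) = \sum_(i <- s | P i) star (F i).
Proof. exact: (big_morph _ mx_starD mx_star0). Qed.

Lemma ent_norm_star x : ent_norm (star x) = ent_norm x.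
Proof.
rewrite /ent_norm /entry_sum exchange_big; apply: eq_bigr => i _; apply: eq_bigr => j _.
by rewrite !mxE cnorm_adj.
Qed.

Lemma mul_deltaE x (i j k l : 'I_m.+1) :
  delta_mx i j * x * delta_mx k l = x j k *: delta_mx i l :> A.
Proof.
apply/matrixP => a b; rewrite !mxE (bigD1 k) //= big1 => [|c /negbTE ck]; last first.
  by rewrite [delta_mx k l c b]mxE ck mulr0.
rewrite !mxE eqxx addr0 (bigD1 j) //= big1 => [|c /negbTE cj]; last first.
  by rewrite mxE cj andbF mul0r.
rewrite !mxE eqxx addr0 andbT.
by case: (a == i); case: (b == l); rewrite /= ?(mul0r, mulr0, mul1r, mulr1).
Qed.

Lemma mx_embed_delta i j : iota (delta_mx i j) = delta_mx i j.
Proof.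
apply/matrixP => a b; rewrite !mxE.
by case: (_ && _); rewrite ?scale1r ?scale0r.
Qed.

Variable tau : {scalar C}.
Local Notation E := (@mx_expect R C m tau).

Lemma mx_expect_is_zmod : zmod_morphism E.
Proof. by move=> b c; apply/matrixP => i j; rewrite !mxE linearB. Qed.

HB.instance Definition _ := GRing.isZmodMorphism.Build A M E mx_expect_is_zmod.

Lemma mx_expect_bimod b x c : E (iota b * x * iota c) = b * E x * c.
Proof.
apply/matrixP => i j; rewrite !mxE linear_sum /=; apply: eq_bigr => k _.
rewrite !mxE -scalerAr mulr1 linearZ /= linear_sum /= mulr_sumr mulr_suml.
apply: eq_bigr => l _; rewrite !mxE -scalerAl mul1r linearZ /=.
by rewrite mulrC.
Qed.

Hypothesis tau_state : is_state tau.

Lemma mx_expect_embed b : E (iota b) = b.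
Proof.
apply/matrixP => i j; rewrite !mxE linearZ /=.
by rewrite (proj1 tau_state) mulr1.
Qed.

Lemma mx_expect_mull b x : E (iota b * x) = b * E x.
Proof. by rewrite -[_ * x]mulr1 -(rmorph1 iota) mx_expect_bimod mulr1. Qed.

Lemma mx_expect_mulr x c : E (x * iota c) = E x * c.
Proof. by rewrite -[x]mul1r -(rmorph1 iota) mx_expect_bimod mul1r rmorph1 mul1r. Qed.

Lemma cent_norm_expect x : cent_norm (E x) <= ent_norm x.
Proof. by do 2! apply: ler_sum => ? _; rewrite mxE normc_tau. Qed.

Lemma mx_expect_star x : E (star x) = (map_mx conjc (E x))^T.
Proof. by apply/matrixP => i j; rewrite !mxE tau_adj. Qed.

(** The real part of the inner product of L2(tr o tau), with the unnormalized trace. It is symmetric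
    and real-bilinear and defines the same norm as the complex inner product. *)
Definition ip x y : R := \sum_i rtau tau ((star x * y) i i).

Lemma ipDr x y z : ip x (y + z) = ip x y + ip x z.
Proof. by rewrite -big_split; apply: eq_bigr => i _; rewrite mulrDr mxE rtauD. Qed.

Lemma ipC x y : ip x y = ip y x.
Proof.
apply: eq_bigr => i _; rewrite -(rtau_adj tau_state); congr rtau.
have -> : star y * x = star (star x * y) by rewrite mx_starM mx_starK.
by rewrite [RHS]mxE [RHS]mxE.
Qed.

Lemma ipDl x y z : ip (x + y) z = ip x z + ip y z.
Proof. by rewrite ipC ipDr !(ipC z). Qed.

Lemma ip0r x : ip x 0 = 0.
Proof. by apply: big1 => i _; rewrite mulr0 mxE rtau0. Qed.

Lemma ipNr x y : ip x (- y) = - ip x y.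
Proof. by rewrite -sumrN; apply: eq_bigr => i _; rewrite mulrN mxE rtauN. Qed.

Lemma ipBr x y z : ip x (y - z) = ip x y - ip x z.
Proof. by rewrite ipDr ipNr. Qed.

Lemma ipBl x y z : ip (x - y) z = ip x z - ip y z.
Proof. by rewrite ipC ipBr !(ipC z). Qed.

Lemma ip_sumr (I : Type) (s : seq I) (P : pred I) x (F : I -> A) :
  ip x (\sum_(i <- s | P i) F i) = \sum_(i <- s | P i) ip x (F i).
Proof. exact: (big_morph _ (ipDr x) (ip0r x)). Qed.

Lemma ip_suml (I : Type) (s : seq I) (P : pred I) x (F : I -> A) :
  ip (\sum_(i <- s | P i) F i) x = \sum_(i <- s | P i) ip (F i) x.
Proof. by rewrite ipC ip_sumr; apply: eq_bigr => i _; rewrite ipC. Qed.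

Lemma ipMr x y z : ip x (y * z) = ip (star y * x) z.
Proof. by rewrite /ip mx_starM mx_starK; apply: eq_bigr => i _; rewrite mulrA. Qed.

(** Complex scalars act on [A] by multiplication with these central elements, since the module
    structure of matrices over [C] has its scalars in [C]. *)
Definition cscal (k : R[i]) : A := iota k%:M.

Definition rscal (r : R) : A := iota (rscalar m r).

Lemma cscalE k x i j : (cscal k * x) i j = k *: x i j.
Proof.
rewrite mxE (bigD1 i) //= big1 => [|l /negbTE li]; last first.
  by rewrite !mxE eq_sym li mulr0n scale0r mul0r.
by rewrite !mxE eqxx mulr1n addr0 -scalerAl mul1r.
Qed.

Lemma cscalC k x : cscal k * x = x * cscal k.
Proof.
apply/matrixP => i j; rewrite cscalE mxE (bigD1 j) //= big1 => [|l /negbTE li].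
  by rewrite !mxE eqxx mulr1n addr0 -scalerAr mulr1.
by rewrite !mxE li mulr0n scale0r mulr0.
Qed.

Lemma cscalM k l x : cscal k * (cscal l * x) = cscal (k * l) * x.
Proof. by apply/matrixP => i j; rewrite !cscalE scalerA. Qed.

Lemma star_cscal k : star (cscal k) = cscal (conjc k).
Proof.
rewrite mx_star_embed; congr iota; apply/matrixP => i j; rewrite !mxE eq_sym.
by case: (i == j); rewrite ?mulr1n // !mulr0n conjc0.
Qed.

Lemma rscalE r x i j : (rscal r * x) i j = r%:C%C *: x i j.
Proof. exact: cscalE. Qed.

Lemma ent_norm_rscal r x : ent_norm (rscal r * x) = `|r| * ent_norm x.
Proof.
rewrite /ent_norm /entry_sum mulr_sumr; apply: eq_bigr => i _.
by rewrite mulr_sumr; apply: eq_bigr => j _; rewrite rscalE cnormZr.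
Qed.

Lemma rscalC r x : rscal r * x = x * rscal r.
Proof. exact: cscalC. Qed.

Lemma ipZr r x y : ip x (rscal r * y) = r * ip x y.
Proof.
rewrite mulr_sumr; apply: eq_bigr => i _.
by rewrite mulrA -rscalC -mulrA rscalE rtauZ.
Qed.

Lemma ipZl r x y : ip (rscal r * x) y = r * ip x y.
Proof. by rewrite ipC ipZr ipC. Qed.

Lemma ipxx x : ip x x = \sum_j \sum_i rtau tau (adj (x i j) * x i j).
Proof.
apply: eq_bigr => j _; rewrite mxE rtau_sum; apply: eq_bigr => i _.
by rewrite !mxE.
Qed.

Lemma ipxx_ge0 x : 0 <= ip x x.
Proof. by rewrite ipxx; do 2! apply: sumr_ge0 => ? _; exact: rtau_ge0. Qed.

Definition l2norm x : R := Num.sqrt (ip x x).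

Lemma l2norm_ge0 x : 0 <= l2norm x. Proof. exact: sqrtr_ge0. Qed.

Lemma sqr_l2norm x : l2norm x ^+ 2 = ip x x.
Proof. by rewrite sqr_sqrtr // ipxx_ge0. Qed.

Lemma l2norm_le r x : 0 <= r -> ip x x <= r ^+ 2 -> l2norm x <= r.
Proof.
by move=> r0 h; rewrite -(ler_pXn2r (n:=2)) ?nnegrE ?l2norm_ge0 // sqr_l2norm.
Qed.

Lemma ip_le x y : `|ip x y| <= l2norm x * l2norm y.
Proof.
rewrite -(ler_pXn2r (n:=2)) ?nnegrE ?mulr_ge0 ?l2norm_ge0 //.
rewrite real_normK ?num_real // exprMn !sqr_l2norm.
apply: sqr_le_of_discr; rewrite ?ipxx_ge0 // => s.
have := ipxx_ge0 (x + rscal s * y).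
by rewrite !(ipDr, ipDl) !(ipZr, ipZl) (ipC y x); lra.
Qed.

Lemma ler_l2normD x y : l2norm (x + y) <= l2norm x + l2norm y.
Proof.
apply: l2norm_le; first by rewrite addr_ge0 ?l2norm_ge0.
rewrite !(ipDr, ipDl) (ipC y x) sqrrD !sqr_l2norm.
have := le_trans (ler_norm _) (ip_le x y); lra.
Qed.

Lemma l2norm0 : l2norm 0 = 0.
Proof. by rewrite /l2norm ip0r sqrtr0. Qed.

Lemma l2normZ r x : l2norm (rscal r * x) = `|r| * l2norm x.
Proof. by rewrite /l2norm ipZl ipZr mulrA -expr2 sqrtrM ?sqr_ge0 // sqrtr_sqr. Qed.

Lemma l2norm_cscal k x : l2norm (cscal k * x) = normc k * l2norm x.
Proof.
rewrite /l2norm ipMr mulrA star_cscal.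
have -> : cscal (conjc k) * cscal k * x = rscal (normc k ^+ 2) * x.
  rewrite -mulrA cscalM; congr (iota _%:M * x).
  case: k => a b /=; rewrite sqr_sqrtr ?addr_ge0 ?sqr_ge0 //.
  by apply/eqP; rewrite eq_complex /=; apply/andP; split; apply/eqP; ring.
by rewrite ipZl sqrtrM ?sqr_ge0 // sqrtr_sqr ger0_norm ?normc_ge0.
Qed.

Lemma ler_l2norm_sum (I : Type) (s : seq I) (P : pred I) (F : I -> A) :
  l2norm (\sum_(i <- s | P i) F i) <= \sum_(i <- s | P i) l2norm (F i).
Proof.
elim/big_ind2 : _ => [|a ra b rb ha hb|//]; first by rewrite l2norm0.
by rewrite (le_trans (ler_l2normD _ _)) // lerD.
Qed.

(** Only row [i] of the product is non-zero, and its entries are [c * y j k]; [rtau_le_cnorm_sqr]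
    bounds them one by one. Summation over matrix units then bounds left multiplication by any
    matrix in L2. *)
Lemma l2norm_scale_delta (c : C) i j y :
  l2norm ((c *: delta_mx i j) * y) <= cnorm c * l2norm y.
Proof.
apply: l2norm_le; first by rewrite mulr_ge0 ?cnorm_ge0 ?l2norm_ge0.
rewrite exprMn sqr_l2norm !ipxx mulr_sumr; apply: ler_sum => k _.
have E a : ((c *: delta_mx i j) * y) a k = (a == i)%:R * (c * y j k).
  rewrite mxE (bigD1 j) //= big1 => [|l /negbTE lj]; last first.
    by rewrite !mxE lj andbF mulr0 mul0r.
  rewrite !mxE eqxx andbT addr0.
  by case: (a == i); rewrite ?(mulr1, mulr0, mul1r, mul0r).
rewrite (bigD1 i) //= big1 => [|l /negbTE li]; last first.
  by rewrite E li mul0r cadj0 mul0r rtau0.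
rewrite E eqxx mul1r addr0 adjM mulrA -(mulrA (adj (y j k))).
apply: le_trans (rtau_le_cnorm_sqr tau_state _ _) _.
rewrite ler_wpM2l ?sqr_ge0 // (bigD1 j) //= lerDl.
by apply: sumr_ge0 => ? _; exact: rtau_ge0.
Qed.

Lemma l2normM x y : l2norm (x * y) <= ent_norm x * l2norm y.
Proof.
rewrite {1}[x]matrix_sum_delta mulr_suml; apply: le_trans (ler_l2norm_sum _ _ _) _.
rewrite mulr_suml; apply: ler_sum => i _; rewrite mulr_suml.
apply: le_trans (ler_l2norm_sum _ _ _) _; rewrite mulr_suml.
by apply: ler_sum => j _; exact: l2norm_scale_delta.
Qed.

Lemma l2norm_delta i j y : l2norm (delta_mx i j * y) <= l2norm y.
Proof. by have := l2norm_scale_delta 1 i j y; rewrite scale1r cnorm1 mul1r. Qed.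

(** The duality argument [ip (star x * y) (star x * y) = ip (x * (star x * y)) y], run inside a
    subset [D]: the bound for [x] is used only at the vector [star x * y], which stays in [D]. *)
Lemma l2norm_star_le (D : set A) x (K : R) : 0 <= K ->
  (forall y, D y -> D (star x * y)) ->
  (forall y, D y -> l2norm (x * y) <= K * l2norm y) ->
  forall y, D y -> l2norm (star x * y) <= K * l2norm y.
Proof.
move=> K0 Dx h y Dy; have [->|n0] := eqVneq (l2norm (star x * y)) 0.
  by rewrite mulr_ge0 ?l2norm_ge0.
have n1 : 0 < l2norm (star x * y) by rewrite lt_neqAle eq_sym n0 l2norm_ge0.
rewrite -(ler_pM2r n1) -expr2 sqr_l2norm ipMr mx_starK.
apply: le_trans (ler_norm _) _; apply: le_trans (ip_le _ _) _.
by rewrite mulrAC ler_wpM2r ?l2norm_ge0 // h //; exact: Dx.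
Qed.

Lemma l2norm_adjoint_le x (K : R) : 0 <= K ->
  (forall y, l2norm (x * y) <= K * l2norm y) ->
  forall y, l2norm (star x * y) <= K * l2norm y.
Proof. by move=> K0 h y; apply: (@l2norm_star_le setT). Qed.

Hypothesis tau_faithful : faithful_state tau.

Lemma l2norm_eq0 x : l2norm x = 0 -> x = 0.
Proof.
move=> h; have := sqr_l2norm x; rewrite h expr0n /= ipxx => /esym H.
have H0 j i : 0 <= rtau tau (adj (x i j) * x i j) by exact: rtau_ge0.
apply/matrixP => i j; rewrite mxE; apply: (rtau_eq0 tau_state tau_faithful).
have /eqP := H; rewrite psumr_eq0 => [|k _]; last exact: sumr_ge0.
move=> /allP /(_ j (mem_index_enum j)) /=; rewrite psumr_eq0 //.
by move=> /allP /(_ i (mem_index_enum i)) /eqP.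
Qed.

End MatrixNorms.

(** * From L2 bounds to norms of matrix entries *)

Section EntryBound.
Variables (R : realType) (C : cstarAlgType R) (m : nat) (tau : {scalar C}).
Hypotheses (tau_state : is_state tau) (tau_faithful : faithful_state tau).
Local Notation A := 'M[C]_m.+1.
Local Notation iota := (@mx_embed R C m).
Local Notation star := (@mx_star R C m).

Lemma mul_scale_delta00 (a b : C) :
  (a *: delta_mx 0 0) * (b *: delta_mx 0 0) = (a * b) *: delta_mx 0 0 :> A.
Proof.
apply/matrixP => i j; rewrite !mxE (bigD1 0) //= big1 => [|k /negbTE k0].
  rewrite !mxE !eqxx addr0 andbT.
  by case: (i == 0); case: (j == 0); rewrite /= ?(mulr1, mulr0, mul1r, mul0r).
by rewrite !mxE k0 /= !(mulr0, andbF).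
Qed.

Lemma sqr_l2norm_scale_delta00 (c : C) :
  l2norm tau (c *: delta_mx 0 0 : A) ^+ 2 = rtau tau (adj c * c).
Proof.
rewrite sqr_l2norm // ipxx (bigD1 0) //= (bigD1 0) //= !mxE !eqxx mulr1.
rewrite big1 => [|i /negbTE i0]; last by rewrite !mxE i0 /= mulr0 cadj0 mul0r rtau0.
rewrite big1 ?addr0 // => i /negbTE i0; apply: big1 => j _.
by rewrite !mxE i0 andbF mulr0 cadj0 mul0r rtau0.
Qed.

(** Matrix units cut the entry [c] out of [x]: the vector [h ^+ n *: delta_mx 0 0] with
    [h = adj c * c] results from [n] alternating applications of [x] and [star x]. All intermediate
    vectors lie in [D], so the moments of [h] grow at most like powers of [K ^+ 2], and
    [cnorm_le_of_moments] bounds [cnorm h = cnorm c ^+ 2]. *)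
Lemma cnorm_entry_le (D : set A) (x : A) (K : R) i j : 0 <= K ->
  (forall b y, D y -> D (iota b * y)) ->
  (forall y, D y -> D (x * y)) -> (forall y, D y -> D (star x * y)) ->
  D 1 ->
  (forall y, D y -> l2norm tau (x * y) <= K * l2norm tau y) ->
  cnorm (x i j) <= K.
Proof.
move=> K0 Db Dx Dx' D1 hx.
set c := x i j; pose h := adj c * c.
have hsa : adj h = h by rewrite adjM adjK.
have adjX n : adj (h ^+ n) = h ^+ n.
  elim: n => [|n IH]; first by rewrite expr0 cadj1.
  by rewrite exprS adjM IH hsa -exprSr exprS.
rewrite -(ler_pXn2r (n:=2)) ?nnegrE ?cnorm_ge0 // -cnorm_adjM -/h.
have Dd k l y : D y -> D (delta_mx k l * y) by rewrite -mx_embed_delta; apply: Db.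
pose z n : A := h ^+ n *: delta_mx 0 0.
have zS n : z n.+1 = delta_mx 0 j * (star x * (delta_mx i 0 * (delta_mx 0 i *
                       (x * (delta_mx j 0 * z n))))).
  rewrite !mulrA mul_deltaE -!mulrA (mulrA (delta_mx 0 i)) (mulrA _ (delta_mx j 0)).
  rewrite mul_deltaE -/c !mxE -/c /z !mul_scale_delta00.
  by rewrite exprS mulrA.
have Kn y : D y -> l2norm tau (delta_mx 0 j * (star x * (delta_mx i 0 *
       (delta_mx 0 i * (x * (delta_mx j 0 * y)))))) <= K ^+ 2 * l2norm tau y.
  move=> Dy; apply: le_trans (l2norm_delta tau_state _ _ _) _.
  have /(l2norm_star_le tau_state K0 Dx' hx) H :
      D (delta_mx i 0 * (delta_mx 0 i * (x * (delta_mx j 0 * y)))).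
    by apply/Dd/Dd/Dx/Dd.
  apply: le_trans H _.
  rewrite expr2 -mulrA ler_wpM2l //.
  do 2! apply: le_trans (l2norm_delta tau_state _ _ _) _.
  apply: le_trans (hx _ _) _; first exact: Dd.
  by rewrite ler_wpM2l // l2norm_delta.
have Dz n : D (z n).
  elim: n => [|n IH]; first by rewrite /z expr0 scale1r -[delta_mx _ _]mulr1; apply: Dd.
  by rewrite zS; apply/Dd/Dx'/Dd/Dd/Dx/Dd.
have zn n : l2norm tau (z n) <= (K ^+ 2) ^+ n * l2norm tau (z 0%N).
  elim: n => [|n IH]; first by rewrite expr0 mul1r.
  rewrite zS; apply: le_trans (Kn _ (Dz n)) _.
  by rewrite [(K ^+ 2) ^+ _]exprS -mulrA ler_wpM2l // sqr_ge0.
apply: (cnorm_le_of_moments tau_state tau_faithful (K := l2norm tau (z 0%N) ^+ 2)) => //.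
  exact: sqr_ge0.
move=> n; rewrite -{1}adjX -sqr_l2norm_scale_delta00.
rewrite -exprM mulnC exprM -exprMn mulrC.
apply: lerXn2r; rewrite ?nnegrE ?l2norm_ge0 //.
by rewrite mulr_ge0 ?l2norm_ge0 // exprn_ge0 // sqr_ge0.
exact: zn.
Qed.

Lemma cnorm_entry_le_op (x : A) (K : R) i j : 0 <= K ->
  (forall y, l2norm tau (x * y) <= K * l2norm tau y) -> cnorm (x i j) <= K.
Proof. by move=> K0 h; apply: (@cnorm_entry_le setT). Qed.

(** Testing the operator norm on the [j]-th unit vector bounds [s], the sum of [adj (x k j) * x k j]
    over [k], by [B ^+ 2]. Passing from [s] to a single summand is monotonicity of the norm on
    positive elements. It is obtained through L2: left multiplication by the [j]-th column is
    bounded by [B], hence so is each of its entries. *)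
Lemma cnorm_le_mx_cnorm (x : A) (B : R) i j : 0 <= B ->
  (mx_cnorm x <= B%:E)%E -> cnorm (x i j) <= B.
Proof.
move=> B0 hx.
have n1 : module_norm (x *m delta_mx j 0) <= B.
  rewrite -lee_fin; apply: le_trans hx; apply: ereal_sup_ubound.
  exists (delta_mx j 0) => //=; rewrite /module_norm.
  rewrite (_ : \sum_i _ = 1) ?cnorm1 ?sqrtr1 //.
  rewrite (bigD1 j) //= big1 => [|k /negbTE kj]; last by rewrite !mxE kj cadj0 mul0r.
  by rewrite !mxE !eqxx cadj1 mulr1 addr0.
have {}n1 : cnorm (\sum_k adj (x k j) * x k j) <= B ^+ 2.
  rewrite -[leLHS]sqr_sqrtr ?cnorm_ge0 // ler_pXn2r ?nnegrE ?sqrtr_ge0 //.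
  move: n1; rewrite /module_norm; congr (Num.sqrt (cnorm _) <= _).
  apply: eq_bigr => k _; rewrite mxE (bigD1 j) //= big1 => [|l /negbTE lj].
    by rewrite !mxE !eqxx mulr1 addr0.
  by rewrite !mxE lj mulr0.
set s := \sum_k _ in n1.
have -> : x i j = (x * delta_mx j 0) i 0.
  rewrite mxE (bigD1 j) //= big1 => [|l /negbTE lj].
    by rewrite !mxE !eqxx mulr1 addr0.
  by rewrite !mxE lj mulr0.
apply: cnorm_entry_le_op => // y; apply: l2norm_le => //.
  by rewrite mulr_ge0 ?l2norm_ge0.
have -> : ip tau (x * delta_mx j 0 * y) (x * delta_mx j 0 * y) =
  \sum_k rtau tau (adj (y 0 k) * s * y 0 k).
  rewrite ipxx; apply: eq_bigr => k _; rewrite -rtau_sum /s mulr_sumr mulr_suml.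
  congr rtau; apply: eq_bigr => l _.
  have -> : (x * delta_mx j 0 * y) l k = x l j * y 0 k.
    rewrite -mulrA mxE (bigD1 j) //= big1 => [|p /negbTE pj].
      rewrite addr0; congr (_ * _); rewrite mxE (bigD1 0) //= big1 => [|p /negbTE pj].
        by rewrite !mxE !eqxx mul1r addr0.
      by rewrite mxE pj andbF mul0r.
    rewrite [(delta_mx j 0 * y) p k]mxE big1 ?mulr0 // => q _.
    by rewrite mxE pj mul0r.
  by rewrite adjM !mulrA.
rewrite exprMn sqr_l2norm // ipxx mulr_sumr; apply: ler_sum => k _.
rewrite (bigD1 0) //= mulrDr ler_wpDr //.
  by rewrite mulr_ge0 ?sqr_ge0 //; apply: sumr_ge0 => l _; apply: rtau_ge0.
have ssa : adj s = s by rewrite cadj_sum; apply: eq_bigr => l _; rewrite adjM adjK.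
exact: rtau_form_le.
Qed.

End EntryBound.

(** * Freeness and alternating words *)

Section Freeness.
Variables (R : realType) (C : cstarAlgType R) (m : nat) (tau : {scalar C}).
Hypothesis tau_state : is_state tau.
Local Notation M := 'M[R[i]]_m.+1.
Local Notation A := 'M[C]_m.+1.
Local Notation iota := (@mx_embed R C m).
Local Notation star := (@mx_star R C m).
Local Notation E := (@mx_expect R C m tau).
Variable X : nat -> A.
Implicit Types (a x y z u v : A) (b c : M) (J : nat -> Prop).

Local Notation alg i := (gen_star_algebra star iota (X i)).

Lemma alg_closed i : star_closed star (alg i).
Proof.
split=> [x y hx hy|x y hx hy|x hx] S [Sc Ss]; have [cB cM cS] := Sc.
- by apply: cB; [exact: hx | exact: hy].
- by apply: cM; [exact: hx | exact: hy].
- by apply: cS; exact: hx.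
Qed.

Lemma alg_iota i b : alg i (iota b).
Proof. by move=> S [_]; apply; left; exists b. Qed.

Lemma alg_gen i : alg i (X i).
Proof. by move=> S [_]; apply; right. Qed.

Lemma algB i x y : alg i x -> alg i y -> alg i (x - y).
Proof. by have [h _ _] := alg_closed i; apply: h. Qed.

Lemma algM i x y : alg i x -> alg i y -> alg i (x * y).
Proof. by have [_ h _] := alg_closed i; apply: h. Qed.

Lemma alg_star i x : alg i x -> alg i (star x).
Proof. by have [_ _ h] := alg_closed i; apply: h. Qed.

Definition centered i a := alg i a /\ E a = 0.

Lemma alg_split i a : alg i a -> exists2 a', centered i a' & a = a' + iota (E a).
Proof.
move=> ia; exists (a - iota (E a)); last by rewrite subrK.
split; first by apply: algB => //; exact: alg_iota.
by rewrite raddfB /= mx_expect_embed // subrr.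
Qed.

Lemma centered_iotal i b a : centered i a -> centered i (iota b * a).
Proof.
case=> ia Ea; split; first by apply: algM => //; exact: alg_iota.
by rewrite mx_expect_mull Ea mulr0.
Qed.

Lemma centered_iotar i b a : centered i a -> centered i (a * iota b).
Proof.
case=> ia Ea; split; first by apply: algM => //; exact: alg_iota.
by rewrite mx_expect_mulr // Ea mul0r.
Qed.

Lemma centered_star i a : centered i a -> centered i (star a).
Proof.
case=> ia Ea; split; first exact: alg_star.
by rewrite mx_expect_star // Ea; apply/matrixP => k l; rewrite !mxE conjc0.
Qed.

(* Products of centered elements with distinct neighbouring indices, all of
   them in [J]; the natural number is the first index. *)
Inductive altword J : nat -> A -> Prop :=
| altword1 i a : J i -> centered i a -> altword J i a
| altwordS i j a x : J i -> centered i a -> i <> j -> altword J j x ->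
    altword J i (a * x).

(** Finite sums give the linear span of alternating words: words with a given first index are stable
    under left multiplication by [iota b], in particular under scalars. *)
Inductive add_span (P : A -> Prop) : A -> Prop :=
| add_span0 : add_span P 0
| add_spanD x y : P x -> add_span P y -> add_span P (x + y).

Lemma add_span1 (P : A -> Prop) x : P x -> add_span P x.
Proof. by move=> h; rewrite -[x]addr0; apply: add_spanD => //; exact: add_span0. Qed.

Lemma add_span_add (P : A -> Prop) x y :
  add_span P x -> add_span P y -> add_span P (x + y).
Proof.
move=> hx hy; elim: hx => [|u v hu _ IH]; first by rewrite add0r.
by rewrite -addrA; apply: add_spanD.
Qed.

Lemma add_span_map (P Q : A -> Prop) (f : A -> A) x : f 0 = 0 ->
  {morph f : u v / u + v} -> (forall u, P u -> add_span Q (f u)) ->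
  add_span P x -> add_span Q (f x).
Proof.
move=> f0 fD h; elim => [|u v hu _ IH]; first by rewrite f0; exact: add_span0.
by rewrite fD; apply: add_span_add => //; exact: h.
Qed.

Lemma altword_iotal J i b x : altword J i x -> altword J i (iota b * x).
Proof.
case=> [{}i a Ji ia|{}i j a {}x Ji ia ij jx].
  by apply: altword1 => //; exact: centered_iotal.
by rewrite mulrA; apply: altwordS jx => //; exact: centered_iotal.
Qed.

Lemma altword_mono J J' i x : (forall k, J k -> J' k) -> altword J i x ->
  altword J' i x.
Proof.
move=> JJ'; elim => [k a Jk ka|k l a z Jk ka kl _ IH].
  by apply: altword1 => //; exact: JJ'.
by apply: altwordS IH => //; exact: JJ'.
Qed.

(** The last letter of [x] has its index in [J] while [y] starts outside [J]. The junction is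
    therefore alternating without keeping track of the last index of a word. *)
Lemma altword_cat J J' i j x y : ~ J j -> (forall k, J k -> J' k) ->
  altword J i x -> altword J' j y -> altword J' i (x * y).
Proof.
move=> nJj JJ' hx hy; elim: hx => [k a Jk ka|k l a z Jk ka kl lz IH].
  apply: altwordS hy => //; first exact: JJ'.
  by move=> kj; apply: nJj; rewrite -kj.
by rewrite -mulrA; apply: altwordS IH => //; exact: JJ'.
Qed.

Hypothesis X_free : star_free star iota E X.

Lemma expect_altword J i x : altword J i x -> E x = 0.
Proof.
move=> h.
have [k [idx [a [idx0 ha hi ->]]]] : exists k (idx : nat -> nat) (a : nat -> A),
    [/\ idx 0%N = i,
        forall j, (j < k.+1)%N -> alg (idx j) (a j) /\ E (a j) = 0,
        forall j, (j.+1 < k.+1)%N -> idx j <> idx j.+1 &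
        x = \prod_(0 <= j < k.+1) a j].
  elim: h => [{}i a _ ia|{}i j a {}x _ ia ij jx [k [idx [f [idx0 hf hi ->]]]]].
    exists 0%N, (fun=> i), (fun=> a); split => //.
    by rewrite big_nat1.
  exists k.+1, (fun n => if n is n'.+1 then idx n' else i),
    (fun n => if n is n'.+1 then f n' else a).
  split=> //.
  - by case=> [|l] //= hl; apply: hf.
  - by case=> [|l] //= hl; [rewrite idx0 | apply: hi].
  - by rewrite [RHS]big_nat_recl.
by have := @X_free k.+1 idx a (ltn0Sn k) ha hi; apply.
Qed.

Lemma expect_span J i x : add_span (altword J i) x -> E x = 0.
Proof.
elim=> [|u v hu _ IH]; first by rewrite raddf0.
by rewrite raddfD /= IH (expect_altword hu) addr0.
Qed.

(** The adjoint reverses [x], so its first letter meets the first letter of [y], and these have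
    distinct indices. The induction moves one letter at a time:
    [star (a * z) * y = star z * (star a * y)], where [star a * y] is again an alternating word. *)
Lemma expect_star_altword J J' i j x y : i <> j ->
  altword J i x -> altword J' j y -> E (star x * y) = 0.
Proof.
move=> ij hx; elim: hx J' j ij y => [k a _ ka|k l a z _ ka kl lz IH] J' j kj y hy.
  apply: (@expect_altword (fun=> True) k).
  apply: (altwordS (j := j)) => //; last by apply: (altword_mono _ hy).
  exact: centered_star.
rewrite mx_starM -mulrA; apply: (IH (fun=> True) k); first exact/nesym.
apply: (altwordS (j := j)) => //; last by apply: (altword_mono _ hy).
exact: centered_star.
Qed.

Lemma expect_star_span J J' i j x y : i <> j ->
  add_span (altword J i) x -> add_span (altword J' j) y -> E (star x * y) = 0.
Proof.
move=> ij hx hy; elim: hx => [|u v hu _ IH].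
  by rewrite mx_star0 mul0r raddf0.
rewrite mx_starD mulrDl raddfD /= IH addr0.
elim: hy => [|w z hw _ IHw]; first by rewrite mulr0 raddf0.
by rewrite mulrDr raddfD /= IHw (expect_star_altword ij hu hw) addr0.
Qed.

Section Decomposition.
Variables (J : nat -> Prop) (n : nat).
Hypothesis J_lt : forall i, J i -> (i < n)%N.

(** [J] is the set of all indices below [n] in the norm estimate, and omits one of them in the
    leave-one-out argument. *)
Definition decomposable x := exists b (w : nat -> A),
  (forall i, add_span (altword J i) (w i)) /\ x = iota b + \sum_(i < n) w i.

Lemma decomposableD x y : decomposable x -> decomposable y -> decomposable (x + y).
Proof.
move=> [b [w [hw ->]]] [c [v [hv ->]]]; exists (b + c), (fun i => w i + v i).
split=> [i|]; first exact: add_span_add.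
by rewrite raddfD big_split /= addrACA.
Qed.

Lemma decomposable_iota b : decomposable (iota b).
Proof.
exists b, (fun=> 0); split=> [i|]; first exact: add_span0.
by rewrite big1 // addr0.
Qed.

Lemma decomposable0 : decomposable 0.
Proof. by have := decomposable_iota 0; rewrite raddf0. Qed.

Lemma decomposable_word i x : altword J i x -> decomposable x.
Proof.
move=> h; exists 0, (fun k => if k == i then x else 0); split=> [k|].
  by case: eqP => [->|_]; [exact: add_span1 | exact: add_span0].
have Ji : J i by case: h.
rewrite raddf0 add0r (bigD1 (Ordinal (J_lt Ji))) //= eqxx big1 ?addr0 // => k /eqP nk.
by case: eqP => // e; case: nk; apply: val_inj.
Qed.

(** If [a] has the index of the first letter, it merges with that letter, and the product is split
    into a centered part and its expectation; the latter shortens the word by a letter, possibly to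
    a matrix. Otherwise [a] itself is split. *)
Lemma decomposable_mul_word i k a x : alg i a -> J i -> altword J k x ->
  decomposable (a * x).
Proof.
move=> ia Ji; case=> [{}k y Jk ky|{}k l y {}x Jk ky kl lx].
  have [e|ik] := eqVneq i k.
    have iay : alg i (a * y) by apply: algM => //; rewrite e; case: ky.
    have [d id ->] := alg_split iay.
    apply: decomposableD; last exact: decomposable_iota.
    by apply: (@decomposable_word i); exact: altword1.
  have [d id ->] := alg_split ia; rewrite mulrDl; apply: decomposableD.
    apply: (@decomposable_word i); apply: (altwordS (j := k)) => //; first exact/eqP.
    exact: altword1.
  by apply: (@decomposable_word k); apply: altword_iotal; exact: altword1.
have [e|ik] := eqVneq i k.
  have iay : alg i (a * y) by apply: algM => //; rewrite e; case: ky.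
  have [d id E'] := alg_split iay; rewrite mulrA E' mulrDl; apply: decomposableD.
    apply: (@decomposable_word i); apply: (altwordS (j := l)) => //.
    by rewrite e.
  by apply/decomposable_word/altword_iotal; exact: lx.
have [d id ->] := alg_split ia; rewrite mulrDl; apply: decomposableD.
  apply: (@decomposable_word i); apply: (altwordS (j := k)) => //; first exact/eqP.
  exact: altwordS kl lx.
by apply/decomposable_word/altword_iotal/(altwordS Jk ky kl lx).
Qed.

Lemma decomposable_mul i a x : alg i a -> J i -> decomposable x ->
  decomposable (a * x).
Proof.
move=> ia Ji [b [w [hw ->]]]; rewrite mulrDr; apply: decomposableD.
  have iab : alg i (a * iota b) by apply: algM => //; exact: alg_iota.
  have [d id ->] := alg_split iab.
  apply: decomposableD; last exact: decomposable_iota.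
  by apply: (@decomposable_word i); exact: altword1.
rewrite mulr_sumr; elim/big_rec: _ => [|k y _ IH].
  exact: decomposable0.
apply: decomposableD => //; elim: (hw k) => [|u v hu _ {}IH].
  by rewrite mulr0; exact: decomposable0.
by rewrite mulrDr; apply: decomposableD => //; exact: (decomposable_mul_word ia Ji hu).
Qed.

Lemma decomposable_iotal b x : decomposable x -> decomposable (iota b * x).
Proof.
move=> [c [w [hw ->]]]; exists (b * c), (fun i => iota b * w i); split=> [i|].
  apply: (@add_span_map (altword J i) _ (fun x => iota b * x)) (hw i).
  - by rewrite mulr0.
  - by move=> u v; rewrite mulrDr.
  - by move=> u hu; apply/add_span1/altword_iotal.
by rewrite rmorphM mulrDr mulr_sumr.
Qed.

Lemma decomposable_sum (I : Type) (s : seq I) (P : pred I) (F : I -> A) :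
  (forall i, P i -> decomposable (F i)) -> decomposable (\sum_(i <- s | P i) F i).
Proof.
move=> h; elim/big_rec: _ => [|k y Pk IH]; last by apply: decomposableD; first exact: h.
exact: decomposable0.
Qed.

Lemma expect_decomposable b (w : nat -> A) :
  (forall i, add_span (altword J i) (w i)) ->
  E (iota b + \sum_(i < n) w i) = b.
Proof.
move=> hw; rewrite raddfD /= mx_expect_embed // raddf_sum big1 ?addr0 // => i _.
exact: expect_span (hw i).
Qed.

Lemma altword_mul_decomposable i a x : centered i a -> ~ J i -> decomposable x ->
  add_span (altword (fun=> True) i) (a * x).
Proof.
move=> ia nJi [b [w [hw ->]]]; rewrite mulrDr; apply: add_span_add.
  by apply/add_span1/altword1 => //; exact: centered_iotar.
rewrite mulr_sumr; elim/big_rec: _ => [|k y _ IH]; first exact: add_span0.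
apply: add_span_add => //.
apply: (@add_span_map (altword J k) _ (fun x => a * x)) (hw k).
- by rewrite mulr0.
- by move=> u v; rewrite mulrDr.
move=> u hu; apply/add_span1; apply: (altwordS (j := k)) => //.
  by move=> ik; apply: nJi; rewrite ik; case: hu.
by apply: (altword_mono _ hu).
Qed.

Lemma expect_centered_mul i a x : centered i a -> ~ J i -> decomposable x ->
  E (a * x) = 0.
Proof. by move=> ia nJi dx; apply: expect_span (altword_mul_decomposable ia nJi dx). Qed.

(** A word [u] of [x] standing between [a] and [a' * y] produces alternating words only, because no
    letter of [x] or [y] has index [i]; their expectation vanishes. Only [E x] survives from [x].
    Then [a * iota (E x) * a'] lies in the algebra of index [i], and its centered part is killed by
    the same argument applied to [y]. *)
Lemma expect_centered_mul4 i a a' x y : centered i a -> centered i a' -> ~ J i ->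
  decomposable x -> decomposable y ->
  E (a * x * a' * y) = E (a * iota (E x) * a') * E y.
Proof.
move=> ia ia' nJi [b [w [hw ->]]] dy.
rewrite expect_decomposable // mulrDr !mulrDl raddfD /= addrC.
rewrite -!mulrA mulr_suml mulr_sumr raddf_sum big1 => [|k _]; last first.
  have h := altword_mul_decomposable ia' nJi dy.
  apply: (@expect_span (fun=> True) i).
  apply: (@add_span_map (altword J k) _ (fun x => a * (x * (a' * y)))) (hw k).
  - by rewrite mul0r mulr0.
  - by move=> u v; rewrite mulrDl mulrDr.
  move=> u hu; apply: (@add_span_map (altword (fun=> True) i) _ (fun x => a * (u * x))) h.
  - by rewrite !mulr0.
  - by move=> z z'; rewrite !mulrDr.
  move=> z hz; apply: add_span1; apply: (altwordS (j := k)) => //.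
    by move=> ik; apply: nJi; rewrite ik; case: hu.
  by apply: altword_cat hu hz.
rewrite add0r; set c := a * (iota b * a').
have ic : alg i c.
  by apply: algM; [case: ia | apply: algM; [exact: alg_iota | case: ia']].
have -> : a * (iota b * (a' * y)) = c * y by rewrite /c !mulrA.
have [d id ->] := alg_split ic.
rewrite mulrDl !raddfD /= (expect_centered_mul id) // add0r mx_expect_mull //.
by rewrite mx_expect_embed // (proj2 id) add0r.
Qed.

End Decomposition.

End Freeness.

(** * The norm of a normalized free sum *)

Lemma sum_cauchy_schwarz (R : realType) (n : nat) (a b : 'I_n -> R) :
  (\sum_i a i * b i) ^+ 2 <= (\sum_i a i ^+ 2) * (\sum_i b i ^+ 2).
Proof.
apply: sqr_le_of_discr; try by apply: sumr_ge0 => i _; exact: sqr_ge0.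
move=> s; rewrite !mulr_sumr -!big_split /=; apply: sumr_ge0 => i _.
by have := sqr_ge0 (a i + s * b i); lra.
Qed.

Section NormBound.
Variables (R : realType) (C : cstarAlgType R) (m : nat) (tau : {scalar C}).
Hypotheses (tau_state : is_state tau) (tau_faithful : faithful_state tau).
Local Notation M := 'M[R[i]]_m.+1.
Local Notation A := 'M[C]_m.+1.
Local Notation iota := (@mx_embed R C m).
Local Notation star := (@mx_star R C m).
Local Notation E := (@mx_expect R C m tau).
Local Notation ip := (@ip R C m tau).
Local Notation l2norm := (@l2norm R C m tau).
Variable X : nat -> A.
Hypothesis X_free : star_free star iota E X.
Hypothesis X_centered : forall i, E (X i) = 0.
Variable B : R.
Hypothesis X_bounded : forall i, ent_norm (X i) <= B.
Implicit Types (a x y z u v : A) (b c : M).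

Local Notation word := (altword tau X).

Lemma entry_bound_ge0 : 0 <= B.
Proof. exact: le_trans (ent_norm_ge0 _) (X_bounded 0%N). Qed.

Lemma centered_gen i : centered tau X i (X i).
Proof. by split; [exact: alg_gen | exact: X_centered]. Qed.

Lemma ip_eq0 x y : E (star x * y) = 0 -> ip x y = 0.
Proof.
move=> /matrixP h; apply: big1 => i _; have := h i i; rewrite [LHS]mxE.
by rewrite /rtau => ->; rewrite mxE.
Qed.

Lemma ip_words J J' i j x y : i <> j ->
  add_span (word J i) x -> add_span (word J' j) y -> ip x y = 0.
Proof. by move=> ij hx hy; apply: ip_eq0; exact: (expect_star_span tau_state X_free ij hx hy). Qed.

Lemma ip_iota_word J i b x : add_span (word J i) x -> ip x (iota b) = 0.
Proof.
move=> hx; rewrite ipC //; apply: ip_eq0.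
by rewrite mx_star_embed mx_expect_mull // (expect_span X_free hx) mulr0.
Qed.

Lemma ip_words_sum J J' n (z w : nat -> A) b :
  (forall i, (i < n)%N -> add_span (word J i) (z i)) ->
  (forall i, (i < n)%N -> add_span (word J' i) (w i)) ->
  ip (\sum_(i < n) z i) (iota b + \sum_(i < n) w i) = \sum_(i < n) ip (z i) (w i).
Proof.
move=> hz hw; rewrite ip_suml //; apply: eq_bigr => i _.
rewrite ipDr (ip_iota_word _ (hz i (ltn_ord i))) add0r ip_sumr (bigD1 i) //=.
rewrite big1 ?addr0 // => j ji; apply: ip_words (hz i _) (hw j _) => //.
by move=> ij; case/eqP : ji; exact/val_inj.
Qed.

Lemma ip_decomposition J n (w : nat -> A) b (x := iota b + \sum_(i < n) w i) :
  (forall i, (i < n)%N -> add_span (word J i) (w i)) ->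
  ip x x = ip (iota b) (iota b) + \sum_(i < n) ip (w i) (w i).
Proof.
move=> hw; have H := ip_words_sum b hw hw; rewrite {1}/x ipDl // H; congr (_ + _).
rewrite /x ipDr ip_sumr big1 ?addr0 // => i _; rewrite ipC //.
exact: ip_iota_word (hw i (ltn_ord i)).
Qed.

Lemma sum_sqr_l2norm_le J n (w : nat -> A) b :
  (forall i, (i < n)%N -> add_span (word J i) (w i)) ->
  \sum_(i < n) l2norm (w i) ^+ 2 <= l2norm (iota b + \sum_(i < n) w i) ^+ 2.
Proof.
move=> hw; rewrite sqr_l2norm // (ip_decomposition b hw).
by under eq_bigr do rewrite sqr_l2norm //; rewrite lerDr ipxx_ge0.
Qed.

(** [w i] is orthogonal to the other components, so removing it cannot increase the norm. *)
Lemma l2norm_sub_component J n (w : nat -> A) b i :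
  (i < n)%N -> (forall i, (i < n)%N -> add_span (word J i) (w i)) ->
  l2norm (iota b + \sum_(j < n) w j - w i) <= l2norm (iota b + \sum_(j < n) w j).
Proof.
move=> ni hw; set x := iota b + _.
have xw : ip (w i) x = ip (w i) (w i).
  rewrite /x ipDr (ip_iota_word _ (hw i ni)) add0r ip_sumr (bigD1 (Ordinal ni)) //=.
  rewrite big1 ?addr0 // => j ji; apply: ip_words (hw i _) (hw j _) => //.
  by move=> ij; case/eqP : ji; exact/val_inj.
apply: (l2norm_le tau_state); first exact: l2norm_ge0.
rewrite sqr_l2norm // ipBl // !ipBr // (ipC tau_state x (w i)) xw subrr subr0.
by rewrite gerBl ipxx_ge0.
Qed.

Lemma word_mul_sub_component J n (w : nat -> A) b i a :
  (i < n)%N -> centered tau X i a ->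
  (forall i, (i < n)%N -> add_span (word J i) (w i)) ->
  add_span (word (fun=> True) i) (a * (iota b + \sum_(j < n) w j - w i)).
Proof.
move=> ni ia hw; rewrite (bigD1 (Ordinal ni)) //= [w i + _]addrC addrA addrK mulrDr.
apply: add_span_add; first by apply/add_span1/altword1 => //; exact: centered_iotar.
rewrite mulr_sumr; elim/big_rec: _ => [|k y ki IH]; first exact: add_span0.
apply: add_span_add => //.
apply: (@add_span_map _ _ _ (word J k) _ (fun x => a * x)) (hw k _) => //.
- by rewrite mulr0.
- by move=> u v; rewrite mulrDr.
move=> u hu; apply/add_span1; apply: (altwordS (j := k)) => //.
  by move=> ik; case/eqP : ki; exact/val_inj.
by apply: (altword_mono _ hu).
Qed.

(** The [n] summands start with distinct indices, hence are orthogonal, and each is at most [B]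
    times the norm of the decomposed vector. Pythagoras gives [sqrt n] where the triangle inequality
    would give [n]. *)
Lemma l2norm_sum_components n (w : nat -> A) b (a : nat -> A) J :
  (forall i, centered tau X i (a i)) -> (forall i, ent_norm (a i) <= B) ->
  (forall i, (i < n)%N -> add_span (word J i) (w i)) ->
  l2norm (\sum_(i < n) a i * (iota b + \sum_(j < n) w j - w i))
    <= Num.sqrt n%:R * B * l2norm (iota b + \sum_(j < n) w j).
Proof.
move=> ia aB hw; set x := iota b + _.
have hz i : (i < n)%N -> add_span (word (fun=> True) i) (a i * (x - w i)).
  by move=> ni; exact: word_mul_sub_component hw.
apply: (l2norm_le tau_state); first by rewrite !mulr_ge0 ?sqrtr_ge0 ?l2norm_ge0 ?entry_bound_ge0.
have := ip_words_sum 0 hz hz; rewrite raddf0 add0r => ->.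
rewrite !exprMn sqr_sqrtr ?ler0n // -mulrA mulr_natl -[X in _ *+ X]card_ord -sumr_const.
apply: ler_sum => i _; rewrite -sqr_l2norm // -exprMn lerXn2r ?nnegrE ?mulr_ge0 ?l2norm_ge0 ?entry_bound_ge0 //.
apply: le_trans (l2normM tau_state _ _) _.
apply: ler_pM => //; [exact: ent_norm_ge0 | exact: l2norm_ge0 |].
exact: (l2norm_sub_component b (ltn_ord i) hw).
Qed.

Lemma l2norm_sum_mul n x : (0 < n)%N ->
  decomposable tau X (fun i => (i < n)%N) n x ->
  l2norm (\sum_(i < n) X i * x) <= 3 * (Num.sqrt n%:R * B) * l2norm x.
Proof.
move=> n0 dx; set J := fun i : nat => _ in dx.
have B0 := entry_bound_ge0.
pose K := Num.sqrt n%:R * B.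
have BK : B <= K by rewrite ler_peMl // -[leLHS]sqrtr1 ler_wsqrtr // ler1n.
have K0 : 0 <= K by apply: le_trans BK.
(* It is enough to test against decomposable [y]: the vector to be estimated is itself decomposable
   and is inserted for [y] at the end. The factor 3 counts the three sums of the splitting. *)
have sesq y : decomposable tau X J n y ->
    `|ip y (\sum_(i < n) X i * x)| <= 3 * K * l2norm x * l2norm y.
  case: dx => b [w [hw ->]] [c [v [hv ->]]].
  have {}hw i : (i < n)%N -> add_span (word J i) (w i) by [].
  have {}hv i : (i < n)%N -> add_span (word J i) (v i) by [].
  set p := iota b + _; set q := iota c + _.
  (* The second sum, of the products of [star (X i) * (q - v i)] with [w i], is collected into one
     inner product with [p]: of all components of [p] only [w i] meets words starting with [i]. It
     then has the form of the first sum, for the adjoints. *)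
  have -> : ip q (\sum_(i < n) X i * p) = ip q (\sum_(i < n) X i * (p - w i)) +
      ip (\sum_(i < n) star (X i) * (q - v i)) p + \sum_(i < n) ip (v i) (X i * w i).
    have hz i : (i < n)%N -> add_span (word (fun=> True) i) (star (X i) * (q - v i)).
      move=> ni; apply: (word_mul_sub_component c ni _ hv).
      exact/(centered_star tau_state)/centered_gen.
    rewrite (ip_words_sum b hz hw) !ip_sumr -!big_split /=; apply: eq_bigr => i _.
    rewrite -(ipMr tau (q - v i)) mulrBr ipBr ipBl //; lra.
  have T1 : `|ip q (\sum_(i < n) X i * (p - w i))| <= K * l2norm p * l2norm q.
    apply: le_trans (ip_le tau_state _ _) _; rewrite mulrC ler_wpM2r ?l2norm_ge0 //.
    exact: (l2norm_sum_components b centered_gen X_bounded hw).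
  have T2 : `|ip (\sum_(i < n) star (X i) * (q - v i)) p| <= K * l2norm p * l2norm q.
    apply: le_trans (ip_le tau_state _ _) _; rewrite mulrAC ler_wpM2r ?l2norm_ge0 //.
    apply: (l2norm_sum_components c (a := fun i => star (X i)) _ _ hv) => i.
      exact/(centered_star tau_state)/centered_gen.
    by rewrite ent_norm_star.
  (* Cauchy-Schwarz over [i] and orthogonality of the components give the bound with [B] in place of
     [K], and [B <= K] because [n] is positive. *)
  have T3 : `|\sum_(i < n) ip (v i) (X i * w i)| <= K * l2norm p * l2norm q.
    apply: (@le_trans _ _ (B * (l2norm p * l2norm q))); last first.
      by rewrite -mulrA ler_wpM2r // mulr_ge0 ?l2norm_ge0.
    apply: le_trans (ler_norm_sum _ _ _) _.
    apply: (@le_trans _ _ (B * \sum_(i < n) l2norm (w i) * l2norm (v i))).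
      rewrite mulr_sumr; apply: ler_sum => i _; apply: le_trans (ip_le tau_state _ _) _.
      rewrite mulrC mulrA ler_wpM2r ?l2norm_ge0 //.
      by apply: le_trans (l2normM tau_state _ _) _; rewrite ler_wpM2r ?l2norm_ge0.
    rewrite ler_wpM2l // -(ler_pXn2r (n:=2)) ?nnegrE ?mulr_ge0 ?l2norm_ge0 //; last first.
      by apply: sumr_ge0 => i _; rewrite mulr_ge0 ?l2norm_ge0.
    apply: le_trans (sum_cauchy_schwarz _ _) _; rewrite exprMn.
    apply: ler_pM; try by apply: sumr_ge0 => i _; exact: sqr_ge0.
      exact: sum_sqr_l2norm_le hw.
    exact: sum_sqr_l2norm_le hv.
  move: T1 T2 T3; set t1 := ip q _; set t2 := ip _ p; set t3 := \sum_i _.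
  have := ler_normD (t1 + t2) t3; have := ler_normD t1 t2.
  by rewrite -/K; lra.
set y := \sum_(i < n) _ in sesq *.
have [->|y0] := eqVneq (l2norm y) 0.
  by rewrite !mulr_ge0 ?l2norm_ge0 ?sqrtr_ge0.
have {}y0 : 0 < l2norm y by rewrite lt_neqAle eq_sym y0 l2norm_ge0.
rewrite -(ler_pM2r y0) -expr2 sqr_l2norm //.
apply: le_trans (ler_norm _) (sesq y _).
apply: decomposable_sum => // i _; apply: (@decomposable_mul _ _ _ _ _ _ _ _ _ i) => //.
  exact: alg_gen.
exact: ltn_ord.
Qed.

Local Notation S := (normalized_sum X).
Local Notation rsqrt n := ((Num.sqrt n%:R)^-1 : R).

Lemma normalized_sumE n : S n = rscal C m (rsqrt n) * \sum_(i < n) X i.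
Proof. by apply/matrixP => i j; rewrite rscalE !mxE. Qed.

Lemma rsqrt_ge0 n : 0 <= rsqrt n.
Proof. by rewrite invr_ge0 sqrtr_ge0. Qed.

Lemma rsqrt_le1 n : rsqrt n <= 1.
Proof.
case: n => [|n]; first by rewrite sqrtr0 invr0.
by rewrite invf_le1 ?sqrtr_gt0 ?ltr0n // -[leLHS]sqrtr1 ler_wsqrtr // ler1n.
Qed.

(** The set [D] of decomposable elements contains 1 and is stable under matrices, [S n] and
    [star (S n)]. Thus [cnorm_entry_le] applies although the L2 bound is known on [D] only. *)
Lemma cnorm_normalized_sum n i j : cnorm (S n i j) <= 3 * B.
Proof.
have B0 := entry_bound_ge0.
case: n => [|n].
  by rewrite normalized_sumE big_ord0 mulr0 mxE cnorm0 mulr_ge0.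
set J := fun i => (i < n.+1)%N; pose D := decomposable tau X J n.+1.
have Db b y : D y -> D (iota b * y) by exact: decomposable_iotal.
have Dsum (a : nat -> A) y : (forall i, gen_star_algebra star iota (X i) (a i)) ->
    D y -> D (rscal C m (rsqrt n.+1) * (\sum_(i < n.+1) a i) * y).
  move=> ha Dy; rewrite -mulrA mulr_suml; apply: Db.
  apply: decomposable_sum => // k _; apply: (@decomposable_mul _ _ _ _ _ _ _ _ _ k) => //.
  exact: ltn_ord.
apply: (cnorm_entry_le tau_state tau_faithful (D := D)) => //.
- by rewrite mulr_ge0.
- by move=> y Dy; rewrite normalized_sumE; apply: Dsum => // k; exact: alg_gen.
- move=> y Dy; rewrite normalized_sumE rscalC mx_starM mx_star_sum.
  have -> : star (rscal C m (rsqrt n.+1)) = rscal C m (rsqrt n.+1).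
    by rewrite /rscal star_cscal conjc_real.
  apply: (Dsum (fun k => star (X k)) y _ Dy) => k.
  by apply: alg_star; exact: alg_gen.
- by rewrite /D -(rmorph1 iota); exact: decomposable_iota.
move=> y Dy; rewrite normalized_sumE -mulrA mulr_suml l2normZ // ger0_norm ?rsqrt_ge0 //.
have := l2norm_sum_mul (ltn0Sn n) Dy.
have s0 : 0 < Num.sqrt n.+1%:R :> R by rewrite sqrtr_gt0 ltr0n.
rewrite ler_pdivrMl // => /le_trans; apply.
by rewrite le_eqVlt; apply/orP; left; apply/eqP; ring.
Qed.

Lemma ent_norm_normalized_sum n : ent_norm (S n) <= (m.+1 ^ 2)%:R * (3 * B).
Proof.
rewrite natrX expr2 -mulrA mulr_natl.
rewrite -[X in _ *+ X]card_ord -sumr_const; apply: ler_sum => i _.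
rewrite mulr_natl -[X in _ *+ X]card_ord -sumr_const; apply: ler_sum => j _.
exact: cnorm_normalized_sum.
Qed.

End NormBound.

(** * Moments of the normalized sums *)

Section Monomials.
Variables (R : realType) (C : cstarAlgType R) (m : nat).
Local Notation M := 'M[R[i]]_m.+1.
Local Notation A := 'M[C]_m.+1.
Local Notation iota := (@mx_embed R C m).
Implicit Types (a d S T : A) (b c : M) (bs cs : seq M).

(** The shapes of the two factors in the moment recursion: [lmono] is [b a c_1 a ... a c_k], with
    coefficients at both ends, and [rmono] is [c_1 a ... c_k a]. A moment is the expectation of
    [a * rmono a bs]. *)
Definition lmono a b cs : A := iota b * \prod_(c <- cs) (a * iota c).

Definition rmono a cs : A := \prod_(c <- cs) (iota c * a).

Definition weight bs : R := \prod_(c <- bs) cent_norm c.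

Lemma weight_ge0 bs : 0 <= weight bs.
Proof. by apply: prodr_ge0 => c _; exact: cent_norm_ge0. Qed.

Lemma weight_take_drop p bs : weight (take p bs) * weight (drop p bs) = weight bs.
Proof. by rewrite -big_cat cat_take_drop. Qed.

Lemma weight_cons b bs : weight (b :: bs) = cent_norm b * weight bs.
Proof. by rewrite /weight big_cons. Qed.

Lemma weight_rcons b bs : weight (rcons bs b) = weight bs * cent_norm b.
Proof. by rewrite /weight big_rcons /= mulrC. Qed.

Lemma rmono_nil a : rmono a [::] = 1.
Proof. by rewrite /rmono big_nil. Qed.

Lemma rmono_cons a c cs : rmono a (c :: cs) = iota c * a * rmono a cs.
Proof. by rewrite /rmono big_cons. Qed.

Lemma lmono_nil a b : lmono a b [::] = iota b.
Proof. by rewrite /lmono big_nil mulr1. Qed.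

Lemma lmono_cons a b c cs : lmono a b (c :: cs) = iota b * (a * lmono a c cs).
Proof. by rewrite /lmono big_cons !mulrA. Qed.

Lemma lmono_rcons a b cs c : lmono a b (rcons cs c) = iota b * (a * rmono a cs) * iota c.
Proof.
elim: cs b => [|d cs IH] b.
  by rewrite /= lmono_cons lmono_nil rmono_nil mulr1 mulrA.
by rewrite rcons_cons lmono_cons IH rmono_cons !mulrA.
Qed.

(* Telescoping of [S = T + d] by the position of the leftmost factor [d]. *)
Lemma mono_expand S T d b bs : S = T + d ->
  iota b * S * rmono S bs = iota b * T * rmono T bs +
    \sum_(p < (size bs).+1) lmono T b (take p bs) * d * rmono S (drop p bs).
Proof.
move=> E; elim: bs b => [|c bs IH] b.
  by rewrite big_ord1 /= lmono_nil !rmono_nil !mulr1 E mulrDr.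
have {IH} := IH c; rewrite -rmono_cons => EQ.
rewrite {1}E mulrDr mulrDl {1}EQ mulrDr -addrA [in RHS]rmono_cons; congr (_ + _).
rewrite addrC [in RHS]big_ord_recl /= lmono_nil; congr (_ + _).
rewrite mulr_sumr; apply: eq_bigr => p _.
by rewrite /= lmono_cons !mulrA.
Qed.

Variables (K : R) (cm : R).
Hypotheses (K_ge1 : 1 <= K) (cm_ge1 : ent_norm (1 : A) <= cm).

Let K0 : 0 <= K. Proof. exact: le_trans K_ge1. Qed.
Let cm0 : 0 <= cm. Proof. exact: le_trans (ent_norm_ge0 _) cm_ge1. Qed.

(** The factor [cm] is the price of the empty monomial: the identity matrix need not have entrywise
    norm 1. It occurs once per monomial, not once per factor. *)
Lemma ent_norm_rmono a cs : ent_norm a <= K ->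
  ent_norm (rmono a cs) <= cm * K ^+ size cs * weight cs.
Proof.
move=> aK; elim: cs => [|c cs IH].
  by rewrite rmono_nil /weight big_nil !mulr1.
rewrite rmono_cons weight_cons /= exprS; apply: le_trans (ler_ent_normM _ _) _.
have -> : cm * (K * K ^+ size cs) * (cent_norm c * weight cs) =
   (cent_norm c * K) * (cm * K ^+ size cs * weight cs) by ring.
apply: ler_pM => //; try exact: ent_norm_ge0.
apply: le_trans (ler_ent_normM _ _) _; rewrite ent_norm_embed.
by rewrite ler_wpM2l // cent_norm_ge0.
Qed.

Lemma ent_norm_lmono a b cs : ent_norm a <= K ->
  ent_norm (lmono a b cs) <= cm * K ^+ size cs * (cent_norm b * weight cs).
Proof.
move=> aK; case/lastP: cs => [|cs c].
  rewrite lmono_nil ent_norm_embed /weight big_nil !mulr1 ler_peMl ?cent_norm_ge0 //.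
  apply: le_trans cm_ge1; apply: le_trans (ent_norm_ge (1 : A) 0 0).
  by rewrite mxE eqxx cnorm1.
rewrite lmono_rcons weight_rcons size_rcons exprS.
apply: le_trans (ler_ent_normM _ _) _; rewrite ent_norm_embed.
have -> : cm * (K * K ^+ size cs) * (cent_norm b * (weight cs * cent_norm c)) =
   (cent_norm b * (K * (cm * K ^+ size cs * weight cs))) * cent_norm c by ring.
rewrite ler_wpM2r ?cent_norm_ge0 //.
apply: le_trans (ler_ent_normM _ _) _; rewrite ent_norm_embed.
rewrite ler_wpM2l ?cent_norm_ge0 //; apply: le_trans (ler_ent_normM _ _) _.
by apply: ler_pM; rewrite ?ent_norm_ge0 // ent_norm_rmono.
Qed.

Lemma ent_norm_rmonoB S T cs e : ent_norm S <= K -> ent_norm T <= K ->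
  ent_norm (S - T) <= e ->
  ent_norm (rmono S cs - rmono T cs) <= cm * (size cs)%:R * K ^+ size cs * e * weight cs.
Proof.
move=> SK TK STe; have e0 : 0 <= e by apply: le_trans STe; exact: ent_norm_ge0.
elim: cs => [|c cs IH].
  by rewrite !rmono_nil subrr /ent_norm entry_sum0 ?cnorm0 // mulr0 !mul0r.
have -> : rmono S (c :: cs) - rmono T (c :: cs) = iota c * (S - T) * rmono S cs
    + iota c * T * (rmono S cs - rmono T cs).
  by rewrite !rmono_cons mulrBr mulrBl mulrBr addrA subrK.
apply: le_trans (ler_ent_normD _ _) _; rewrite weight_cons /=.
apply: (@le_trans _ _ (cent_norm c * e * (cm * K ^+ size cs * weight cs) +
   cent_norm c * K * (cm * (size cs)%:R * K ^+ size cs * e * weight cs))).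
  apply: lerD; apply: le_trans (ler_ent_normM _ _) _;
    (apply: ler_pM; [exact: ent_norm_ge0 | exact: ent_norm_ge0 | |]).
  - apply: le_trans (ler_ent_normM _ _) _; rewrite ent_norm_embed.
    by rewrite ler_wpM2l // cent_norm_ge0.
  - exact: ent_norm_rmono.
  - apply: le_trans (ler_ent_normM _ _) _; rewrite ent_norm_embed.
    by rewrite ler_wpM2l // cent_norm_ge0.
  - exact: IH.
rewrite -subr_ge0 exprS -natr1.
have -> : cm * ((size cs)%:R + 1) * (K * K ^+ size cs) * e * (cent_norm c * weight cs) -
   (cent_norm c * e * (cm * K ^+ size cs * weight cs) +
    cent_norm c * K * (cm * (size cs)%:R * K ^+ size cs * e * weight cs)) =
   (K - 1) * (cm * K ^+ size cs * e * cent_norm c * weight cs) by ring.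
by rewrite !mulr_ge0 ?subr_ge0 ?exprn_ge0 ?cent_norm_ge0 ?weight_ge0.
Qed.

Lemma ent_norm_lmonoB S T b cs e : ent_norm S <= K -> ent_norm T <= K ->
  ent_norm (S - T) <= e ->
  ent_norm (lmono S b cs - lmono T b cs)
    <= cm * (size cs)%:R * K ^+ size cs * e * (cent_norm b * weight cs).
Proof.
move=> SK TK STe; have e0 : 0 <= e by apply: le_trans STe; exact: ent_norm_ge0.
elim: cs b => [|c cs IH] b.
  by rewrite !lmono_nil subrr /ent_norm entry_sum0 ?cnorm0 // mulr0 !mul0r.
have -> : lmono S b (c :: cs) - lmono T b (c :: cs) = iota b * ((S - T) * lmono S c cs
    + T * (lmono S c cs - lmono T c cs)).
  by rewrite !lmono_cons mulrBl mulrBr addrA subrK mulrBr.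
apply: le_trans (ler_ent_normM _ _) _; rewrite ent_norm_embed weight_cons /=.
rewrite mulrCA ler_wpM2l ?cent_norm_ge0 //; apply: le_trans (ler_ent_normD _ _) _.
apply: (@le_trans _ _ (e * (cm * K ^+ size cs * (cent_norm c * weight cs)) +
   K * (cm * (size cs)%:R * K ^+ size cs * e * (cent_norm c * weight cs)))).
  apply: lerD; apply: le_trans (ler_ent_normM _ _) _;
    (apply: ler_pM; [exact: ent_norm_ge0 | exact: ent_norm_ge0 | |]) => //.
  exact: ent_norm_lmono.
rewrite -subr_ge0 exprS -natr1.
have -> : cm * ((size cs)%:R + 1) * (K * K ^+ size cs) * e * (cent_norm c * weight cs) -
   (e * (cm * K ^+ size cs * (cent_norm c * weight cs)) +
    K * (cm * (size cs)%:R * K ^+ size cs * e * (cent_norm c * weight cs))) =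
   (K - 1) * (cm * K ^+ size cs * e * (cent_norm c * weight cs)) by ring.
by rewrite !mulr_ge0 ?subr_ge0 ?exprn_ge0 ?cent_norm_ge0 ?weight_ge0.
Qed.

End Monomials.

(** * The approximate semicircular recursion *)

Section ApproxRecursion.
Variables (R : realType) (C : cstarAlgType R) (m : nat) (tau : {scalar C}).
Hypotheses (tau_state : is_state tau) (tau_faithful : faithful_state tau).
Local Notation M := 'M[R[i]]_m.+1.
Local Notation A := 'M[C]_m.+1.
Local Notation iota := (@mx_embed R C m).
Local Notation star := (@mx_star R C m).
Local Notation E := (@mx_expect R C m tau).
Variable X : nat -> A.
Hypothesis X_free : star_free star iota E X.
Hypothesis X_centered : forall i, E (X i) = 0.
Hypothesis X_dist : same_star_distribution star iota E X.
Variable B : R.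
Hypothesis X_bounded : forall i, ent_norm (X i) <= B.
Implicit Types (b c : M) (bs cs : seq M).

Local Notation S := (normalized_sum X).
Local Notation rsqrt n := ((Num.sqrt n%:R)^-1 : R).
Local Notation eta := (op_covariance iota E (X 0%N)).

(** A single constant dominating 1, the norms of the [X i], those of the [S n], and those of [S n]
    with one summand removed; the last case uses the sum of two terms. *)
Definition mom_const : R := 1 + B + (m.+1 ^ 2)%:R * (3 * B).
Local Notation K := mom_const.
Local Notation cm := (ent_norm (1 : A)).

Let B0 : 0 <= B := entry_bound_ge0 X_bounded.
Let B3 : 0 <= (m.+1 ^ 2)%:R * (3 * B).
Proof. by rewrite !mulr_ge0. Qed.

Lemma mom_const_ge1 : 1 <= K.
Proof. by rewrite /K; move: B0 B3; lra. Qed.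

Let K0 : 0 <= K := le_trans ler01 mom_const_ge1.

Lemma le_mom_const : B <= K.
Proof. by rewrite /K; move: B0 B3; lra. Qed.

Lemma ent_norm1_ge1 : 1 <= cm.
Proof.
apply: le_trans (ent_norm_ge (1 : A) 0 0).
by rewrite mxE eqxx cnorm1.
Qed.

Lemma ent_norm_S n : ent_norm (S n) <= K.
Proof.
have := ent_norm_normalized_sum tau_state tau_faithful X_free X_centered X_bounded n.
by rewrite /K; move: B0; lra.
Qed.

Lemma covariance_eq i b : op_covariance iota E (X i) b = eta b.
Proof.
have := X_dist i 0%N false [:: (b, false)].
by rewrite /star_moment !big_seq1 /= /op_covariance !mulrA.
Qed.

Lemma covarianceB b c : eta (b - c) = eta b - eta c.
Proof. by rewrite /op_covariance raddfB mulrBr mulrBl raddfB. Qed.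

Lemma cent_norm_covariance b : cent_norm (eta b) <= K ^+ 2 * cent_norm b.
Proof.
apply: le_trans (cent_norm_expect tau_state _) _.
apply: le_trans (ler_ent_normM _ _) _.
have XK : ent_norm (X 0%N) <= K by apply: le_trans le_mom_const.
have -> : K ^+ 2 * cent_norm b = (K * cent_norm b) * K by ring.
apply: ler_pM; rewrite ?ent_norm_ge0 //; apply: le_trans (ler_ent_normM _ _) _.
by rewrite ent_norm_embed ler_wpM2r ?cent_norm_ge0.
Qed.

(** A summand of the semicircular recursion at [S n], but with the covariance of [X 0]. As this
    covariance does not depend on [n], the recursions of different [S n] can be compared. *)
Definition recursion_term n b bs p : M :=
  eta (E (lmono (S n) b (take p bs))) * E (rmono (S n) (drop p bs)).

(** There are three error terms, each with two monomials ([cm ^+ 2]), two factors [X i] ([K ^+ 2])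
    and one difference of [S n] and [T], of size [r * B <= r * K]. *)
Definition recursion_const : R := 3 * cm ^+ 2 * K ^+ 3.

(** The point is the order [r ^+ 2] with [r = rsqrt n]: the explicit summand [d = r X i] gives one
    factor [r], and each exchange of [S n] with [T = S n - d] in a neighbouring monomial gives
    another. The factor [N + 1] counts the positions of the leftmost [d], and [N] bounds the number
    of exchanged letters. *)
Lemma leave_one_out n i b bs (beta := cent_norm b * weight bs) (N := (size bs)%:R) :
  (i < n)%N ->
  cent_norm (E (X i * (iota b * S n * rmono (S n) bs))
             - rscalar m (rsqrt n) * \sum_(p < (size bs).+1) recursion_term n b bs p)
    <= (rsqrt n) ^+ 2 * ((N + 1) * N * recursion_const * K ^+ size bs * beta).
Proof.
move=> ni; set r := rsqrt n.
have r0 : 0 <= r by exact: rsqrt_ge0.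
have r1 : r <= 1 by exact: rsqrt_le1.
pose d := rscal C m r * X i; pose T := S n - d.
have ST : S n = T + d by rewrite /T subrK.
have dB : ent_norm d <= r * B by rewrite ent_norm_rscal ger0_norm // ler_wpM2l.
have SK : ent_norm (S n) <= K by exact: ent_norm_S.
have TK : ent_norm T <= K.
  apply: le_trans (ler_ent_normB _ _) _.
  have := ent_norm_normalized_sum tau_state tau_faithful X_free X_centered X_bounded n.
  move: dB (B0); rewrite /K; nra.
have dST : ent_norm (S n - T) <= r * B by rewrite ST addrC addKr.
have XK j : ent_norm (X j) <= K by apply: le_trans (X_bounded j) le_mom_const.
pose J := fun k => (k < n)%N /\ k <> i.
have J_lt k : J k -> (k < n)%N by case.
have nJi : ~ J i by case.
have ci := centered_gen X_centered i.
have TE : T = rscal C m r * \sum_(k < n | k != i :> nat) X k.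
  rewrite /T normalized_sumE -/r /d (bigD1 (Ordinal ni)) //= mulrDr addrC addKr.
  by congr (_ * _); apply: eq_bigl => k.
have dT x : decomposable tau X J n x -> decomposable tau X J n (T * x).
  move=> dx; rewrite TE -mulrA mulr_suml; apply: decomposable_iotal.
  apply: decomposable_sum => // k /eqP ki.
  by apply: (@decomposable_mul _ _ _ _ _ _ _ _ _ k) => //; exact: alg_gen.
have d1 : decomposable tau X J n 1 by rewrite -(rmorph1 iota); exact: decomposable_iota.
have dR cs : decomposable tau X J n (rmono T cs).
  elim: cs => [|c cs IH]; first by rewrite rmono_nil.
  by rewrite rmono_cons -mulrA; apply: decomposable_iotal => //; apply: dT.
have dL c cs : decomposable tau X J n (lmono T c cs).
  elim: cs c => [|c' cs IH] c; first by rewrite lmono_nil; exact: decomposable_iota.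
  by rewrite lmono_cons; apply: decomposable_iotal => //; apply: dT.
rewrite (mono_expand b bs ST) mulrDr raddfD /=.
(* The term without [d] vanishes: the centered [X i] stands in front of an element decomposable
   without the index [i]. *)
rewrite (expect_centered_mul X_free (n := n) ci nJi); last first.
  by rewrite -mulrA; apply: decomposable_iotal => //; apply: dT.
rewrite add0r mulr_sumr raddf_sum /= mulr_sumr -sumrB.
apply: le_trans (ler_cent_norm_sum _ _ _) _.
have -> : r ^+ 2 * ((N + 1) * N * recursion_const * K ^+ size bs * beta) =
  \sum_(p < (size bs).+1) r ^+ 2 * (N * recursion_const * K ^+ size bs * beta).
  by rewrite sumr_const card_ord -[RHS]mulr_natl -natr1 -/N; ring.
apply: ler_sum => p _.
set q := nat_of_ord p.
have qs : (q <= size bs)%N by rewrite -ltnS ltn_ord.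
set U := lmono (S n) b (take q bs); set V := rmono (S n) (drop q bs).
set U' := lmono T b (take q bs); set V' := rmono T (drop q bs).
have sz1 : size (take q bs) = q by rewrite size_take_min; apply/minn_idPl.
have sz2 : size (drop q bs) = (size bs - q)%N by rewrite size_drop.
pose u := cent_norm b * weight (take q bs); pose v := weight (drop q bs).
have u0 : 0 <= u by rewrite mulr_ge0 ?cent_norm_ge0 ?weight_ge0.
have v0 : 0 <= v by exact: weight_ge0.
have uv : u * v = beta by rewrite /u /v -mulrA weight_take_drop.
have lecm : cm <= cm by [].
have K1 := mom_const_ge1.
have hU : ent_norm U <= cm * K ^+ q * u by have := ent_norm_lmono lecm b (take q bs) SK; rewrite sz1.
have hU' : ent_norm U' <= cm * K ^+ q * u by have := ent_norm_lmono lecm b (take q bs) TK; rewrite sz1.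
have hV' : ent_norm V' <= cm * K ^+ (size bs - q) * v.
  by have := ent_norm_rmono lecm (drop q bs) TK; rewrite sz2.
have hdU : ent_norm (U' - U) <= cm * N * K ^+ q * (r * B) * u.
  rewrite -ent_normN opprB.
  have := ent_norm_lmonoB K1 lecm b (take q bs) SK TK dST; rewrite sz1 -/U -/U'.
  move/le_trans; apply; rewrite -!mulrA ler_wpM2l ?ent_norm_ge0 //.
  by rewrite ler_wpM2r ?ler_nat // !mulr_ge0 ?exprn_ge0 ?cent_norm_ge0 ?weight_ge0.
have hdV : ent_norm (V - V') <= cm * N * K ^+ (size bs - q) * (r * B) * v.
  have := ent_norm_rmonoB K1 lecm (drop q bs) SK TK dST; rewrite sz2 -/V -/V'.
  move/le_trans; apply; rewrite -!mulrA ler_wpM2l ?ent_norm_ge0 //.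
  by rewrite ler_wpM2r ?ler_nat ?leq_subr // !mulr_ge0 ?exprn_ge0 ?cent_norm_ge0 ?weight_ge0.
have -> : X i * (U' * d * V) = rscal C m r * (X i * U' * X i * V).
  by rewrite /d !mulrA -[_ * rscal _ _ _]rscalC !mulrA.
rewrite mx_expect_mull // -mulrBr cent_norm_rscalar ger0_norm //.
rewrite expr2 -[leRHS]mulrA ler_wpM2l //.
(* The right monomial is first changed from [S n] to [T], so that [expect_centered_mul4] factors the
   expectation. After the factorization both monomials are changed back from [T] to [S n]. These are
   the three errors. *)
have -> : E (X i * U' * X i * V) - recursion_term n b bs q =
    E (X i * U' * X i * (V - V')) + eta (E U' - E U) * E V' - eta (E U) * E (V - V').
  have -> : E (X i * U' * X i * V) = E (X i * U' * X i * (V - V')) + eta (E U') * E V'.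
    rewrite -(covariance_eq i) /op_covariance.
    rewrite -(expect_centered_mul4 tau_state X_free ci ci nJi (dL b _) (dR _)).
    by rewrite -raddfD -mulrDr subrK.
  rewrite /recursion_term -/U -/V; set W := E (_ * (V - V')).
  rewrite covarianceB mulrBl raddfB mulrBr.
  by rewrite opprB !addrA subrK.
apply: le_trans (ler_cent_normD _ _) _; rewrite cent_normN.
have hE1 : cent_norm (E (X i * U' * X i * (V - V'))) <=
    (K * (cm * K ^+ q * u)) * K * (cm * N * K ^+ (size bs - q) * (r * B) * v).
  apply: le_trans (cent_norm_expect tau_state _) _.
  apply: le_trans (ler_ent_normM _ _) _; apply: ler_pM; rewrite ?ent_norm_ge0 //.
  apply: le_trans (ler_ent_normM _ _) _; apply: ler_pM; rewrite ?ent_norm_ge0 //.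
  by apply: le_trans (ler_ent_normM _ _) _; apply: ler_pM; rewrite ?ent_norm_ge0.
have hE2 : cent_norm (eta (E U' - E U) * E V') <=
    (K ^+ 2 * (cm * N * K ^+ q * (r * B) * u)) * (cm * K ^+ (size bs - q) * v).
  apply: le_trans (ler_cent_normM _ _) _; apply: ler_pM; rewrite ?cent_norm_ge0 //.
    apply: le_trans (cent_norm_covariance _) _; rewrite ler_wpM2l ?sqr_ge0 //.
    by rewrite -raddfB; apply: le_trans (cent_norm_expect tau_state _) _.
  by apply: le_trans (cent_norm_expect tau_state _) _.
have hE3 : cent_norm (eta (E U) * E (V - V')) <=
    (K ^+ 2 * (cm * K ^+ q * u)) * (cm * N * K ^+ (size bs - q) * (r * B) * v).
  apply: le_trans (ler_cent_normM _ _) _; apply: ler_pM; rewrite ?cent_norm_ge0 //.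
    apply: le_trans (cent_norm_covariance _) _; rewrite ler_wpM2l ?sqr_ge0 //.
    by apply: le_trans (cent_norm_expect tau_state _) _.
  by apply: le_trans (cent_norm_expect tau_state _) _.
have h12 := ler_cent_normD (E (X i * U' * X i * (V - V'))) (eta (E U' - E U) * E V').
apply: (@le_trans _ _ (3 * (cm ^+ 2 * K ^+ 2 * N * (K ^+ q * K ^+ (size bs - q)) *
    (r * B) * (u * v)))).
  move: hE1 hE2 hE3 h12.
  set e1 := cent_norm (E _); set e2 := cent_norm (_ * E V'); set e3 := cent_norm (_ * E (_ - _)).
  have -> : K * (cm * K ^+ q * u) * K * (cm * N * K ^+ (size bs - q) * (r * B) * v) =
    cm ^+ 2 * K ^+ 2 * N * (K ^+ q * K ^+ (size bs - q)) * (r * B) * (u * v) by ring.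
  have -> : K ^+ 2 * (cm * N * K ^+ q * (r * B) * u) * (cm * K ^+ (size bs - q) * v) =
    cm ^+ 2 * K ^+ 2 * N * (K ^+ q * K ^+ (size bs - q)) * (r * B) * (u * v) by ring.
  have -> : K ^+ 2 * (cm * K ^+ q * u) * (cm * N * K ^+ (size bs - q) * (r * B) * v) =
    cm ^+ 2 * K ^+ 2 * N * (K ^+ q * K ^+ (size bs - q)) * (r * B) * (u * v) by ring.
  lra.
rewrite -exprD subnKC // uv /recursion_const.
have -> : r * (N * (3 * cm ^+ 2 * K ^+ 3) * K ^+ size bs * beta) =
  3 * (cm ^+ 2 * K ^+ 2 * N * K ^+ size bs * (r * K) * beta) by ring.
rewrite ler_wpM2l // ler_wpM2r //; first by rewrite -uv mulr_ge0.
apply: ler_wpM2l; first by rewrite !mulr_ge0 ?exprn_ge0 ?ent_norm_ge0.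
by rewrite ler_wpM2l ?le_mom_const.
Qed.

Lemma rsqrt_sqr n : (0 < n)%N -> rsqrt n ^+ 2 * n%:R = 1.
Proof.
by move=> n0; rewrite exprVn sqr_sqrtr ?ler0n // mulVf // pnatr_eq0 -lt0n.
Qed.

(** The first factor is expanded as [r] times the sum of the [X i]. Since [r ^+ 2 * n = 1], the main
    terms add up to the recursion with coefficient one, and the [n] errors of order [r ^+ 2] with
    the prefactor [r] leave an error of order [r]. *)
Lemma approx_recursion n b bs (N := (size bs)%:R) : (0 < n)%N ->
  cent_norm (op_moment iota E (S n) (b :: bs)
             - \sum_(p < (size bs).+1) recursion_term n b bs p)
    <= rsqrt n * ((N + 1) * N * recursion_const * K ^+ size bs * (cent_norm b * weight bs)).
Proof.
move=> n0; set F := \sum_(p < _) _; set Z := _ * _ * _ * _ * _; set r := rsqrt n.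
have r0 : 0 <= r by exact: rsqrt_ge0.
have -> : op_moment iota E (S n) (b :: bs) =
    rscalar m r * \sum_(i < n) E (X i * (iota b * S n * rmono (S n) bs)).
  rewrite /op_moment big_cons -/(rmono (S n) bs) {1}normalized_sumE -/r.
  by rewrite -(mulrA (rscal C m r)) mx_expect_mull // mulr_suml raddf_sum.
have {1}-> : F = rscalar m r * \sum_(i < n) rscalar m r * F.
  have rsE t : rscalar m t * F = t%:C%C *: F by rewrite -mul_scalar_mx.
  rewrite sumr_const card_ord rsE -[_ *+ n]scaler_nat.
  have -> G : rscalar m r * G = r%:C%C *: G by rewrite -mul_scalar_mx.
  rewrite !scalerA (_ : _ * _ = (r ^+ 2 * n%:R)%:C%C); last first.
    by rewrite expr2 !rmorphM rmorph_nat /= mulrAC.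
  by rewrite rsqrt_sqr // scale1r.
rewrite -mulrBr -sumrB cent_norm_rscalar ger0_norm //.
apply: (@le_trans _ _ (r * \sum_(i < n) r ^+ 2 * Z)).
  rewrite ler_wpM2l //; apply: le_trans (ler_cent_norm_sum _ _ _) _.
  by apply: ler_sum => i _; exact: leave_one_out.
rewrite sumr_const card_ord -mulr_natr [r ^+ 2 * Z * _]mulrAC rsqrt_sqr //.
by rewrite mul1r.
Qed.

End ApproxRecursion.

(** * Comparison of the moments of two normalized sums *)

Lemma ltn_mul_succ_expn4 n : (n.+1 * n <= 4 ^ n)%N.
Proof.
elim: n => [//|n IH]; rewrite expnS.
have nw := ltn_expl n (isT : (1 < 4)%N); rewrite 2!mulSn addnA [(n * _)%N]mulnC.
have -> : (4 * 4 ^ n = (4 ^ n + 4 ^ n) + (4 ^ n + 4 ^ n))%N by rewrite (mulnDl 2 2) !mul2n -!addnn.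
apply: leq_add; first exact: leq_add.
exact: leq_trans IH (leq_addr _ _).
Qed.

(** Summing over the cut positions of a moment costs a factor 2, independent of its length, as soon
    as the rate [G] is at least twice [K]. This is what lets a purely geometric bound survive the
    induction on the length. *)
Lemma geometric_mix_le (R : realType) (K G : R) n : 0 <= K -> 2 * K <= G ->
  \sum_(p < n.+1) K ^+ p * G ^+ (n - p) <= 2 * G ^+ n.
Proof.
move=> K0 KG; elim: n => [|n IH].
  by rewrite big_ord1 !expr0; lra.
rewrite big_ord_recl expr0 mul1r subn0.
under eq_bigr => p _ do rewrite lift0 exprS subSS -mulrA.
rewrite -mulr_sumr [in leRHS]exprS exprS.
have : 0 <= G ^+ n by rewrite exprn_ge0 //; lra.
by move: IH; set s := \sum_(_ < _) _; set g := G ^+ n => H g0; nra.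
Qed.

Section MomentDiff.
Variables (R : realType) (C : cstarAlgType R) (m : nat) (tau : {scalar C}).
Hypotheses (tau_state : is_state tau) (tau_faithful : faithful_state tau).
Local Notation M := 'M[R[i]]_m.+1.
Local Notation A := 'M[C]_m.+1.
Local Notation iota := (@mx_embed R C m).
Local Notation star := (@mx_star R C m).
Local Notation E := (@mx_expect R C m tau).
Variable X : nat -> A.
Hypothesis X_free : star_free star iota E X.
Hypothesis X_centered : forall i, E (X i) = 0.
Hypothesis X_dist : same_star_distribution star iota E X.
Variable B : R.
Hypothesis X_bounded : forall i, ent_norm (X i) <= B.
Implicit Types (b c : M) (bs cs : seq M).

Local Notation S := (normalized_sum X).
Local Notation rsqrt n := ((Num.sqrt n%:R)^-1 : R).
Local Notation eta := (op_covariance iota E (X 0%N)).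
Local Notation K := (mom_const m B).
Local Notation cm := (ent_norm (1 : A)).
Local Notation L := (recursion_const C m B).

(** Chosen so that the induction on the length closes: [L] absorbs the errors of the recursion,
    [4 * K ^+ 2 * cm] the sum over the cut positions, and [4 * K] ensures [4 * K <= G] and
    [1 <= G]. *)
Definition growth : R := L + 4 * K ^+ 2 * cm + 4 * K.
Local Notation G := growth.

Let K1 : 1 <= K := mom_const_ge1 X_bounded.
Let K0 : 0 <= K := le_trans ler01 K1.
Let cm1 : 1 <= cm := ent_norm1_ge1 C m.
Let cm0 : 0 <= cm := ent_norm_ge0 _.
Let L0 : 0 <= L.
Proof. by rewrite !mulr_ge0 ?exprn_ge0. Qed.

Lemma growth_ge : 1 <= G /\ 4 * K <= G.
Proof.
have : 0 <= 4 * K ^+ 2 * cm by rewrite !mulr_ge0 ?sqr_ge0.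
by rewrite /G; move: L0 K1; lra.
Qed.

(** The outer coefficients leave the expectation by the bimodule property, and a strictly shorter
    moment remains. The premise is the induction hypothesis of [moment_diff], restricted to such
    moments. *)
Lemma expect_lmono_diff n l b cs (e : R) : 0 <= e ->
  (forall bs, (size bs < size cs)%N ->
     cent_norm (op_moment iota E (S n) bs - op_moment iota E (S l) bs)
       <= G ^+ size bs * weight bs * e) ->
  cent_norm (E (lmono (S n) b cs) - E (lmono (S l) b cs))
    <= G ^+ size cs * (cent_norm b * weight cs) * e.
Proof.
move=> e0 IH; case/lastP: cs IH => [|cs c] IH.
  rewrite !lmono_nil subrr cent_norm0 !mulr_ge0 ?exprn_ge0 ?cent_norm_ge0 ?weight_ge0 //.
  by move: growth_ge; lra.
have {}IH := IH cs (eq_leq (esym (size_rcons _ _))).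
rewrite !lmono_rcons !mx_expect_bimod -mulrBl -mulrBr size_rcons weight_rcons.
have G1 := proj1 growth_ge.
apply: (@le_trans _ _ (cent_norm b * (G ^+ size cs * weight cs * e) * cent_norm c)).
  apply: le_trans (ler_cent_normM _ _) _; rewrite ler_wpM2r ?cent_norm_ge0 //.
  by apply: le_trans (ler_cent_normM _ _) _; rewrite ler_wpM2l ?cent_norm_ge0.
rewrite exprS -subr_ge0.
have -> : G * G ^+ size cs * (cent_norm b * (weight cs * cent_norm c)) * e -
  cent_norm b * (G ^+ size cs * weight cs * e) * cent_norm c =
  (G - 1) * (G ^+ size cs * (cent_norm b * (weight cs * cent_norm c)) * e) by ring.
rewrite !mulr_ge0 ?subr_ge0 ?exprn_ge0 ?cent_norm_ge0 ?weight_ge0 //; lra.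
Qed.

Lemma expect_rmono_diff n l cs (e : R) : 0 <= e ->
  (forall bs, (size bs < size cs)%N ->
     cent_norm (op_moment iota E (S n) bs - op_moment iota E (S l) bs)
       <= G ^+ size bs * weight bs * e) ->
  cent_norm (E (rmono (S n) cs) - E (rmono (S l) cs)) <= G ^+ size cs * weight cs * e.
Proof.
have G1 := proj1 growth_ge; have G0 : 0 <= G by lra.
move=> e0; case: cs => [|c cs] IH.
  by rewrite !rmono_nil subrr cent_norm0 !mulr_ge0 ?exprn_ge0 ?weight_ge0.
have {}IH := IH cs (ltnSn _).
rewrite !rmono_cons -!mulrA !mx_expect_mull // -mulrBr weight_cons.
apply: (@le_trans _ _ (cent_norm c * (G ^+ size cs * weight cs * e))).
  by apply: le_trans (ler_cent_normM _ _) _; rewrite ler_wpM2l ?cent_norm_ge0.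
rewrite /= exprS -subr_ge0.
have -> : G * G ^+ size cs * (cent_norm c * weight cs * e) -
  cent_norm c * (G ^+ size cs * weight cs * e) =
  (G - 1) * (G ^+ size cs * (cent_norm c * weight cs) * e) by ring.
by rewrite !mulr_ge0 ?subr_ge0 ?exprn_ge0 ?cent_norm_ge0 ?weight_ge0.
Qed.

Lemma expect_S n : E (S n) = 0.
Proof.
by rewrite normalized_sumE mx_expect_mull // raddf_sum big1 ?mulr0 // => i _; exact: X_centered.
Qed.

(** Both moments satisfy the approximate recursion with the same [eta]. Their difference thus
    consists of the two recursion errors and of differences of shorter moments, which an induction
    on the length controls. *)
Lemma moment_diff n l bs : (0 < n)%N -> (0 < l)%N ->
  cent_norm (op_moment iota E (S n) bs - op_moment iota E (S l) bs)
    <= G ^+ size bs * weight bs * (rsqrt n + rsqrt l).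
Proof.
move=> n0 l0; set e := rsqrt n + _.
have e0 : 0 <= e by rewrite addr_ge0 // rsqrt_ge0.
have [G1 GK] := growth_ge; have G0 : 0 <= G by lra.
have [k] := ubnP (size bs); elim: k bs => // k IH [|b bs] sk.
  rewrite /op_moment !big_nil !mulr1 !expect_S subrr cent_norm0.
  by rewrite !mulr_ge0 ?weight_ge0 ?exprn_ge0.
have {}IH cs : (size cs <= size bs)%N ->
    cent_norm (op_moment iota E (S n) cs - op_moment iota E (S l) cs)
      <= G ^+ size cs * weight cs * e.
  by move=> h; apply: IH; rewrite (leq_ltn_trans h).
pose F i := \sum_(p < (size bs).+1) recursion_term tau X i b bs p.
set Z : R := 4 ^+ size bs * L * K ^+ size bs * weight (b :: bs).
have rec i : (0 < i)%N ->
    cent_norm (op_moment iota E (S i) (b :: bs) - F i) <= rsqrt i * Z.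
  move=> i0; apply: le_trans (approx_recursion tau_state tau_faithful X_free X_centered
    X_dist X_bounded b bs i0) _.
  rewrite ler_wpM2l ?rsqrt_ge0 // /Z weight_cons.
  rewrite ler_wpM2r ?mulr_ge0 ?weight_ge0 ?cent_norm_ge0 // ler_wpM2r ?exprn_ge0 //.
  (* The polynomial factor is absorbed into [4 ^+ size bs], which the inequality [4 * K <= G]
     absorbs in turn. *)
  by rewrite ler_wpM2r // natr1 -natrM -natrX ler_nat ltn_mul_succ_expn4.
have Fd : cent_norm (F n - F l) <= 4 * K ^+ 2 * cm * G ^+ size bs * weight (b :: bs) * e.
  rewrite -sumrB; apply: le_trans (ler_cent_norm_sum _ _ _) _.
  (* In each product difference one factor is a difference, bounded at rate [G] by induction, and
     the other is bounded at rate [K] by the norm of the sums. Using [G] for both factors would lose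
     the geometric sum over [p]. *)
  apply: (@le_trans _ _ (\sum_(p < (size bs).+1) (K ^+ 2 * cm * weight (b :: bs) * e) *
      (K ^+ (size bs - p) * G ^+ p + K ^+ p * G ^+ (size bs - p)))).
    apply: ler_sum => p _; rewrite /recursion_term.
    set q := nat_of_ord p.
    have qs : (q <= size bs)%N by rewrite -ltnS ltn_ord.
    have sz1 : size (take q bs) = q by rewrite size_take_min; apply/minn_idPl.
    have sz2 : size (drop q bs) = (size bs - q)%N by rewrite size_drop.
    pose u := cent_norm b * weight (take q bs); pose v := weight (drop q bs).
    have u0 : 0 <= u by rewrite mulr_ge0 ?cent_norm_ge0 ?weight_ge0.
    have v0 : 0 <= v by exact: weight_ge0.
    have uv : weight (b :: bs) = u * v by rewrite weight_cons /u /v -mulrA weight_take_drop.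
    have SK i : ent_norm (S i) <= K by apply: (ent_norm_S tau_state tau_faithful X_free X_centered X_bounded).
    have hU i : cent_norm (E (lmono (S i) b (take q bs))) <= cm * K ^+ q * u.
      apply: le_trans (cent_norm_expect tau_state _) _.
      by have := ent_norm_lmono (lexx cm) b (take q bs) (SK i); rewrite sz1.
    have hV i : cent_norm (E (rmono (S i) (drop q bs))) <= cm * K ^+ (size bs - q) * v.
      apply: le_trans (cent_norm_expect tau_state _) _.
      by have := ent_norm_rmono (lexx cm) (drop q bs) (SK i); rewrite sz2.
    have dU : cent_norm (E (lmono (S n) b (take q bs)) - E (lmono (S l) b (take q bs)))
        <= G ^+ q * u * e.
      have := @expect_lmono_diff n l b (take q bs) e e0; rewrite sz1; apply=> cs h.
      by apply: IH; rewrite (leq_trans (ltnW h)).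
    have dV : cent_norm (E (rmono (S n) (drop q bs)) - E (rmono (S l) (drop q bs)))
        <= G ^+ (size bs - q) * v * e.
      have := @expect_rmono_diff n l (drop q bs) e e0; rewrite sz2; apply=> cs h.
      by apply: IH; rewrite (leq_trans (ltnW h)) // leq_subr.
    move: (hU l) (hV n) dU dV.
    set Un := E (lmono (S n) _ _); set Ul := E (lmono (S l) _ _).
    set Vn := E (rmono (S n) _); set Vl := E (rmono (S l) _) => {}hU {}hV dU dV.
    have -> : eta Un * Vn - eta Ul * Vl = eta (Un - Ul) * Vn + eta Ul * (Vn - Vl).
      by rewrite covarianceB mulrBl mulrBr addrA subrK.
    apply: le_trans (ler_cent_normD _ _) _.
    have -> : K ^+ 2 * cm * weight (b :: bs) * e *
        (K ^+ (size bs - q) * G ^+ q + K ^+ q * G ^+ (size bs - q)) =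
      (K ^+ 2 * (G ^+ q * u * e)) * (cm * K ^+ (size bs - q) * v) +
      (K ^+ 2 * (cm * K ^+ q * u)) * (G ^+ (size bs - q) * v * e) by rewrite uv; ring.
    apply: lerD; apply: le_trans (ler_cent_normM _ _) _;
      apply: ler_pM; rewrite ?cent_norm_ge0 //.
      apply: le_trans (cent_norm_covariance tau_state X_bounded _) _.
      by rewrite ler_wpM2l ?sqr_ge0.
    apply: le_trans (cent_norm_covariance tau_state X_bounded _) _.
    by rewrite ler_wpM2l ?sqr_ge0.
  rewrite -mulr_sumr big_split /=.
  have KG : 2 * K <= G by move: K0; lra.
  have H := geometric_mix_le (size bs) K0 KG.
  have {}H' : \sum_(p < (size bs).+1) K ^+ (size bs - p) * G ^+ p <= 2 * G ^+ size bs.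
    rewrite (reindex_inj rev_ord_inj) /=; apply: le_trans H.
    rewrite le_eqVlt; apply/orP; left; apply/eqP; apply: eq_bigr => p _.
    by rewrite subSS subKn // -ltnS ltn_ord.
  have -> : 4 * K ^+ 2 * cm * G ^+ size bs * weight (b :: bs) * e =
    (K ^+ 2 * cm * weight (b :: bs) * e) * (2 * G ^+ size bs + 2 * G ^+ size bs) by ring.
  by rewrite ler_wpM2l ?lerD // !mulr_ge0 ?exprn_ge0 ?weight_ge0.
have -> : op_moment iota E (S n) (b :: bs) - op_moment iota E (S l) (b :: bs) =
  (op_moment iota E (S n) (b :: bs) - F n) - (op_moment iota E (S l) (b :: bs) - F l)
   + (F n - F l).
  by rewrite opprB [RHS]addrAC !addrA !subrK.
apply: le_trans (ler_cent_normD _ _) _.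
have := ler_cent_normD (op_moment iota E (S n) (b :: bs) - F n)
  (- (op_moment iota E (S l) (b :: bs) - F l)); rewrite cent_normN => h.
have := rec n n0; have := rec l l0 => hl hn.
have hZ : Z <= L * G ^+ size bs * weight (b :: bs).
  have -> : Z = L * (4 * K) ^+ size bs * weight (b :: bs) by rewrite exprMn /Z; ring.
  rewrite ler_wpM2r ?weight_ge0 // ler_wpM2l //.
  by rewrite lerXn2r ?nnegrE ?mulr_ge0.
(* One factor [G] is split into its three summands: the first bounds the recursion errors, the
   second bounds [F n - F l], and the third is non-negative slack. *)
have -> : G ^+ size (b :: bs) * weight (b :: bs) * e =
  L * G ^+ size bs * weight (b :: bs) * e + 4 * K ^+ 2 * cm * G ^+ size bs * weight (b :: bs) * e
  + 4 * K * (G ^+ size bs * weight (b :: bs) * e) by rewrite /= exprS /G; ring.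
have h1 : rsqrt n * Z + rsqrt l * Z <= L * G ^+ size bs * weight (b :: bs) * e.
  by rewrite -mulrDl mulrC ler_wpM2r.
have : 0 <= 4 * K * (G ^+ size bs * weight (b :: bs) * e).
  by rewrite !mulr_ge0 ?exprn_ge0 ?weight_ge0.
move=> p0; apply: ler_wpDr p0 _; apply: lerD Fd.
by apply: le_trans h _; apply: le_trans (lerD hn hl) h1.
Qed.

End MomentDiff.

(** * Limits along an ultrafilter *)

Lemma free_ultrafilter_exists :
  exists U : set_system nat, UltraFilter U /\ (\oo : set_system nat) `<=` U.
Proof. exact: ultraFilterLemma. Qed.

Definition free_ultrafilter : set_system nat := sval (cid free_ultrafilter_exists).

Local Notation UF := free_ultrafilter.

#[global] Instance free_ultrafilter_ultra : UltraFilter UF.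
Proof. by rewrite /UF; case: cid => U []. Qed.

Lemma free_ultrafilter_ge N : UF [set n | (N <= n)%N].
Proof.
have : (\oo : set_system nat) `<=` UF by rewrite /UF; case: cid => U [].
by apply; exists N.
Qed.

Lemma free_ultrafilter_meet (A B : set nat) : UF A -> UF B -> exists n, A n /\ B n.
Proof.
move=> hA hB; have /filter_ex [n [An Bn]] : UF (A `&` B) by exact: filterI.
by exists n.
Qed.

(** The limit is the supremum of the [x] that lie below [u n] for almost every [n]. The ultrafilter
    property turns the failure of the lower bound [sup S + e / 2] into an upper bound that holds
    almost everywhere. *)
Lemma ultralimit_real (R : realType) (u : nat -> R) (K : R) :
  (forall n, `|u n| <= K) ->
  exists l, forall e : R, 0 < e -> UF [set n | `|u n - l| < e].
Proof.
move=> uK; pose S := [set x | UF [set n | x <= u n]].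
have SK : S (- K).
  apply: filterS (free_ultrafilter_ge 0) => n _ /=.
  by have := uK n; rewrite ler_norml => /andP[].
have Sub : ubound S (K + 1).
  move=> x Sx; rewrite leNgt; apply/negP => xK.
  have [n /=] := filter_ex Sx; have := uK n; rewrite ler_norml => /andP[_]; lra.
have supS : has_sup S by split; [exists (- K) | exists (K + 1)].
exists (sup S) => e e0.
have [x Sx xe] : exists2 x, S x & sup S - e < x by apply: sup_adherent.
have nS : ~ S (sup S + e / 2).
  by move=> /(ub_le_sup (proj2 supS)); lra.
have [//|nU] := in_ultra_setVsetC [set n | sup S + e / 2 <= u n] _.
apply: filterS (filterI Sx nU) => n /= [h1 /negP]; rewrite -ltNge => h2.
by rewrite ltr_norml; apply/andP; split; lra.
Qed.

Section MatrixUltralimit.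
Variables (R : realType) (m : nat).
Local Notation M := 'M[R[i]]_m.+1.
Implicit Types (b c : nat -> M) (k l : M).

Definition mxlim b l := forall e : R, 0 < e -> UF [set n | cent_norm (b n - l) < e].

Lemma mxlim_exists b (K : R) : (forall n, cent_norm (b n) <= K) -> exists l, mxlim b l.
Proof.
move=> bK.
have hRe (p : 'I_m.+1 * 'I_m.+1) n : `|complex.Re (b n p.1 p.2)| <= K.
  by apply: le_trans (normc_Re _) (le_trans (cent_norm_ge _ _ _) (bK n)).
have hIm (p : 'I_m.+1 * 'I_m.+1) n : `|complex.Im (b n p.1 p.2)| <= K.
  by apply: le_trans (normc_Im _) (le_trans (cent_norm_ge _ _ _) (bK n)).
have [f hf] := choice (fun p => ultralimit_real (hRe p)).
have [g hg] := choice (fun p => ultralimit_real (hIm p)).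
exists (\matrix_(i, j) Complex (f (i, j)) (g (i, j))) => e e0.
pose d := e / (4 * (m.+1 * m.+1)%:R).
have d0 : 0 < d by rewrite divr_gt0 // mulr_gt0 ?ltr0n.
have : UF [set n | forall p : 'I_m.+1 * 'I_m.+1,
    `|complex.Re (b n p.1 p.2) - f p| < d /\ `|complex.Im (b n p.1 p.2) - g p| < d].
  by apply: filter_forall => p; apply: filterS (filterI (hf p d d0) (hg p d d0)).
apply: filterS => n /= H.
apply: (@le_lt_trans _ _ (\sum_(i < m.+1) \sum_(j < m.+1) (d + d))).
  apply: ler_sum => i _; apply: ler_sum => j _; rewrite !mxE.
  have [/= hx hy] := H (i, j); apply: le_trans (normc_le_ReIm _) _.
  by rewrite ReD ImD ReN ImN lerD // ltW.
rewrite !sumr_const !card_ord -mulrnA -mulr_natr /d.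
have : (m.+1 * m.+1)%:R != 0 :> R by rewrite pnatr_eq0.
set q := _%:R => q0; rewrite (_ : (_ + _) * q = e / 2) ?ltr_pdivrMr //; first by lra.
by field.
Qed.

Lemma mxlim_cst k : mxlim (fun=> k) k.
Proof.
by move=> e e0; apply: filterS (free_ultrafilter_ge 0) => n _ /=; rewrite subrr cent_norm0.
Qed.

Lemma mxlimD b c k l : mxlim b k -> mxlim c l -> mxlim (fun n => b n + c n) (k + l).
Proof.
move=> hb hc e e0; have e2 : 0 < e / 2 by lra.
apply: filterS (filterI (hb _ e2) (hc _ e2)) => n /= [h1 h2].
rewrite opprD addrACA; have := ler_cent_normD (b n - k) (c n - l); lra.
Qed.

Lemma mxlimM b c k l : mxlim b k -> mxlim c l -> mxlim (fun n => b n * c n) (k * l).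
Proof.
move=> hb hc e e0.
pose K := cent_norm k + cent_norm l + 1.
have K0 : 0 < K by rewrite ltr_wpDl ?addr_ge0 ?cent_norm_ge0.
have e2 : 0 < e / (2 * K) by rewrite divr_gt0 // mulr_gt0.
apply: filterS (filterI (filterI (hb _ e2) (hc _ e2)) (hc _ ltr01)) => n /= [[h1 h2] h3].
have -> : b n * c n - k * l = (b n - k) * c n + k * (c n - l).
  by rewrite mulrBl mulrBr addrA subrK.
apply: le_lt_trans (ler_cent_normD _ _) _.
have cK : cent_norm (c n) <= K.
  rewrite -(subrK l (c n)); apply: le_trans (ler_cent_normD _ _) _.
  by have := cent_norm_ge0 k; rewrite /K; lra.
have kK : cent_norm k <= K by have := cent_norm_ge0 l; rewrite /K; lra.
apply: (@le_lt_trans _ _ (cent_norm (b n - k) * K + K * cent_norm (c n - l))).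
  apply: lerD; apply: le_trans (ler_cent_normM _ _) _.
    by rewrite ler_wpM2l ?cent_norm_ge0.
  by rewrite ler_wpM2r ?cent_norm_ge0.
rewrite [K * _]mulrC -mulrDl -ltr_pdivlMr //.
have -> : e / K = e / (2 * K) + e / (2 * K) by field; rewrite gt_eqF.
by rewrite ltrD.
Qed.

Lemma mxlim_sum (I : Type) (r : seq I) (P : pred I) (b : I -> nat -> M) (l : I -> M) :
  (forall i, mxlim (b i) (l i)) ->
  mxlim (fun n => \sum_(i <- r | P i) b i n) (\sum_(i <- r | P i) l i).
Proof.
move=> h; elim: r => [|i r IH].
  rewrite big_nil (_ : (fun n => _) = fun=> 0); first exact: mxlim_cst.
  by apply/funext => n; rewrite big_nil.
rewrite big_cons (_ : (fun n => _) = fun n =>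
  if P i then b i n + \sum_(j <- r | P j) b j n else \sum_(j <- r | P j) b j n).
  by case: (P i) => //; apply: mxlimD.
by apply/funext => n; rewrite big_cons.
Qed.

Lemma mxlim_ext b c l : (forall n, b n = c n) -> mxlim b l -> mxlim c l.
Proof. by move=> /funext ->. Qed.

Lemma mxlim_conjT b l : mxlim b l ->
  mxlim (fun n => (map_mx conjc (b n))^T) (map_mx conjc l)^T.
Proof.
move=> h e e0; apply: filterS (h e e0) => n /=.
have -> : (map_mx conjc (b n))^T - (map_mx conjc l)^T = (map_mx conjc (b n - l))^T.
  by apply/matrixP => i j; rewrite !mxE rmorphB.
rewrite (_ : cent_norm _^T = cent_norm (b n - l)) // /cent_norm /entry_sum exchange_big.
by do 2! apply: eq_bigr => ? _; rewrite !mxE normc_conj.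
Qed.

(** Here freeness of the ultrafilter enters: each of its sets contains arbitrarily large [n], for
    which the term in [d] is negligible. The lemma transfers all estimates with rate [rsqrt n] to
    the limit. *)
Lemma mxlim_norm_le b l k (c d : R) : 0 <= d -> mxlim b l ->
  (forall n, (0 < n)%N -> cent_norm (k - b n) <= c + d * (Num.sqrt n%:R)^-1) ->
  cent_norm (k - l) <= c.
Proof.
move=> d0 bl h; apply/ler_addgt0Pl => e e0.
have e2 : 0 < e / 2 by lra.
have d1 : 0 < d + 1 by lra.
pose N := (Num.truncn (((d + 1) * 2 / e) ^+ 2)).+1.
have [n /= [h1 h2]] := free_ultrafilter_meet (bl _ e2) (free_ultrafilter_ge N).
have n0 : (0 < n)%N by apply: leq_trans h2.
have hn : d * (Num.sqrt n%:R)^-1 <= e / 2.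
  have s0 : 0 < Num.sqrt n%:R :> R by rewrite sqrtr_gt0 ltr0n.
  rewrite ler_pdivrMr //.
  have : (d + 1) * 2 / e <= Num.sqrt n%:R.
    rewrite -[leLHS]ger0_norm ?divr_ge0 ?mulr_ge0 ?(ltW d1) ?(ltW e0) // -sqrtr_sqr.
    rewrite ler_wsqrtr //; apply: le_trans (_ : N%:R <= _); last by rewrite ler_nat.
    by apply/ltW; rewrite /N; exact: truncnS_gt.
  rewrite ler_pdivrMr //; lra.
have := h n n0; have := ler_cent_normD (k - b n) (b n - l); rewrite addrA subrK; lra.
Qed.

Lemma mxlim_uniq b k l : mxlim b k -> mxlim b l -> k = l.
Proof.
move=> hk hl; apply/eqP; rewrite -subr_eq0; apply/eqP/cent_norm_eq0.
apply/eqP; rewrite eq_le cent_norm_ge0 andbT; apply/ler_addgt0Pl => e e0.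
have e2 : 0 < e / 2 by lra.
have [n /= [h1 h2]] := free_ultrafilter_meet (hk _ e2) (hl _ e2).
rewrite addr0; move: h1; rewrite cent_norm_distC => h1.
have := ler_cent_normD (k - b n) (b n - l); rewrite addrA subrK; lra.
Qed.

Lemma mxlim_entry_ge0 b l i j : mxlim b l -> (forall n, 0 <= b n i j) -> 0 <= l i j.
Proof.
move=> bl h.
have H e : 0 < e -> exists2 z : R[i], 0 <= z & normc (z - l i j) < e.
  move=> /bl /filter_ex [n /= hn]; exists (b n i j) => //.
  by apply: le_lt_trans hn; have := cent_norm_ge (b n - l) i j; rewrite !mxE.
rewrite lecE /=; apply/andP; split.
  apply/eqP/eqP; rewrite -normr_le0; apply/ler_addgt0Pl => e e0; rewrite addr0.
  have [z z0 hz] := H e e0.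
  have := normc_Im (z - l i j); move: z0; rewrite lecE => /andP[/eqP /= iz _].
  by case: z iz hz => x y /=; case: (l i j) => x' y' /= -> /=; rewrite sub0r normrN; lra.
apply/ler_addgt0Pl => e e0; have [z z0 hz] := H e e0.
have := normc_Re (z - l i j); move: z0; rewrite lecE => /andP[_ /= rz].
case: z rz hz => x y /=; case: (l i j) => x' y' /=.
by rewrite ler_norml => h0 h1 /andP[h2 h3]; lra.
Qed.

End MatrixUltralimit.

(** [P] is diagonalized by a unitary [Q], and the square roots of its eigenvalues are taken; these
    eigenvalues are the values of the quadratic form at the rows of [Q], hence non-negative. This is
    the form of positivity demanded of a conditional expectation into matrices. *)
Lemma psd_factor (R : realType) (n : nat) (P : 'M[R[i]]_n) :
  (map_mx conjc P)^T = P ->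
  (forall v : 'rV[R[i]]_n, 0 <= (v *m P *m (map_mx conjc v)^T) 0 0) ->
  exists y : 'M[R[i]]_n, P = (map_mx conjc y)^T *m y.
Proof.
move=> Pherm Ppos.
have Pnormal : P \is normalmx.
  apply/normalmxP; rewrite (_ : map_mx _ _ = P) //.
  by rewrite -{2}Pherm; apply/matrixP => i j; rewrite !mxE.
have := orthomx_spectralP Pnormal.
set Q := spectralmx P; set d := spectral_diag P => PE.
have Qu : Q \is unitarymx by exact: spectral_unitarymx.
have Qi : invmx Q = (map_mx conjc Q)^T.
  by rewrite invmx_unitary //; apply/matrixP => i j; rewrite !mxE.
have QQ : Q *m (map_mx conjc Q)^T = 1%:M by rewrite -Qi mulmxV // unitarymx_unit.
have d0 i : 0 <= d 0 i.
  have := Ppos (row i Q).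
  have -> : (row i Q *m P *m (map_mx conjc (row i Q))^T) 0 0
      = (Q *m P *m (map_mx conjc Q)^T) i i.
    by rewrite -row_mul !mxE; apply: eq_bigr => j _; rewrite !mxE.
  rewrite PE Qi !mulmxA QQ mul1mx -mulmxA QQ mulmx1.
  by rewrite mxE eqxx mulr1n.
exists (diag_mx (map_mx (@sqrtc R) d) *m Q).
rewrite map_mxM trmx_mul {1}PE Qi -!mulmxA; congr (_ *m _).
rewrite mulmxA; congr (_ *m _).
apply/matrixP => i j; rewrite !mxE (bigD1 i) //= big1 ?addr0 => [|k /negbTE ki].
  rewrite !mxE eqxx mulr1n; case: (i == j); last by rewrite !mulr0n mulr0.
  rewrite !mulr1n -[LHS]sqr_sqrtc expr2; congr (_ * _).
  have := d0 i; rewrite -sqrtc_ge0; case: (@sqrtc R _) => x y.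
  by rewrite lecE /= => /andP[/eqP -> _]; rewrite oppr0.
by rewrite !mxE ki mulr0n conjc0 mul0r.
Qed.

(** * The C*-algebra of bounded matrix sequences *)

Section BoundedSequences.
Variables (R : realType) (C : cstarAlgType R) (m : nat).
Local Notation A := 'M[C]_m.+1.
Local Notation iota := (@mx_embed R C m).
Local Notation star := (@mx_star R C m).

Record bseq := BSeq {
  bseq_val :> nat -> A;
  bseqP : exists K : R, forall n, ent_norm (bseq_val n) <= K }.

HB.instance Definition _ := gen_eqMixin bseq.
HB.instance Definition _ := gen_choiceMixin bseq.

Implicit Types a b c : bseq.

Lemma bseq_ext a b : (forall n, a n = b n) -> a = b.
Proof.
case: a b => [a aP] [b bP] /= /funext e; move: aP bP; rewrite e => aP bP.
by congr BSeq; exact: Prop_irrelevance.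
Qed.

Lemma bseq_cst_subproof (x : A) : exists K : R, forall n : nat, ent_norm x <= K.
Proof. by exists (ent_norm x). Qed.

Definition bseq_cst x := BSeq (bseq_cst_subproof x).

Lemma bseq_add_subproof a b : exists K : R, forall n, ent_norm (a n + b n) <= K.
Proof.
case: (bseqP a) (bseqP b) => [K aK] [L bL]; exists (K + L) => n.
by rewrite (le_trans (ler_ent_normD _ _)) // lerD.
Qed.

Definition bseq_add a b := BSeq (bseq_add_subproof a b).

Lemma bseq_opp_subproof a : exists K : R, forall n, ent_norm (- a n) <= K.
Proof. by case: (bseqP a) => [K aK]; exists K => n; rewrite ent_normN. Qed.

Definition bseq_opp a := BSeq (bseq_opp_subproof a).

Lemma bseq_mul_subproof a b : exists K : R, forall n, ent_norm (a n * b n) <= K.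
Proof.
case: (bseqP a) (bseqP b) => [K aK] [L bL]; exists (K * L) => n.
by rewrite (le_trans (ler_ent_normM _ _)) // ler_pM ?ent_norm_ge0.
Qed.

Definition bseq_mul a b := BSeq (bseq_mul_subproof a b).

Lemma bseq_star_subproof a : exists K : R, forall n, ent_norm (star (a n)) <= K.
Proof. by case: (bseqP a) => [K aK]; exists K => n; rewrite ent_norm_star. Qed.

Definition bseq_star a := BSeq (bseq_star_subproof a).

Fact bseq_addA : associative bseq_add.
Proof. by move=> a b c; apply: bseq_ext => n /=; rewrite addrA. Qed.
Fact bseq_addC : commutative bseq_add.
Proof. by move=> a b; apply: bseq_ext => n /=; rewrite addrC. Qed.
Fact bseq_add0 : left_id (bseq_cst 0) bseq_add.
Proof. by move=> a; apply: bseq_ext => n /=; rewrite add0r. Qed.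
Fact bseq_addN : left_inverse (bseq_cst 0) bseq_opp bseq_add.
Proof. by move=> a; apply: bseq_ext => n /=; rewrite addNr. Qed.

HB.instance Definition _ := GRing.isZmodule.Build bseq
  bseq_addA bseq_addC bseq_add0 bseq_addN.

Fact bseq_mulA : associative bseq_mul.
Proof. by move=> a b c; apply: bseq_ext => n /=; rewrite mulrA. Qed.
Fact bseq_mul1 : left_id (bseq_cst 1) bseq_mul.
Proof. by move=> a; apply: bseq_ext => n /=; rewrite mul1r. Qed.
Fact bseq_1mul : right_id (bseq_cst 1) bseq_mul.
Proof. by move=> a; apply: bseq_ext => n /=; rewrite mulr1. Qed.
Fact bseq_mulDl : left_distributive bseq_mul +%R.
Proof. by move=> a b c; apply: bseq_ext => n /=; rewrite mulrDl. Qed.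
Fact bseq_mulDr : right_distributive bseq_mul +%R.
Proof. by move=> a b c; apply: bseq_ext => n /=; rewrite mulrDr. Qed.
Fact bseq_1neq0 : bseq_cst 1 != 0.
Proof. by apply/eqP => /(congr1 (fun a => bseq_val a 0)) /= /eqP; rewrite oner_eq0. Qed.

HB.instance Definition _ := GRing.Zmodule_isNzRing.Build bseq
  bseq_mulA bseq_mul1 bseq_1mul bseq_mulDl bseq_mulDr bseq_1neq0.

Definition bseq_scale (k : R[i]) a := bseq_cst (cscal C m k) * a.

Fact bseq_scaleA k l a : bseq_scale k (bseq_scale l a) = bseq_scale (k * l) a.
Proof. by apply: bseq_ext => n /=; rewrite cscalM. Qed.
Fact bseq_scale1 : left_id 1 bseq_scale.
Proof. by move=> a; apply: bseq_ext => n /=; rewrite /cscal !rmorph1 mul1r. Qed.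
Fact bseq_scaleDr : right_distributive bseq_scale +%R.
Proof. by move=> k a b; rewrite /bseq_scale mulrDr. Qed.
Fact bseq_scaleDl a : {morph bseq_scale^~ a : k l / k + l}.
Proof.
by move=> k l; apply: bseq_ext => n /=; rewrite /cscal !raddfD /= mulrDl.
Qed.

HB.instance Definition _ := GRing.Zmodule_isLmodule.Build R[i] bseq
  bseq_scaleA bseq_scale1 bseq_scaleDr bseq_scaleDl.

Fact bseq_scaleAl (k : R[i]) a b : k *: (a * b) = (k *: a) * b.
Proof. exact: mulrA. Qed.

HB.instance Definition _ := GRing.Lmodule_isLalgebra.Build R[i] bseq bseq_scaleAl.

Fact bseq_scaleAr (k : R[i]) a b : k *: (a * b) = a * (k *: b).
Proof. by apply: bseq_ext => n /=; rewrite mulrA cscalC mulrA. Qed.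

HB.instance Definition _ := GRing.Lalgebra_isAlgebra.Build R[i] bseq bseq_scaleAr.

Lemma bseq_prod (I : Type) (r : seq I) (P : pred I) (F : I -> bseq) n :
  (\prod_(i <- r | P i) F i) n = \prod_(i <- r | P i) F i n.
Proof. exact: (big_morph (fun a : bseq => a n)). Qed.

Section OperatorNormOnSequences.
Variable tau : {scalar C}.
Hypotheses (tau_state : is_state tau) (tau_faithful : faithful_state tau).
Local Notation l2norm := (@l2norm R C m tau).

(* The norm is the supremum over n of the operator norm of left multiplication
   by [a n] on the Hilbert space L2(tr o tau). *)
Definition bseq_bound a : set R :=
  [set K | 0 <= K /\ forall n y, l2norm (a n * y) <= K * l2norm y].

Definition bseq_norm a : R := inf (bseq_bound a).

Lemma bseq_bound_ent a (K : R) : 0 <= K -> (forall n, ent_norm (a n) <= K) ->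
  bseq_bound a K.
Proof.
move=> K0 aK; split=> // n y; apply: le_trans (l2normM tau_state _ _) _.
by rewrite ler_wpM2r ?l2norm_ge0.
Qed.

Lemma bseq_bound_has_inf a : has_inf (bseq_bound a).
Proof.
split; last by exists 0 => K [].
have [K aK] := bseqP a; exists K; apply: bseq_bound_ent => //.
exact: le_trans (ent_norm_ge0 _) (aK 0%N).
Qed.

Lemma bseq_norm_le a K : bseq_bound a K -> bseq_norm a <= K.
Proof. by move=> h; apply: ge_inf => //; exact: (proj2 (bseq_bound_has_inf a)). Qed.

Lemma bseq_norm_ge0 a : 0 <= bseq_norm a.
Proof.
by apply: lb_le_inf; [exact: (proj1 (bseq_bound_has_inf a)) | move=> K []].
Qed.

Lemma bseq_bound_norm a : bseq_bound a (bseq_norm a).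
Proof.
split=> [|n y]; first exact: bseq_norm_ge0.
have [y0|yn] := eqVneq (l2norm y) 0.
  have [K [_ h]] := proj1 (bseq_bound_has_inf a).
  by have := h n y; rewrite y0 !mulr0.
have y0 : 0 < l2norm y by rewrite lt_neqAle eq_sym yn l2norm_ge0.
rewrite -ler_pdivrMr //; apply: lb_le_inf; first exact: (proj1 (bseq_bound_has_inf a)).
by move=> K [_ h]; rewrite ler_pdivrMr.
Qed.

Lemma ler_bseq_normD a b : bseq_norm (a + b) <= bseq_norm a + bseq_norm b.
Proof.
have [a0 ha] := bseq_bound_norm a; have [b0 hb] := bseq_bound_norm b.
apply: bseq_norm_le; split=> [|n y]; first exact: addr_ge0.
by rewrite mulrDl (le_trans (ler_l2normD tau_state _ _)) // mulrDl lerD.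
Qed.

Lemma bseq_normZ_le (k : R[i]) a : bseq_norm (k *: a) <= normc k * bseq_norm a.
Proof.
have [a0 ha] := bseq_bound_norm a.
apply: bseq_norm_le; split=> [|n y]; first by rewrite mulr_ge0 ?normc_ge0.
by rewrite -mulrA l2norm_cscal // -mulrA ler_wpM2l ?normc_ge0.
Qed.

Lemma bseq_normZ (k : R[i]) a : bseq_norm (k *: a) = normc k * bseq_norm a.
Proof.
apply/eqP; rewrite eq_le bseq_normZ_le /=.
have [->|k0] := eqVneq k 0.
  by rewrite ComplexField.Normc.normc0 mul0r bseq_norm_ge0.
have nk0 : 0 < normc k.
  rewrite lt_neqAle normc_ge0 andbT eq_sym; apply: contraNneq k0.
  by move=> /ComplexField.Normc.eq0_normc ->.
have := bseq_normZ_le k^-1 (k *: a); rewrite scalerA mulVf // scale1r.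
by rewrite ComplexField.Normc.normcV ler_pdivlMl.
Qed.

Lemma bseq_norm_eq0 a : bseq_norm a = 0 -> a = 0.
Proof.
have [_ ha] := bseq_bound_norm a => a0; apply: bseq_ext => n /=.
apply: (l2norm_eq0 tau_state tau_faithful); apply/eqP.
by rewrite eq_le l2norm_ge0 andbT; have := ha n 1; rewrite a0 mul0r mulr1.
Qed.

Lemma ler_bseq_normM a b : bseq_norm (a * b) <= bseq_norm a * bseq_norm b.
Proof.
have [a0 ha] := bseq_bound_norm a; have [b0 hb] := bseq_bound_norm b.
apply: bseq_norm_le; split=> [|n y]; first exact: mulr_ge0.
rewrite -mulrA; apply: le_trans (ha _ _) _.
by rewrite -mulrA ler_wpM2l.
Qed.

Lemma bseq_norm_star_le a : bseq_norm (bseq_star a) <= bseq_norm a.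
Proof.
have [a0 ha] := bseq_bound_norm a; apply: bseq_norm_le; split=> // n y.
exact: l2norm_adjoint_le (ha n) y.
Qed.

(** The squared L2 norm of [a n * y] is the inner product of [star (a n) * a n * y] with [y], so the
    square root of a bound for [bseq_star a * a] bounds [a]. *)
Lemma bseq_norm_starM a : bseq_norm (bseq_star a * a) = bseq_norm a ^+ 2.
Proof.
apply/eqP; rewrite eq_le; apply/andP; split.
  apply: le_trans (ler_bseq_normM _ _) _; rewrite expr2 ler_wpM2r ?bseq_norm_ge0 //.
  exact: bseq_norm_star_le.
have [s0 hs] := bseq_bound_norm (bseq_star a * a).
rewrite -[leRHS]sqr_sqrtr // lerXn2r ?nnegrE ?bseq_norm_ge0 ?sqrtr_ge0 //.
apply: bseq_norm_le; split=> [|n y]; first exact: sqrtr_ge0.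
apply: (l2norm_le tau_state); first by rewrite mulr_ge0 ?sqrtr_ge0 ?l2norm_ge0.
rewrite exprMn sqr_sqrtr // ipMr mulrA; apply: le_trans (ler_norm _) _.
apply: le_trans (ip_le tau_state _ _) _; rewrite expr2 mulrA ler_wpM2r ?l2norm_ge0 //.
exact: hs.
Qed.

Lemma cnorm_bseq_le a n i j : cnorm (a n i j) <= bseq_norm a.
Proof.
have [a0 ha] := bseq_bound_norm a.
exact: (cnorm_entry_le_op tau_state tau_faithful _ _ a0 (ha n)).
Qed.

Lemma ent_norm_le_entries (x : A) (e : R) : (forall i j, cnorm (x i j) <= e) ->
  ent_norm x <= (m.+1 ^ 2)%:R * e.
Proof.
move=> h; rewrite natrX expr2 -mulrA mulr_natl.
rewrite -[X in _ *+ X]card_ord -sumr_const; apply: ler_sum => i _.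
by rewrite mulr_natl -[X in _ *+ X]card_ord -sumr_const; apply: ler_sum => j _.
Qed.

(** Completeness is inherited from [C]. By [cnorm_bseq_le] the entries are Cauchy uniformly in [n],
    and conversely the entrywise norm controls the operator norm by [bseq_bound_ent]. *)
Lemma bseq_complete (u : nat -> bseq) :
  (forall e : R, 0 < e -> exists N : nat, forall p q : nat,
     (N <= p)%N -> (N <= q)%N -> bseq_norm (u p - u q) < e) ->
  exists l : bseq, (fun n => bseq_norm (u n - l)) @ \oo --> (0 : R).
Proof.
move=> uc.
have entc (t : nat * ('I_m.+1 * 'I_m.+1)) :
    exists l : C, ccvg (fun p => u p t.1 t.2.1 t.2.2) l.
  apply: ccvg_complete => e e0; have [N hN] := uc e e0; exists N => p q Np Nq.
  apply: le_lt_trans (hN p q Np Nq); have := cnorm_bseq_le (u p - u q) t.1 t.2.1 t.2.2.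
  by rewrite /= !mxE.
have [f hf] := choice entc.
pose l n : A := \matrix_(i, j) f (n, (i, j)).
have ul e : 0 < e -> exists N, forall p n, (N <= p)%N ->
    ent_norm (u p n - l n) <= (m.+1 ^ 2)%:R * e.
  move=> e0; have [N hN] := uc e e0; exists N => p n Np.
  apply: ent_norm_le_entries => i j; rewrite !mxE -cnormN opprB.
  (* Letting the second index tend to infinity at fixed [p] keeps the bound uniform in [n]. *)
  apply: (@ccvg_norm_le _ _ (fun q => u (q + N)%N n i j - u p n i j)) => [q|].
    have := cnorm_bseq_le (u (q + N)%N - u p) n i j; rewrite /= !mxE => /le_trans; apply.
    by apply/ltW/hN => //; rewrite leq_addl.
  move=> d d0; have [N' hN'] := hf (n, (i, j)) d d0; exists N' => q Nq.
  by rewrite opprB addrA subrK; apply: hN'; rewrite (leq_trans Nq) // leq_addr.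
have lb : exists K : R, forall n, ent_norm (l n) <= K.
  have [N hN] := ul 1 ltr01; have [K uK] := bseqP (u N).
  exists (K + (m.+1 ^ 2)%:R * 1) => n; rewrite -[l n](subKr (u N n)).
  by apply: le_trans (ler_ent_normB _ _) _; rewrite lerD ?hN.
exists (BSeq lb); apply/cvgrPdist_lt => e e0.
pose d := e / (2 * (m.+1 ^ 2)%:R).
have q0 : 0 < (m.+1 ^ 2)%:R :> R by rewrite ltr0n expn_gt0.
have d0 : 0 < d by rewrite divr_gt0 // mulr_gt0.
have [N hN] := ul d d0; exists N => // p /= Np; rewrite sub0r normrN.
rewrite ger0_norm ?bseq_norm_ge0 //.
apply: (@le_lt_trans _ _ ((m.+1 ^ 2)%:R * d)).
  apply/bseq_norm_le/bseq_bound_ent => [|n]; first by rewrite mulr_ge0 ?ltW.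
  exact: hN.
have -> : (m.+1 ^ 2)%:R * d = e / 2 by rewrite /d; field; rewrite gt_eqF.
lra.
Qed.

(* An alias of [bseq] carrying the proofs on which the C*-structure depends. *)
Definition cbseq of is_state tau & faithful_state tau := bseq.

End OperatorNormOnSequences.
End BoundedSequences.

Section SequenceAlgebra.
Variables (R : realType) (C : cstarAlgType R) (m : nat) (tau : {scalar C}).
Hypotheses (tau_state : is_state tau) (tau_faithful : faithful_state tau).
Local Notation M := 'M[R[i]]_m.+1.
Local Notation A := 'M[C]_m.+1.
Local Notation iota := (@mx_embed R C m).
Local Notation star := (@mx_star R C m).
Local Notation E := (@mx_expect R C m tau).
Local Notation A' := (@cbseq R C m tau tau_state tau_faithful).

HB.instance Definition _ := GRing.Algebra.on A'.

Fact cbseq_starD (a b : A') : bseq_star (a + b) = bseq_star a + bseq_star b :> A'.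
Proof. by apply: bseq_ext => n /=; rewrite mx_starD. Qed.
Fact cbseq_starZ (k : R[i]) (a : A') : bseq_star (k *: a) = conjc k *: (bseq_star a : A').
Proof. by apply: bseq_ext => n /=; rewrite mx_starM star_cscal cscalC. Qed.
Fact cbseq_starM (a b : A') : bseq_star (a * b) = bseq_star b * bseq_star a :> A'.
Proof. by apply: bseq_ext => n /=; rewrite mx_starM. Qed.
Fact cbseq_starK (a : A') : bseq_star (bseq_star a) = a :> A'.
Proof. by apply: bseq_ext => n /=; rewrite mx_starK. Qed.

HB.instance Definition _ := isCStarAlg.Build R A' cbseq_starD cbseq_starZ
  cbseq_starM cbseq_starK (@ler_bseq_normD R C m tau tau_state)
  (@bseq_normZ R C m tau tau_state) (@bseq_norm_eq0 R C m tau tau_state tau_faithful)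
  (@ler_bseq_normM R C m tau tau_state) (@bseq_norm_starM R C m tau tau_state)
  (@bseq_complete R C m tau tau_state tau_faithful).


End SequenceAlgebra.

(** The partial sums of the Neumann series are the iterates of [x -> 1 + a * x] from 0. The limit is
    a fixed point, which gives a right inverse; it commutes with [a], which makes the inverse
    two-sided. *)
Lemma neumann_inverse (R : realType) (A : cstarAlgType R) (a : A) :
  cnorm a <= 2^-1 -> exists x, (1 - a) * x = 1 /\ x * (1 - a) = 1.
Proof.
move=> a2; pose u n := iter n (fun x => 1 + a * x) (0 : A).
have u2 n : cnorm (u n) <= 2.
  elim: n => [|n IH]; first by rewrite cnorm0.
  apply: le_trans (ler_cnormD _ _) _; rewrite cnorm1.
  by have := ler_cnormM a (u n); have := cnorm_ge0 a; have := cnorm_ge0 (u n); nra.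
have uB p k : cnorm (u (p + k)%N - u p) <= 2^-1 ^+ p * 2.
  elim: p => [|p IH]; first by rewrite add0n expr0 mul1r subr0.
  have -> : u (p.+1 + k)%N - u p.+1 = a * (u (p + k)%N - u p).
    by rewrite addSn /u /= opprD addrACA subrr add0r mulrBr.
  apply: le_trans (ler_cnormM _ _) _; rewrite exprS -mulrA.
  by apply: ler_pM => //; exact: cnorm_ge0.
have [l hl] : exists l, ccvg u l.
  apply: ccvg_complete => e e0.
  have : geometric (2 : R) 2^-1 @ \oo --> 0.
    by apply: cvg_geometric; rewrite ger0_norm ?invr_ge0 //; lra.
  move/cvgrPdist_lt => /(_ e e0) [N _ hN]; exists N.
  have H p q : (N <= p)%N -> (p <= q)%N -> cnorm (u q - u p) < e.
    move=> Np pq; rewrite -(subnKC pq); apply: le_lt_trans (uB p _) _.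
    have := hN p Np; rewrite /= sub0r normrN mulrC => /(le_lt_trans _); apply.
    exact: ler_norm.
  by move=> p q Np Nq; case/orP: (leq_total p q) => pq; [rewrite cnormBC|]; exact: H.
have El : l = 1 + a * l.
  apply: (@ccvg_uniq _ _ (fun n => u n.+1)); first exact: ccvgS.
  apply: (@ccvg_lip _ _ (fun x => 1 + a * x) (cnorm a)) => // [|x y]; first exact: cnorm_ge0.
  by rewrite opprD addrACA subrr add0r -mulrBr ler_cnormM.
have la : l * a = a * l.
  apply: (@ccvg_uniq _ _ (fun n => u n * a)).
    apply: (@ccvg_lip _ _ (fun x => x * a) (cnorm a)) => // [|x y]; first exact: cnorm_ge0.
    by rewrite -mulrBl mulrC ler_cnormM.
  have -> : (fun n => u n * a) = (fun x => a * x) \o u.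
    apply/funext => n /=; elim: n => [|n IH]; first by rewrite mul0r mulr0.
    by rewrite /u /= mulrDl mulrDr mul1r mulr1 -mulrA IH.
  apply: (@ccvg_lip _ _ (fun x => a * x) (cnorm a)) => // [|x y]; first exact: cnorm_ge0.
  by rewrite -mulrBr ler_cnormM.
exists l; rewrite mulrBl mulrBr mulr1 mul1r la.
by rewrite {1 3}El addrK.
Qed.

(** * The conditional expectation on bounded sequences *)

Section SequenceExpectation.
Variables (R : realType) (C : cstarAlgType R) (m : nat) (tau : {scalar C}).
Hypotheses (tau_state : is_state tau) (tau_faithful : faithful_state tau).
Local Notation M := 'M[R[i]]_m.+1.
Local Notation A := 'M[C]_m.+1.
Local Notation iota := (@mx_embed R C m).
Local Notation star := (@mx_star R C m).
Local Notation E := (@mx_expect R C m tau).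
Local Notation A' := (@cbseq R C m tau tau_state tau_faithful).
Implicit Types (a : A') (b c : M).

Definition bseq_embed b : A' := bseq_cst (iota b).

Fact bseq_embed_is_zmod : zmod_morphism bseq_embed.
Proof. by move=> b c; apply: bseq_ext => n /=; rewrite raddfB. Qed.
Fact bseq_embed_is_monoid : monoid_morphism bseq_embed.
Proof. by split=> [|b c]; apply: bseq_ext => n /=; rewrite ?rmorph1 ?rmorphM. Qed.
Fact bseq_embed_is_scalable : scalable bseq_embed.
Proof.
move=> k b; apply: bseq_ext => n /=; rewrite /cscal -rmorphM /=.
by congr iota; rewrite -mul_scalar_mx.
Qed.

HB.instance Definition _ := GRing.isZmodMorphism.Build M A' bseq_embed bseq_embed_is_zmod.
HB.instance Definition _ := GRing.isMonoidMorphism.Build M A' bseq_embed bseq_embed_is_monoid.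
HB.instance Definition _ := GRing.isScalable.Build R[i] M A' _ bseq_embed bseq_embed_is_scalable.

Lemma bseq_expect_exists a : exists l, mxlim (fun n => E ((a : bseq C m) n)) l.
Proof.
have [K aK] := bseqP a; apply: (@mxlim_exists _ _ _ K) => n.
exact: le_trans (cent_norm_expect tau_state _) (aK n).
Qed.

Definition bseq_expect a : M := sval (cid (bseq_expect_exists a)).

Lemma bseq_expectP a : mxlim (fun n => E ((a : bseq C m) n)) (bseq_expect a).
Proof. by rewrite /bseq_expect; case: cid. Qed.

Lemma bseq_expect_uniq a l : mxlim (fun n => E ((a : bseq C m) n)) l -> bseq_expect a = l.
Proof. exact: mxlim_uniq (bseq_expectP a). Qed.

Lemma bseq_expect_bimod b a c :
  bseq_expect (bseq_embed b * a * bseq_embed c) = b * bseq_expect a * c.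
Proof.
apply: bseq_expect_uniq.
apply: mxlim_ext (mxlimM (mxlimM (mxlim_cst b) (bseq_expectP a)) (mxlim_cst c)) => n.
by rewrite /= mx_expect_bimod.
Qed.

Fact bseq_expect_is_linear : linear bseq_expect.
Proof.
move=> k a a'; apply: bseq_expect_uniq.
have := mxlimD (mxlimM (mxlim_cst k%:M) (bseq_expectP a)) (bseq_expectP a').
rewrite [k%:M * _]mul_scalar_mx; apply: mxlim_ext => n.
by rewrite raddfD /= mx_expect_mull.
Qed.

HB.instance Definition _ := GRing.isLinear.Build R[i] A' M _ bseq_expect bseq_expect_is_linear.

Fact bseq_embed_inj : injective bseq_embed.
Proof. by move=> b c /(congr1 (fun a : bseq C m => a 0%N)) /= /mx_embed_inj. Qed.

Fact bseq_embed_adj b : bseq_embed (map_mx conjc b)^T = adj (bseq_embed b).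
Proof. by apply: bseq_ext => n /=; rewrite mx_star_embed. Qed.

Fact bseq_expect_embed b : bseq_expect (bseq_embed b) = b.
Proof.
apply: bseq_expect_uniq; apply: mxlim_ext (mxlim_cst b) => n /=.
by rewrite mx_expect_embed.
Qed.

Lemma bseq_expect_adj a : bseq_expect (adj a) = (map_mx conjc (bseq_expect a))^T.
Proof.
apply: bseq_expect_uniq; apply: mxlim_ext (mxlim_conjT (bseq_expectP a)) => n /=.
by rewrite mx_expect_star.
Qed.

Lemma bseq_expect_diag_ge0 a i : 0 <= bseq_expect (adj a * a) i i.
Proof.
apply: mxlim_entry_ge0 (bseq_expectP _) _ => n /=; rewrite !mxE linear_sum /=.
by apply: sumr_ge0 => k _; rewrite !mxE; exact: (proj2 tau_state).
Qed.

Fact bseq_expect_pos a : exists y : M, bseq_expect (adj a * a) = (map_mx conjc y)^T * y.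
Proof.
apply: psd_factor => [|v]; first by rewrite -bseq_expect_adj adjM adjK.
(* The first column of [V] is the adjoint of [v]. The value of the quadratic form at [v] is then the
   corner entry of the expectation of [adj z * z] with [z = a * bseq_embed V], and diagonal entries
   are limits of non-negative numbers. *)
pose V : M := \matrix_(i, j) (if j == 0 then conjc (v 0 i) else 0).
have := bseq_expect_diag_ge0 (a * bseq_embed V) 0.
rewrite adjM -bseq_embed_adj mulrA -[_ * _ * a]mulrA bseq_expect_bimod.
congr (0 <= _); rewrite [LHS]mxE [RHS]mxE; apply: eq_bigr => j _; congr (_ * _).
  by rewrite [LHS]mxE [RHS]mxE; apply: eq_bigr => i _; rewrite !mxE /= conjcK.
by rewrite !mxE.
Qed.

HB.instance Definition _ := isOpCStarProbSpace.Build R m A' bseq_embed_inj bseq_embed_adj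
  bseq_expect_embed bseq_expect_bimod bseq_expect_pos.


End SequenceExpectation.

(** * The limit theorem *)

Lemma rsqrt_small (R : realType) (d e : R) : 0 <= d -> 0 < e ->
  exists N, forall n, (N < n)%N -> d * (Num.sqrt n%:R)^-1 <= e.
Proof.
move=> d0 e0; have d1 : 0 < d + 1 by lra.
exists (Num.truncn (((d + 1) / e) ^+ 2)) => n Nn.
have s0 : 0 < Num.sqrt n%:R :> R by rewrite sqrtr_gt0 ltr0n (leq_ltn_trans _ Nn).
rewrite ler_pdivrMr //.
have : (d + 1) / e <= Num.sqrt n%:R.
  rewrite -[leLHS]ger0_norm ?divr_ge0 ?(ltW d1) ?(ltW e0) // -sqrtr_sqr.
  rewrite ler_wsqrtr //; apply: le_trans (ltW (truncnS_gt _)) _.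
  by rewrite ler_nat.
rewrite ler_pdivrMr //; lra.
Qed.

Lemma rmono_nseq (R : realType) (C : cstarAlgType R) m (a : 'M[C]_m.+1) c p :
  rmono a (nseq p c) = (mx_embed C c * a) ^+ p.
Proof.
by elim: p => [|p IH]; rewrite ?rmono_nil //= rmono_cons IH exprS.
Qed.

(** * The operator norm of complex matrices *)

Section OperatorNormBounds.
Variables (R : realType) (m : nat).
Implicit Types b : 'M[R[i]]_m.+1.

Lemma normc_le_euclidean (v : 'cV[R[i]]_m.+1) i : normc (v i 0) <= euclidean_norm v.
Proof.
rewrite -[leLHS]ger0_norm ?normc_ge0 // -sqrtr_sqr /euclidean_norm ler_wsqrtr //.
by rewrite (bigD1 i) //= lerDl; apply: sumr_ge0 => j _; exact: sqr_ge0.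
Qed.

Lemma euclidean_norm_le (v : 'cV[R[i]]_m.+1) :
  euclidean_norm v <= \sum_i normc (v i 0).
Proof.
have S0 : 0 <= \sum_i normc (v i 0) by apply: sumr_ge0 => i _; exact: normc_ge0.
rewrite -[leRHS]ger0_norm // -sqrtr_sqr /euclidean_norm ler_wsqrtr //.
rewrite expr2 mulr_suml; apply: ler_sum => i _; rewrite expr2 ler_wpM2l ?normc_ge0 //.
by rewrite (bigD1 i) //= lerDl; apply: sumr_ge0 => j _; exact: normc_ge0.
Qed.

Lemma euclidean_norm_mul_le b v : euclidean_norm v <= 1 ->
  euclidean_norm (b *m v) <= cent_norm b.
Proof.
move=> v1; apply: le_trans (euclidean_norm_le _) _; apply: ler_sum => i _.
rewrite mxE; apply: (@le_trans _ _ (\sum_j normc (b i j * v j 0))).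
  elim/big_ind2 : _ => [|x rx y ry hx hy|//]; first by rewrite ComplexField.Normc.normc0.
  by rewrite (le_trans (ler_normcD _ _)) // lerD.
apply: ler_sum => j _; rewrite ComplexField.Normc.normcM ler_piMr ?normc_ge0 //.
exact: le_trans (normc_le_euclidean _ _) v1.
Qed.

Lemma euclidean_norm0 : euclidean_norm (0 : 'cV[R[i]]_m.+1) = 0.
Proof.
rewrite /euclidean_norm big1 ?sqrtr0 // => i _.
by rewrite mxE ComplexField.Normc.normc0 expr0n.
Qed.

Lemma opnorm_has_sup b : has_sup [set euclidean_norm (b *m v) | v in
  [set v | euclidean_norm v <= 1]].
Proof.
split; first by exists (euclidean_norm (b *m 0)), 0 => //=; rewrite euclidean_norm0.
by exists (cent_norm b) => _ [v /= v1 <-]; exact: euclidean_norm_mul_le.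
Qed.

Lemma opnorm_le_cent b : opnorm b <= cent_norm b.
Proof.
apply: ge_sup; first exact: (proj1 (opnorm_has_sup b)).
by move=> _ [v /= v1 <-]; exact: euclidean_norm_mul_le.
Qed.

Lemma opnorm_ge0 b : 0 <= opnorm b.
Proof.
apply: ub_le_sup; first exact: (proj2 (opnorm_has_sup b)).
by exists 0 => /=; rewrite ?mulmx0 euclidean_norm0.
Qed.

Lemma cent_norm_le_opnorm b : cent_norm b <= (m.+1 ^ 2)%:R * opnorm b.
Proof.
have h i j : normc (b i j) <= opnorm b.
  have -> : b i j = (b *m delta_mx j 0 : 'cV_m.+1) i 0.
    rewrite mxE (bigD1 j) //= big1 ?addr0 => [|k /negbTE kj].
      by rewrite mxE !eqxx mulr1.
    by rewrite mxE kj mulr0.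
  apply: le_trans (normc_le_euclidean _ _) _.
  apply: ub_le_sup; first exact: (proj2 (opnorm_has_sup b)).
  exists (delta_mx j 0) => //=; rewrite /euclidean_norm (bigD1 j) //= big1 => [|k /negbTE kj].
    by rewrite mxE !eqxx ComplexField.Normc.normc1 expr1n addr0 sqrtr1.
  by rewrite mxE kj ComplexField.Normc.normc0 expr0n.
rewrite natrX expr2 -mulrA mulr_natl.
rewrite -[X in _ *+ X]card_ord -sumr_const; apply: ler_sum => i _.
by rewrite mulr_natl -[X in _ *+ X]card_ord -sumr_const; apply: ler_sum => j _.
Qed.

End OperatorNormBounds.

Lemma cauchy_transformE (R : realType) (m : nat) (A : nzRingType)
    (iota : 'M[R[i]]_m.+1 -> A) (E : A -> 'M[R[i]]_m.+1) a b x :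
  is_inverse (iota b - a) x -> cauchy_transform iota E a b = E x.
Proof.
move=> [ax xa]; rewrite /cauchy_transform; congr E.
by apply: xget_unique => // y [ay ya]; rewrite -[y]mul1r -xa -mulrA ay mulr1.
Qed.

(** * The limit element and its resolvent *)

Section CentralLimit.
Variables (R : realType) (C : cstarAlgType R) (m : nat) (tau : {scalar C}).
Hypotheses (tau_state : is_state tau) (tau_faithful : faithful_state tau).
Local Notation M := 'M[R[i]]_m.+1.
Local Notation A := 'M[C]_m.+1.
Local Notation iota := (@mx_embed R C m).
Local Notation star := (@mx_star R C m).
Local Notation E := (@mx_expect R C m tau).
Local Notation A' := (@cbseq R C m tau tau_state tau_faithful).
Local Notation emb := (@bseq_embed R C m tau tau_state tau_faithful).
Local Notation E' := (@bseq_expect R C m tau tau_state tau_faithful).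
Variable X : nat -> A.
Hypothesis X_free : star_free star iota E X.
Hypothesis X_centered : forall i, E (X i) = 0.
Hypothesis X_dist : same_star_distribution star iota E X.
Variable B : R.
Hypothesis X_bounded : forall i, ent_norm (X i) <= B.
Implicit Types (b c : M) (bs cs : seq M).

Local Notation S := (normalized_sum X).
Local Notation rsqrt n := ((Num.sqrt n%:R)^-1 : R).
Local Notation eta := (op_covariance iota E (X 0%N)).
Local Notation K := (mom_const m B).
Local Notation G := (growth C m B).

Let S_bounded : exists L : R, forall n, ent_norm (S n) <= L.
Proof. by exists K; exact: (ent_norm_S tau_state tau_faithful X_free X_centered X_bounded). Qed.

Definition limit_sum : A' := BSeq S_bounded.
Local Notation s := limit_sum.

Lemma mxlim_moment bs :
  mxlim (fun n => op_moment iota E (S n) bs) (op_moment emb E' s bs).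
Proof.
apply: mxlim_ext (bseq_expectP _) => n /=.
by rewrite /op_moment bseq_prod.
Qed.

Lemma mxlim_lmono b cs :
  mxlim (fun n => E (lmono (S n) b cs)) (E' (emb b * \prod_(c <- cs) (s * emb c))).
Proof.
apply: mxlim_ext (bseq_expectP _) => n /=.
by rewrite /lmono bseq_prod.
Qed.

Lemma mxlim_rmono cs :
  mxlim (fun n => E (rmono (S n) cs)) (E' (\prod_(c <- cs) (emb c * s))).
Proof.
apply: mxlim_ext (bseq_expectP _) => n /=.
by rewrite /rmono bseq_prod.
Qed.

Lemma mxlim_eta (b : nat -> M) l : mxlim b l -> mxlim (fun n => eta (b n)) (eta l).
Proof.
move=> bl e e0.
have K2 : 0 < K ^+ 2 by rewrite exprn_gt0 // (lt_le_trans ltr01) // (mom_const_ge1 X_bounded).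
apply: filterS (bl (e / K ^+ 2) (divr_gt0 e0 K2)) => n /=.
rewrite ltr_pdivlMr // => h; rewrite -covarianceB.
apply: le_lt_trans (cent_norm_covariance tau_state X_bounded _) _.
by rewrite mulrC.
Qed.

(** The error of [approx_recursion] disappears along the ultrafilter. The recursion is first
    obtained with [eta]; its case [bs = [::]] then identifies [eta] with the covariance of [s]. *)
Lemma moment_recursion_eta b bs : op_moment emb E' s (b :: bs) =
  \sum_(p < (size bs).+1) eta (E' (emb b * \prod_(c <- take p bs) (s * emb c))) *
    E' (\prod_(c <- drop p bs) (emb c * s)).
Proof.
(* The goal is brought to the shape of [mxlim_norm_le] with [k = 0] and [c = 0]. *)
apply/eqP; rewrite -subr_eq0 -oppr_eq0 -sub0r; apply/eqP/cent_norm_eq0.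
apply/eqP; rewrite eq_le cent_norm_ge0 andbT.
pose Z := ((size bs)%:R + 1) * (size bs)%:R * recursion_const C m B
  * K ^+ size bs * (cent_norm b * weight bs).
have K0 : 0 <= K := le_trans ler01 (mom_const_ge1 X_bounded).
have Z0 : 0 <= Z.
  have L0 : 0 <= recursion_const C m B by rewrite !mulr_ge0 ?exprn_ge0 ?ent_norm_ge0.
  apply: mulr_ge0; last by rewrite mulr_ge0 ?cent_norm_ge0 ?weight_ge0.
  apply: mulr_ge0; last exact: exprn_ge0.
  by apply: mulr_ge0 => //; apply: mulr_ge0 => //; exact: addr_ge0.
pose F n := \sum_(p < (size bs).+1) recursion_term tau X n b bs p.
set F' := \sum_(p < _) _.
have hF : mxlim F F'.
  apply: mxlim_sum => p.
  exact: (mxlimM (mxlim_eta (mxlim_lmono b (take p bs))) (mxlim_rmono (drop p bs))).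
have := mxlimD (mxlim_moment (b :: bs)) (mxlimM (mxlim_cst (-1)) hF).
rewrite mulN1r => hlim; apply: (mxlim_norm_le Z0 hlim) => n n0.
rewrite sub0r cent_normN add0r mulN1r mulrC.
exact: (approx_recursion tau_state tau_faithful X_free X_centered X_dist X_bounded).
Qed.

Lemma covariance_limit b : op_covariance emb E' s b = eta b.
Proof.
have := moment_recursion_eta b [::].
rewrite big_ord1 /= !big_nil !mulr1 bseq_expect_embed /op_moment big_seq1.
rewrite /op_covariance mulrA => ->.
have -> : E' 1 = 1 by rewrite -(bseq_expect_embed tau_state tau_faithful 1) rmorph1.
by rewrite mulr1.
Qed.

Lemma semicircular_limit : semicircular emb E' s.
Proof.
split; first by apply: bseq_expect_uniq; apply: mxlim_ext (mxlim_cst 0) => n;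
  rewrite (expect_S X_centered).
move=> b bs; rewrite moment_recursion_eta; apply: eq_bigr => p _.
by rewrite covariance_limit.
Qed.

Lemma moment_limit_diff n bs : (0 < n)%N ->
  cent_norm (op_moment iota E (S n) bs - op_moment emb E' s bs)
    <= G ^+ size bs * weight bs * rsqrt n.
Proof.
move=> n0; have [G1 _] := growth_ge X_bounded.
apply: (mxlim_norm_le (d := G ^+ size bs * weight bs) _ (mxlim_moment bs)) => [|l l0].
  by rewrite mulr_ge0 ?weight_ge0 ?exprn_ge0 //; lra.
rewrite -mulrDr.
exact: (moment_diff tau_state tau_faithful X_free X_centered X_dist X_bounded).
Qed.

Lemma converges_limit : converges_in_distribution iota E S (s : A').
Proof.
move=> bs; apply/cvgrPdist_lt => e e0.
have [G1 _] := growth_ge X_bounded.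
have d0 : 0 <= G ^+ size bs * weight bs.
  by rewrite mulr_ge0 ?weight_ge0 ?exprn_ge0 //; lra.
have e2 : 0 < e / 2 by lra.
have [N hN] := rsqrt_small d0 e2; exists N.+1 => // n /= Nn.
rewrite sub0r normrN ger0_norm ?opnorm_ge0 //.
apply: le_lt_trans (opnorm_le_cent _) _.
have n0 : (0 < n)%N by apply: leq_ltn_trans Nn.
apply: le_lt_trans (moment_limit_diff bs n0) _.
by have := hN n Nn; lra.
Qed.

(** The factor [m.+1 ^ 2] converts the operator norm of [b^-1] into the entrywise one, which then
    satisfies [cent_norm b^-1 * (2 * G) <= 1]. This makes [b^-1 * S n] at most one half in norm, and
    it turns the moment bounds of rate [G] into bounds of rate one half. *)
Definition radius : R := ((m.+1 ^ 2)%:R * (2 * G))^-1.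

(** The inverse [y] is constructed once, in the algebra of sequences; its component at [n] inverts
    [iota b - S n]. Both Cauchy transforms are thus read off from [y], one through [E'] and one
    through [E] at [n]. *)
Lemma resolvent_estimate b : b \is a GRing.unit -> opnorm b^-1 < radius ->
  exists y : A', is_inverse (emb b - s) y /\
    forall n, (0 < n)%N -> cent_norm (E' y - E ((y : bseq C m) n)) <= rsqrt n.
Proof.
move=> bU br; set c := b^-1.
have [G1 GK] := growth_ge X_bounded.
have K1 := mom_const_ge1 X_bounded.
have q0 : 0 < (m.+1 ^ 2)%:R :> R by rewrite ltr0n expn_gt0.
have cG : cent_norm c * (2 * G) <= 1.
  have G2 : 0 < 2 * G by lra.
  rewrite -ler_pdivlMr // mul1r; apply: le_trans (cent_norm_le_opnorm _) _.
  rewrite -ler_pdivlMl // -invfM; exact: ltW.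
have c0 := cent_norm_ge0 c.
have SK n : ent_norm (S n) <= K.
  exact: (ent_norm_S tau_state tau_faithful X_free X_centered X_bounded).
have eS n : ent_norm (iota c * S n) <= 2^-1.
  apply: le_trans (ler_ent_normM _ _) _; rewrite ent_norm_embed.
  have := SK n; have := ent_norm_ge0 (S n); nra.
have [x [ax xa]] : exists x : A', (1 - emb c * s) * x = 1 /\ x * (1 - emb c * s) = 1.
  apply: neumann_inverse; apply: bseq_norm_le => //; apply: bseq_bound_ent => //.
pose y := x * emb c.
have Eb : emb b - s = emb b * (1 - emb c * s).
  by rewrite mulrBr mulr1 mulrA -rmorphM /= divrr // rmorph1 mul1r.
have yinv : is_inverse (emb b - s) y.
  split; rewrite Eb /y.
    by rewrite mulrA -[emb b * _ * x]mulrA ax mulr1 -rmorphM /= divrr // rmorph1.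
  by rewrite mulrA -[x * _ * emb b]mulrA -rmorphM /= mulVr // rmorph1 mulr1.
exists y; split=> // n n0.
pose z k := (y : bseq C m) k.
have z_eq k : z k = iota c + iota c * S k * z k.
  have : x = 1 + emb c * s * x by rewrite -[X in X + _]ax mulrBl mul1r subrK.
  move=> /(congr1 (fun x => x * emb c)); rewrite mulrDl mul1r -[_ * x * _]mulrA -/y.
  by move=> /(congr1 (fun a : bseq C m => a k)).
(* A finite Neumann expansion with remainder, so that only moments of bounded length are compared
   and no infinite sum of expectations appears. *)
have zp k p : z k = (\sum_(j < p) rmono (S k) (nseq j c)) * iota c
    + rmono (S k) (nseq p c) * z k.
  elim: p => [|p IH]; first by rewrite big_ord0 mul0r add0r rmono_nil mul1r.
  rewrite big_ord_recr mulrDl -addrA {1}IH; congr (_ + _).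
  rewrite {1}z_eq mulrDr; congr (_ + _); rewrite mulrA; congr (_ * _).
  by rewrite !rmono_nseq exprSr.
have [Z hZ] := bseqP y.
have rem k p : cent_norm (E (rmono (S k) (nseq p c) * z k)) <= 2^-1 ^+ p * Z.
  apply: le_trans (cent_norm_expect tau_state _) _.
  elim: p => [|p IH]; first by rewrite rmono_nil !mul1r; exact: hZ.
  rewrite /= rmono_cons -mulrA; apply: le_trans (ler_ent_normM _ _) _.
  by rewrite exprS -mulrA; apply: ler_pM; rewrite ?ent_norm_ge0.
have diff l : (0 < l)%N -> cent_norm (E (z n) - E (z l)) <= rsqrt n + rsqrt l.
  move=> l0; set e := rsqrt n + _.
  have e0 : 0 <= e by rewrite addr_ge0 // rsqrt_ge0.
  have term j : cent_norm (E (rmono (S n) (nseq j c)) - E (rmono (S l) (nseq j c)))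
      <= 2^-1 ^+ j * e.
    have H : cent_norm (E (rmono (S n) (nseq j c)) - E (rmono (S l) (nseq j c)))
        <= G ^+ size (nseq j c) * weight (nseq j c) * e.
      apply: (expect_rmono_diff X_bounded) => // bs _.
      exact: (moment_diff tau_state tau_faithful X_free X_centered X_dist X_bounded).
    apply: le_trans H _; rewrite ler_wpM2r // size_nseq.
    elim: j => [|j IH]; first by rewrite /weight big_nil !expr0 mulr1.
    rewrite /= weight_cons !exprS mulrACA; apply: ler_pM => //.
    - by rewrite mulr_ge0 //; lra.
    - by rewrite mulr_ge0 ?weight_ge0 ?exprn_ge0 //; lra.
    - by lra.
  (* The order [p] of the expansion is arbitrary: the remainders of both sides are at most
     [2^-1 ^+ p * Z], and they disappear as [p] grows. *)
  rewrite -subr_le0; apply: (@le0_of_le_geometric _ _ (2 * Z) 2^-1).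
    by apply/andP; split; lra.
  move=> p; rewrite lerBlDr.
  have sum_le : \sum_(j < p) 2^-1 ^+ j * e <= 2 * e.
    rewrite -mulr_suml ler_wpM2r //; elim: p => [|p IH]; first by rewrite big_ord0.
    rewrite big_ord_recl expr0; under eq_bigr => j _ do rewrite lift0 exprS.
    by rewrite -mulr_sumr; lra.
  have -> : E (z n) - E (z l) =
     (\sum_(j < p) (E (rmono (S n) (nseq j c)) - E (rmono (S l) (nseq j c)))) * c
     + (E (rmono (S n) (nseq p c) * z n) - E (rmono (S l) (nseq p c) * z l)).
    rewrite sumrB mulrBl {1}(zp n p) {1}(zp l p) !raddfD /= !mx_expect_mulr //.
    by rewrite !raddf_sum addrACA.
  apply: le_trans (ler_cent_normD _ _) _; rewrite [leRHS]addrC lerD //.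
    apply: le_trans (ler_cent_normM _ _) _.
    apply: (@le_trans _ _ (2 * e * cent_norm c)).
      rewrite ler_wpM2r //; apply: le_trans sum_le.
      apply: le_trans (ler_cent_norm_sum _ _ _) _.
      by apply: ler_sum => j _; exact: term.
    nra.
  apply: le_trans (ler_cent_normD _ _) _; rewrite cent_normN.
  have := rem n p; have := rem l p; lra.
apply: le_trans (_ : _ <= _); first by rewrite cent_norm_distC.
(* Letting [l] run along the ultrafilter replaces the component at [l] by [E' y] and removes
   [rsqrt l]. *)
apply: (mxlim_norm_le (d := 1) _ (bseq_expectP y)) => // l l0.
by rewrite mul1r; exact: diff.
Qed.

End CentralLimit.

Lemma mx_cnorm_uniform_bound (R : realType) (C : cstarAlgType R) (tau : {scalar C})
    (m : nat) (X : nat -> 'M[C]_m.+1) : is_state tau -> faithful_state tau ->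
  (ereal_sup (range (fun i => mx_cnorm (X i))) < +oo)%E ->
  exists B : R, forall i, ent_norm (X i) <= B.
Proof.
move=> tau_state tau_faithful hs.
have [B B0 hB] : exists2 B : R, 0 <= B & forall i, (mx_cnorm (X i) <= B%:E)%E.
  set s := ereal_sup _ in hs.
  have sX i : (mx_cnorm (X i) <= s)%E by apply: ereal_sup_ubound; exists i.
  exists (Num.max 0 (fine s)) => [|i]; first by rewrite le_max lexx.
  apply: le_trans (sX i) _; move: hs; case: s {sX} => [r|//|] _ /=.
    by rewrite lee_fin le_max lexx orbT.
  exact: leNye.
exists ((m.+1 ^ 2)%:R * B) => i; apply: ent_norm_le_entries => k l.
exact: (cnorm_le_mx_cnorm tau_state tau_faithful).
Qed.

(* The size of the matrices is m.+1, and X_1, X_2, ... are X 0, X 1, ... *)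
Theorem theorem1p1 (R : realType) (C : cstarAlgType R) (tau : {scalar C})
    (m : nat) (X : nat -> 'M[C]_m.+1) :
  let iota := @mx_embed R C m in
  let E := @mx_expect R C m tau in
  let S := normalized_sum X in
  is_state tau ->
  faithful_state tau ->
  (forall i, X i <> 0) ->
  same_star_distribution (@mx_star R C m) iota E X ->
  (forall i, E (X i) = 0) ->
  star_free (@mx_star R C m) iota E X ->
  (ereal_sup (range (fun i => mx_cnorm (X i))) < +oo)%E ->
  exists (A' : opCStarProbSpace R m) (s : A'),
    [/\ semicircular op_embed op_expect s,
        forall i b, op_covariance op_embed op_expect s b = op_covariance iota E (X i) b,
        converges_in_distribution iota E S s &
        exists (kappa c K : R) (N : nat),
          [/\ 0 < kappa, 1 < c, 0 < K &
              forall b, Omega kappa c b ->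
                resolvent_set op_embed s b /\
                forall n, (N <= n)%N ->
                  resolvent_set iota (S n) b /\
                  opnorm (cauchy_transform op_embed op_expect s b
                          - cauchy_transform iota E (S n) b)
                    <= K * (Num.sqrt n%:R)^-1 * opnorm b]].
Proof.
move=> iota E S tau_state tau_faithful _ X_dist X_centered X_free X_norm.
have [B X_bounded] := mx_cnorm_uniform_bound tau_state tau_faithful X_norm.
exists (cbseq m tau_state tau_faithful).
exists (limit_sum tau_state tau_faithful X_free X_centered X_bounded); split.
- exact: semicircular_limit.
- move=> i b; rewrite (covariance_limit tau_state tau_faithful X_free X_centered X_dist).
  by rewrite (covariance_eq X_dist).
- exact: converges_limit.
have r0 : 0 < radius C m B.
  have [G1 _] := growth_ge X_bounded.
  by rewrite invr_gt0 mulr_gt0 ?ltr0n ?expn_gt0 //; lra.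
set q : R := (m.+1 ^ 2)%:R.
have q0 : 0 < q by rewrite ltr0n expn_gt0.
(* The resolvent estimate gives the rate [rsqrt n] without the factor [opnorm b]. On [Omega] this
   factor is bounded below: [1 <= cent_norm (b * b^-1)], which is at most
   [q * q * opnorm b * opnorm b^-1] and hence at most [q * q * radius * opnorm b]. This is the
   origin of the third constant. *)
exists (radius C m B), 2, (q * q * radius C m B), 1%N; split=> //.
- by lra.
- by rewrite !mulr_gt0.
move=> b [bU br _].
have [y [yinv hy]] := resolvent_estimate tau_state tau_faithful X_free X_centered X_dist
  X_bounded bU br.
split; first by exists y.
move=> n n1.
have yn : is_inverse (iota b - S n) ((y : bseq C m) n).
  by case: yinv => h1 h2; split; [move/(congr1 (fun a : bseq C m => a n)) : h1
                                 |move/(congr1 (fun a : bseq C m => a n)) : h2].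
split; first by exists ((y : bseq C m) n).
rewrite (cauchy_transformE _ yinv) (cauchy_transformE _ yn).
apply: le_trans (opnorm_le_cent _) _; apply: le_trans (hy n n1) _.
have rb : 1 <= q * q * radius C m B * opnorm b.
  have one : 1 <= cent_norm (b * b^-1).
    rewrite divrr //; apply: le_trans (cent_norm_ge _ 0 0).
    by rewrite mxE eqxx ComplexField.Normc.normc1.
  apply: le_trans one _; apply: le_trans (ler_cent_normM _ _) _.
  have := cent_norm_le_opnorm b; have := cent_norm_le_opnorm b^-1; rewrite -/q => h2 h1.
  apply: le_trans (ler_pM (cent_norm_ge0 _) (cent_norm_ge0 _) h1 h2) _.
  have := ltW br; have := opnorm_ge0 b => ob h.
  have -> : q * q * radius C m B * opnorm b = q * opnorm b * (q * radius C m B) by ring.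
  by rewrite ler_wpM2l ?mulr_ge0 ?ler_wpM2l // ltW.
by rewrite mulrAC ler_peMl // rsqrt_ge0.
Qed.
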